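(* Let $X_\Sigma$ be a smooth complete fibered toric variety with $\Sigma=\Sigma_B\ltimes_\Phi\Sigma_F$ and projection $p\colon X_\Sigma\to X_{\Sigma_B}$, and let $\rho_1,\ldots,\rho_r$ be the rays of $\Sigma_F$. Then the Chern polynomial of the tangent bundle of $X_\Sigma$ is $$c(\mathcal{T}_{X_\Sigma})=p^*\bigl(c(\mathcal{T}_{X_{\Sigma_B}})\bigr)\cdot\prod_{i=1}^r\bigl(1+[\widetilde D_i]\cdot t\bigr).$$
   Context: All varieties are over $\mathbb{C}$. $T_B, T_F$ are algebraic tori with cocharacter lattices $N_B, N_F$, and $N=N_B\times N_F$. For a fan $\Sigma$, $X_\Sigma$ is the corresponding toric variety. A fibered toric variety is a toric variety $X_\Sigma$ for the torus $T=T_B\times T_F$ such that the projection $T\to T_B$ induces a toric morphism $p\colon X_\Sigma\to X_{\Sigma_B}$ which is a fiber bundle with fiber $X_{\Sigma_F}$; its fan is a twisted product $\Sigma=\Sigma_B\ltimes_\Phi\Sigma_F$ for a map $\Phi$ as follows. Cone-wise linear map: $\Phi\colon|\Sigma_B|\to N_F$ denotes a continuous map from the support of $\Sigma_B$ to $(N_F)_{\mathbb{R}}=N_F\otimes\mathbb{R}$ whose restriction to every cone $\sigma\in\Sigma_B$ is linear and integral (it maps $\sigma\cap N_B$ into $N_F$). Twisted product: $\Sigma_B\ltimes_\Phi\Sigma_F$ is the fan in $N$ with cones $\{\widetilde\sigma+\tau \mid \sigma\in\Sigma_B,\ \tau\in\Sigma_F\}$, where $\widetilde\sigma=\{(x,\Phi(x))\mid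 x\in\sigma\}$ and $\tau$ is regarded as $\{0\}\times\tau$; the morphism $p$ is induced by the projection $N\to N_B$. For each ray $\rho_i$ of $\Sigma_F$ with primitive generator $e_i$, $\widetilde D_i$ is the torus-invariant prime divisor of $X_\Sigma$ corresponding to the ray generated by $(0,e_i)\in N$, and $[\widetilde D_i]\in H^2(X_\Sigma,\mathbb{Z})$ is its Poincaré dual class. $\mathcal{T}_X$ is the tangent bundle of $X$, and the Chern polynomial is $c(\mathcal{T}_X)=\sum_{i=0}^{\dim X}c_i(\mathcal{T}_X)t^i\in H^*(X,\mathbb{Z})[t]$; $p^*$ acts coefficientwise. *)

(* Defs.v *)
From HB Require Import structures.
From mathcomp Require Import all_boot all_order all_algebra.
From mathcomp Require Import all_classical all_reals all_analysis.
From mathcomp Require Import complex freeg.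

Set Implicit Arguments.
Unset Strict Implicit.
Unset Printing Implicit Defensive.

Import Order.TTheory GRing.Theory Num.Theory.
Import numFieldNormedType.Exports.
Local Open Scope classical_set_scope.
Local Open Scope ring_scope.
Local Open Scope quotient_scope.

(* R[i], as a numFieldType so that it carries its analytic topology. *)
Definition Cplx (R : realType) : numFieldType := R[i].

Section StandardSimplex.
Variable R : realType.

Definition std_simplex (n : nat) : set 'rV[R]_n.+1 :=
  [set x | (forall i, 0 <= x 0 i) /\ \sum_i x 0 i = 1].
Arguments std_simplex n : clear implicits.

Section Maps.
Variables (m n : nat) (theta : 'I_m.+1 -> 'I_n.+1).

Definition simplex_mx : 'M[R]_(m.+1, n.+1) := \matrix_(i, j) (theta i == j)%:R.

Lemma simplex_mx_subproof (x : std_simplex m) :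
  (set_val x *m simplex_mx) \in std_simplex n.
Proof.
have [x_ge0 x_sum1] : std_simplex m (set_val x) by case: x => x xS; exact: set_mem.
apply/mem_set; split=> [j|].
  rewrite mxE sumr_ge0 // => i _.
  by rewrite mxE mulr_ge0 ?ler0n.
rewrite -x_sum1; under eq_bigr do rewrite mxE.
rewrite exchange_big /=; apply: eq_bigr => i _; rewrite -mulr_sumr.
rewrite (bigD1 (theta i)) //= mxE eqxx big1 ?addr0 ?mulr1 // => j.
by rewrite mxE eq_sym => /negbTE->.
Qed.

(* The affine map between standard simplices that is theta on vertices. *)
Definition simplex_fun (x : std_simplex m) : std_simplex n :=
  exist _ (set_val x *m simplex_mx) (simplex_mx_subproof x).

Lemma simplex_fun_continuous : continuous simplex_fun.
Proof.
apply: continuous_comp_initial => x /=.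
have -> : set_val \o simplex_fun =
    fun y => \sum_i (set_val y : 'rV[R]_m.+1) 0 i *: row i simplex_mx.
  by apply/funext => y /=; rewrite {1}set_valE /= mulmx_sum_row.
elim: (index_enum _) => [|i r cr].
  under [X in continuous_at _ X]eq_fun do rewrite big_nil.
  exact: cst_continuous.
under [X in continuous_at _ X]eq_fun do rewrite big_cons.
have ci : (fun y : std_simplex m => (set_val y : 'rV[R]_m.+1) 0 i) @ x -->
    (set_val x : 'rV[R]_m.+1) 0 i.
  apply: (@cvg_comp _ _ _ set_val (fun M : 'rV[R]_m.+1 => M 0 i)).
    exact: initial_continuous.
  exact: coord_continuous.
have cz := cvgZr_tmp (a := row i simplex_mx) ci.
exact: (cvgD (cz _) cr).
Qed.

Definition simplex_map : continuousType (std_simplex m) (std_simplex n) :=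
  mkcts simplex_fun_continuous.

End Maps.
End StandardSimplex.
Arguments std_simplex R n : clear implicits.

Section SingularCohomology.
Variables (R : realType) (X : topologicalType).

Definition simplex (n : nat) : Type := continuousType (std_simplex R n) X.
HB.instance Definition _ n := Choice.on (simplex n).

Definition face m n (theta : 'I_m.+1 -> 'I_n.+1) (s : simplex n) : simplex m :=
  s \o simplex_map R theta.

(* The front i-face and the back j-face of an n-simplex; used with n = i + j. *)
Definition front n i : 'I_i.+1 -> 'I_n.+1 := fun k => inord k.
Definition back n j : 'I_j.+1 -> 'I_n.+1 := fun k => inord (n - j + k).

Definition cochain (n : nat) : zmodType := simplex n -> int.

Definition codiff n (phi : cochain n) : cochain n.+1 :=
  fun s => \sum_(i < n.+2) (-1) ^+ i * phi (face (fintype.lift i) s).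

Definition cocycle n : {pred cochain n} := fun phi => `[< codiff phi = 0 >].

Lemma cocycle_zmod n : zmod_closed (@cocycle n).
Proof.
split=> [|phi psi /asboolP phi0 /asboolP psi0]; apply/asboolP; apply/funext=> s.
  by rewrite /codiff big1 // => i _; rewrite mulr0.
rewrite /codiff; under eq_bigr do rewrite mulrBr.
rewrite big_split /= sumrN.
by rewrite [X in X - _](congr1 (@^~ s) phi0) [X in _ - X](congr1 (@^~ s) psi0) subrr.
Qed.
HB.instance Definition _ n := GRing.isZmodClosed.Build _ (@cocycle n) (@cocycle_zmod n).

Record cocycles (n : nat) := Cocycle
  { cocycle_val :> cochain n ; _ : cocycle_val \in @cocycle n }.
HB.instance Definition _ n := [isSub for @cocycle_val n].
HB.instance Definition _ n := [Choice of cocycles n by <:].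
HB.instance Definition _ n := [SubChoice_isSubZmodule of cocycles n by <:].

Definition is_coboundary n : cochain n -> Prop :=
  match n with
  | 0 => fun phi => phi = 0
  | k.+1 => fun phi => exists psi : cochain k, phi = codiff psi
  end.

Definition coboundary n : {pred cocycles n} :=
  fun phi => `[< is_coboundary (cocycle_val phi) >].

Lemma coboundary_zmod n : zmod_closed (@coboundary n).
Proof.
split=> [|phi psi].
  apply/asboolP; case: n => //= n; exists 0; apply/funext => s.
  by rewrite /codiff big1 // => i _; rewrite mulr0.
case: n phi psi => [|n] phi psi /asboolP/= + /asboolP/= + .
  by move=> phi0 psi0; apply/asboolP => /=; rewrite phi0 psi0 subrr.
move=> [f ff] [g gg]; apply/asboolP => /=; exists (f - g).
rewrite ff gg; apply/funext => s; rewrite /codiff.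
under [RHS]eq_bigr do rewrite mulrBr.
by rewrite big_split /= sumrN.
Qed.
HB.instance Definition _ n :=
  GRing.isZmodClosed.Build _ (@coboundary n) (@coboundary_zmod n).

(* H^n(X, Z): cocycles modulo coboundaries. *)
Definition coh n : zmodType := Quotient.quot (@coboundary n).

(* The class of a cocycle (and 0 on cochains that are not cocycles). *)
Definition coh_class n (phi : cochain n) : coh n :=
  \pi_(coh n) (insubd (0 : cocycles n) phi).

Definition coh_repr n (a : coh n) : cochain n := cocycle_val (repr a).

Definition cochain_cup i j n (phi : cochain i) (psi : cochain j) : cochain n :=
  fun s => phi (face (@front n i) s) * psi (face (@back n j) s).

(* The cup product H^i x H^j -> H^n, used with n = i + j; the index n is
   separate so that no cast between H^(i + j) and H^n is needed. *)
Definition cup i j n (a : coh i) (b : coh j) : coh n :=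
  coh_class (cochain_cup (n := n) (coh_repr a) (coh_repr b)).

Definition coh_one : coh 0 := coh_class (fun=> 1).

Definition chain (n : nat) : zmodType := {freeg (simplex n) / int}.

Definition bdry n : chain n.+1 -> chain n :=
  fglift (fun s => \sum_(i < n.+2) << (-1) ^+ i *g face (fintype.lift i) s >>).

Definition is_cycle n : chain n -> Prop :=
  match n with 0 => fun=> True | k.+1 => fun c => bdry c = 0 end.

Definition chain_in n (A : set X) (c : chain n) : Prop :=
  {in dom c, forall s : simplex n, range s `<=` A}.

(* The cap product C^i x C_n -> C_j, used with n = i + j. *)
Definition cap i n j (phi : cochain i) : chain n -> chain j :=
  fglift (fun s => << phi (face (@front n i) s) *g face (@back n j) s >>).

End SingularCohomology.

Section Pullback.
Variables (R : realType) (X Y : topologicalType) (f : continuousType X Y).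

Definition coh_pullback n (a : coh R Y n) : coh R X n :=
  coh_class (fun s : simplex R X n => coh_repr a (f \o s : simplex R Y n)).

End Pullback.

Section ChernPolynomials.
Variables (R : realType) (X : topologicalType).

(* p : cpoly stands for sum_k (p k) t^k in H^*(X, Z)[t]; the k-th coefficient of
   a Chern polynomial lies in H^(2k). *)
Definition cpoly : Type := forall k, coh R X k.*2.

Definition cpoly1 : cpoly :=
  fun k => match k with 0 => coh_one R X | _ => 0 end.

Definition cpoly_mul (p q : cpoly) : cpoly :=
  fun k => \sum_(i < k.+1) cup k.*2 (p i) (q (k - i)%N).

(* 1 + a t *)
Definition cpoly_lin (a : coh R X 2) : cpoly :=
  fun k => match k with 0 => coh_one R X | 1 => a | _ => 0 end.

End ChernPolynomials.

Definition cpoly_pullback (R : realType) (X Y : topologicalType)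
    (f : continuousType X Y) (p : cpoly R Y) : cpoly R X :=
  fun k => coh_pullback f (p k).

(* Fibre coordinates are row vectors: a vector of coordinates v in the
   trivialization i has coordinates v *m vb_trans i j x in the trivialization j. *)
Record vbundle (R : realType) (X : topologicalType) (r : nat) := VBundle {
  vb_index : Type ;
  vb_dom : vb_index -> set X ;
  vb_trans : vb_index -> vb_index -> X -> 'M[Cplx R]_r }.

Section VectorBundles.
Variables (R : realType) (X : topologicalType).

Definition is_vbundle r (E : vbundle R X r) : Prop :=
  [/\ forall i, open (vb_dom (v := E) i),
      forall x, exists i, vb_dom (v := E) i x,
      forall i j x, vb_dom i x -> vb_dom j x ->
        {for x, continuous (vb_trans (v := E) i j)},
      forall i x, vb_dom i x -> vb_trans (v := E) i i x = 1%:M &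
      forall i j k x, vb_dom i x -> vb_dom j x -> vb_dom k x ->
        vb_trans (v := E) i k x = vb_trans i j x *m vb_trans j k x].

(* A bundle map, by its matrices in all pairs of trivializations. *)
Definition is_vbundle_map r s (E : vbundle R X r) (F : vbundle R X s)
    (h : vb_index E -> vb_index F -> X -> 'M[Cplx R]_(r, s)) : Prop :=
  (forall i j x, vb_dom i x -> vb_dom j x -> {for x, continuous (h i j)}) /\
  (forall i i' j j' x, vb_dom i x -> vb_dom i' x -> vb_dom j x -> vb_dom j' x ->
     h i j x *m vb_trans j j' x = vb_trans i i' x *m h i' j' x).

(* 0 -> E -> F -> G -> 0 is exact in every fibre. *)
Definition short_exact r s t (E : vbundle R X r) (F : vbundle R X s)
    (G : vbundle R X t)
    (h : vb_index E -> vb_index F -> X -> 'M[Cplx R]_(r, s))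
    (k : vb_index F -> vb_index G -> X -> 'M[Cplx R]_(s, t)) : Prop :=
  [/\ is_vbundle_map h, is_vbundle_map k &
      forall i j l x, vb_dom i x -> vb_dom j x -> vb_dom l x ->
        [/\ row_free (h i j x), (h i j x == kermx (k j l x))%MS &
            row_full (k j l x)]].

End VectorBundles.

Definition vb_pullback (R : realType) (X Y : topologicalType) (f : X -> Y) r
    (E : vbundle R Y r) : vbundle R X r :=
  {| vb_index := vb_index E ;
     vb_dom := fun i => f @^-1` vb_dom i ;
     vb_trans := fun i j x => vb_trans i j (f x) |}.

Record chart (R : realType) (X : topologicalType) (n : nat) := Chart {
  chart_dom : set X ;
  chart_map : X -> 'rV[Cplx R]_n }.

Section ComplexManifolds.
Variables (R : realType) (X : topologicalType) (n : nat).
Implicit Types (c : chart R X n) (A : set (chart R X n)) (x : X).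

(* A homeomorphism from an open subset of X onto an open subset of C^n. *)
Definition is_chart c : Prop :=
  [/\ open (chart_dom c),
      forall x, chart_dom c x -> {for x, continuous (chart_map c)},
      {in chart_dom c &, injective (chart_map c)} &
      forall V, open V -> V `<=` chart_dom c -> open (chart_map c @` V)].

(* The local inverse of c; x only provides a value outside the image of c. *)
Definition chart_inv c x : 'rV[Cplx R]_n -> X :=
  'pinv_(fun=> x) (chart_dom c) (chart_map c).

Definition transition c c' x : 'rV[Cplx R]_n -> 'rV[Cplx R]_n :=
  chart_map c' \o chart_inv c x.

Definition compatible c c' : Prop :=
  forall x, chart_dom c x -> chart_dom c' x ->
    differentiable (transition c c' x) (chart_map c x) /\
    differentiable (transition c' c x) (chart_map c' x).

Definition complex_manifold A : Prop :=
  [/\ forall c, A c -> is_chart c,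
      forall x, exists2 c, A c & chart_dom c x &
      forall c c', A c -> A c' -> compatible c c'].

Definition holomorphic_chart A c : Prop :=
  is_chart c /\ forall c', A c' -> compatible c c'.

Definition tangent_bundle A : vbundle R X n :=
  {| vb_index := A ;
     vb_dom := fun c : A => chart_dom (set_val c) ;
     vb_trans := fun (c c' : A) x =>
       jacobian (transition (set_val c) (set_val c') x) (chart_map (set_val c) x) |}.

(* f is holomorphic on the open set U and is a local equation of D there,
   with nowhere vanishing differential along D. *)
Definition defining_function A (D U : set X) (f : X -> Cplx R) : Prop :=
  [/\ D `&` U = [set x | U x /\ f x = 0],
      forall c x, A c -> U x -> chart_dom c x ->
        differentiable (f \o chart_inv c x : 'rV[Cplx R]_n -> Cplx R)
          (chart_map c x) &
      forall c x, A c -> U x -> chart_dom c x -> D x ->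
        exists v, 'd (f \o chart_inv c x : 'rV[Cplx R]_n -> Cplx R)
          (chart_map c x) v != 0].

(* L is the line bundle O(D) of the smooth hypersurface D: the f i are the
   coordinates of the canonical section of O(D). *)
Definition is_divisor_bundle A (D : set X) (L : vbundle R X 1) : Prop :=
  exists f : vb_index L -> X -> Cplx R,
    (forall i, defining_function A D (vb_dom i) (f i)) /\
    (forall i j x, vb_dom i x -> vb_dom j x ->
       f j x = f i x * vb_trans i j x 0 0).

(* The affine map from the standard 2d-simplex to C^d = C^d x 0 in C^n sending
   vertex 2k+1 to e_k, vertex 2k+2 to 'i e_k and vertex 0 to minus the sum of
   the others; it is positively oriented for the complex orientation and has 0
   in its interior. *)
Definition oriented_simplex (d : nat) (t : 'rV[R]_d.*2.+1) : 'rV[Cplx R]_n :=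
  \row_k (if (k < d)%N then
    ((t 0 (inord k.*2.+1) - t 0 ord0) +i* (t 0 (inord k.*2.+2) - t 0 ord0))%C
  else 0).

(* Holomorphic coordinates of X centred at x, in which Z is C^d x 0. *)
Definition adapted_chart A (Z : set X) (d : nat) x c : Prop :=
  [/\ holomorphic_chart A c, chart_dom c x, chart_map c x = 0 &
      Z `&` chart_dom c =
        [set y | chart_dom c y /\ forall k : 'I_n, (d <= k)%N -> chart_map c y 0 k = 0]].

(* mu is a fundamental cycle of the compact d-dimensional complex submanifold Z
   of X: a cycle in Z that is, for every point x of Z, homologous modulo
   Z \ x to a small positively oriented simplex around x. *)
Definition fundamental_cycle A (Z : set X) (d : nat) (mu : chain R X d.*2) : Prop :=
  [/\ is_cycle mu, chain_in Z mu &
      forall x c (s : simplex R X d.*2), Z x -> adapted_chart A Z d x c ->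
        (forall t, chart_dom c (s t) /\
                   chart_map c (s t) = oriented_simplex (set_val t)) ->
        exists (b : chain R X d.*2) (e : chain R X d.*2.+1),
          [/\ chain_in (Z `\ x) b, chain_in Z e & mu = << s >> + b + bdry e]].

(* eta cap [X] is the image of [D], for D a smooth hypersurface. *)
Definition is_poincare_dual A (D : set X) (eta : coh R X 2) : Prop :=
  exists (mu : chain R X n.*2) (nu : chain R X n.-1.*2)
         (e : chain R X n.-1.*2.+1),
    [/\ fundamental_cycle A [set: X] mu, fundamental_cycle A D nu &
        cap n.-1.*2 (coh_repr eta) mu = nu + bdry e].

Definition poincare_dual A (D : set X) : coh R X 2 :=
  xget 0 [set eta | is_poincare_dual A D eta].

End ComplexManifolds.

(* The Grothendieck-Hirzebruch axioms.  Chern classes with values in integral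
   singular cohomology are the unique assignment satisfying them: chern_divisor
   for a hyperplane of projective space gives the usual normalization. *)
Record chern_theory (R : realType) := ChernTheory {
  chern : forall (X : topologicalType) (r : nat), vbundle R X r -> cpoly R X ;
  chern0 : forall (X : topologicalType) (r : nat) (E : vbundle R X r),
    is_vbundle E -> chern E 0 = coh_one R X ;
  chern_gt_rank : forall (X : topologicalType) (r : nat) (E : vbundle R X r) k,
    is_vbundle E -> (r < k)%N -> chern E k = 0 ;
  chern_pullback : forall (X Y : topologicalType) (f : continuousType X Y)
      (r : nat) (E : vbundle R Y r),
    is_vbundle E -> chern (vb_pullback f E) = cpoly_pullback f (chern E) ;
  chern_short_exact : forall (X : topologicalType) (r s t : nat)
      (E : vbundle R X r) (F : vbundle R X s) (G : vbundle R X t)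
      (h : vb_index E -> vb_index F -> X -> 'M[Cplx R]_(r, s))
      (k : vb_index F -> vb_index G -> X -> 'M[Cplx R]_(s, t)),
    is_vbundle E -> is_vbundle F -> is_vbundle G -> short_exact h k ->
    chern F = cpoly_mul (chern E) (chern G) ;
  chern_divisor : forall (X : topologicalType) (n : nat)
      (A : set (chart R X n)) (D : set X) (L : vbundle R X 1),
    compact [set: X] -> hausdorff_space X -> complex_manifold A ->
    is_vbundle L -> is_divisor_bundle A D L ->
    chern L = cpoly_lin (poincare_dual A D) }.

(* Conventions: N = 'rV[int]_n, N_R = 'rV[R]_n and M = 'cV[int]_n, paired by
   the matrix product u *m m. *)

Section Fans.
Variable R : realType.

Definition realmx m n (u : 'M[int]_(m, n)) : 'M[R]_(m, n) := map_mx intr u.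

(* The cone generated by the rows of u. *)
Definition cone k n (u : 'M[int]_(k, n)) : set 'rV[R]_n :=
  [set a *m realmx u | a in [set a : 'rV[R]_k | forall i, 0 <= a 0 i]].

Section Rank.
Variable n : nat.
Implicit Types (sigma tau : set 'rV[R]_n) (Sigma : set (set 'rV[R]_n)).

Definition is_face tau sigma : Prop :=
  exists2 m : 'cV[R]_n, (forall x, sigma x -> 0 <= (x *m m) 0 0) &
    tau = [set x | sigma x /\ (x *m m) 0 0 = 0].

Definition rational_polyhedral sigma : Prop :=
  exists k (u : 'M[int]_(k, n)), sigma = cone u.

Definition strongly_convex sigma : Prop :=
  forall x, sigma x -> sigma (- x) -> x = 0.

Definition is_fan Sigma : Prop :=
  [/\ finite_set Sigma /\ Sigma !=set0,
      forall sigma, Sigma sigma ->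
        rational_polyhedral sigma /\ strongly_convex sigma,
      forall sigma tau, Sigma sigma -> is_face tau sigma -> Sigma tau &
      forall sigma tau, Sigma sigma -> Sigma tau ->
        is_face (sigma `&` tau) sigma /\ is_face (sigma `&` tau) tau].

Definition support Sigma : set 'rV[R]_n := \bigcup_(sigma in Sigma) sigma.

(* Every cone is generated by part of a basis of N. *)
Definition smooth_fan Sigma : Prop :=
  forall sigma, Sigma sigma ->
    exists (e : 'M[int]_n) k (j : 'I_k -> 'I_n),
      [/\ e \in unitmx, injective j & sigma = cone (rowsub j e)].

Definition complete_fan Sigma : Prop := support Sigma = setT.

Definition primitive (u : 'rV[int]_n) : Prop :=
  forall (k : int) (v : 'rV[int]_n), u = k *: v -> `|k| = 1.

(* e lists, without repetition, the primitive generators of the rays. *)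
Definition ray_generators Sigma r (e : 'I_r -> 'rV[int]_n) : Prop :=
  injective e /\
  (forall u, (primitive u /\ Sigma (cone u)) <-> exists i, u = e i).

End Rank.

Section TwistedProduct.
Variables b f : nat.

Definition conewise_linear (SigmaB : set (set 'rV[R]_b))
    (Phi : 'rV[R]_b -> 'rV[R]_f) : Prop :=
  {within support SigmaB, continuous Phi} /\
  (forall sigma, SigmaB sigma ->
     (exists L : 'M[R]_(b, f), forall x, sigma x -> Phi x = x *m L) /\
     (forall u : 'rV[int]_b, sigma (realmx u) ->
        exists v : 'rV[int]_f, Phi (realmx u) = realmx v)).

Definition twisted_product (SigmaB : set (set 'rV[R]_b))
    (Phi : 'rV[R]_b -> 'rV[R]_f) (SigmaF : set (set 'rV[R]_f)) :
    set (set 'rV[R]_(b + f)) :=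
  [set [set row_mx x (Phi x) + row_mx 0 y | x in sigma & y in tau]
     | sigma in SigmaB & tau in SigmaF].

End TwistedProduct.

Section ToricVarieties.
Variables (n : nat) (Sigma : set (set 'rV[R]_n)).
Implicit Types (sigma tau : set 'rV[R]_n) (m : 'cV[int]_n).

(* S_sigma, the monoid of lattice points of the dual cone of sigma; its group of
   units is perp sigma. *)
Definition dual_monoid sigma : set 'cV[int]_n :=
  [set m | forall x, sigma x -> 0 <= (x *m realmx m) 0 0].

Definition perp sigma : set 'cV[int]_n :=
  [set m | forall x, sigma x -> (x *m realmx m) 0 0 = 0].

(* A complex point of the affine chart U_sigma = Spec C[S_sigma] is a monoid
   morphism S_sigma -> (C, * ).  A point of X_Sigma is given by the smallest
   chart U_tau containing it and by its monoid morphism there; tau is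
   the smallest such cone exactly when the morphism is nonzero only on the
   units of S_tau, i.e. when the point lies in the torus orbit O(tau).  The
   morphism is extended by 0 outside S_tau. *)
Record toric_variety : Type := ToricPoint {
  orbit_cone : set 'rV[R]_n ;
  character : 'cV[int]_n -> Cplx R ;
  orbit_cone_in : Sigma orbit_cone ;
  character0 : character 0 = 1 ;
  characterD : forall m m', dual_monoid orbit_cone m ->
    dual_monoid orbit_cone m' -> character (m + m') = character m * character m' ;
  character_neq0 : forall m, character m != 0 <-> perp orbit_cone m }.

HB.instance Definition _ := gen_eqMixin toric_variety.
HB.instance Definition _ := gen_choiceMixin toric_variety.

Definition toric_chart sigma : set toric_variety :=
  [set x | is_face (orbit_cone x) sigma].

(* The analytic topology: the charts are open, and carry the initial
   topology for the characters m : U_sigma -> C, m in S_sigma. *)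
Definition toric_subbase : set (set toric_variety) :=
  [set U | exists sigma m (V : set (Cplx R)),
     [/\ Sigma sigma, dual_monoid sigma m, open V &
         U = [set x | toric_chart sigma x /\ V (character x m)]]].

HB.instance Definition _ :=
  isSubBaseTopological.Build toric_variety toric_subbase id.

(* The charts U_sigma = C^n of the n-dimensional smooth cones, with
   coordinates the dual basis of the basis of N generating sigma. *)
Definition toric_atlas : set (chart R toric_variety n) :=
  [set c | exists e : 'M[int]_n,
     [/\ e \in unitmx, Sigma (cone e),
         chart_dom c = toric_chart (cone e) &
         chart_map c = fun x => \row_j character x (col j (invmx e))]].

(* The closure of the orbit O(rho). *)
Definition toric_divisor (rho : set 'rV[R]_n) : set toric_variety :=
  closure [set x | orbit_cone x = rho].

End ToricVarieties.

(* p is the toric morphism induced by the lattice map u |-> u *m phi. *)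
Definition is_toric_morphism n n' (Sigma : set (set 'rV[R]_n))
    (Sigma' : set (set 'rV[R]_n')) (phi : 'M[int]_(n, n'))
    (p : toric_variety Sigma -> toric_variety Sigma') : Prop :=
  forall sigma sigma', Sigma sigma -> Sigma' sigma' ->
    (forall x, sigma x -> sigma' (x *m realmx phi)) ->
    forall x, toric_chart sigma x ->
      toric_chart sigma' (p x) /\
      forall m, dual_monoid sigma' m -> character (p x) m = character x (phi *m m).

End Fans.

Arguments cone R {k n} u.
Arguments toric_atlas {R n} Sigma.
Arguments toric_divisor {R n} Sigma rho.
Arguments is_toric_morphism {R n n'} Sigma Sigma' phi p.
Arguments cpoly1 {R X}.
Arguments cpoly_mul {R X} p q.

(* Main.v *)
(* Sublattice bases adapted to Sigma = Sigma_B |x Sigma_F are integral frames with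
   a zero lower left block, so the jacobians of the corresponding charts of
   X_Sigma are block triangular: 0 -> V -> T X_Sigma -> p^* T X_B -> 0, where V is
   the bundle of vertical vectors, and c(T X_Sigma) = c(V) p^* c(T X_B).
   Completeness makes the primitive generators u_1, ..., u_r of the rays of
   Sigma_F span N_F, and they give a relative Euler sequence
   0 -> O^(r - f) -> O(D_1) + ... + O(D_r) -> V -> 0; in the charts the last map
   has entries <u_l, m_k> chi^(m_k - mu_l), with m_k the vertical part of the dual
   frame and chi^mu_l the local equation of D_l.  Hence
   c(V) = prod_l (1 + [D_l] t), by the axiom c(O(D)) = 1 + [D] t.
   Trivial bundles have c = 1 since they are pulled back from a point, and the
   Chern polynomials of two bundles commute because a direct sum is an extension
   in both orders; this replaces graded commutativity of the cup product. *)
From mathcomp Require Import all_boot all_order all_algebra.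
From mathcomp Require Import all_classical all_reals all_analysis.
From mathcomp Require Import perm complex finmap.
Require Import Defs.

Set Implicit Arguments.
Unset Strict Implicit.
Unset Printing Implicit Defensive.

Import Order.TTheory GRing.Theory Num.Theory.
Import numFieldNormedType.Exports.
Local Open Scope classical_set_scope.
Local Open Scope ring_scope.

(** * Transition cocycles and Chern classes *)

(** The axiom for divisor bundles asks for a compact Hausdorff manifold, while a toric variety is
    given only by points, characters and a subbase; much of the work derives both properties from
    the fan. Two points are separated by a lattice functional found with an integral form of Farkas'
    lemma. Compactness comes from finitely many images of polysquares: the chart of a point is found
    by following the direction [- ln] of the moduli of its coordinates. The unit law, the
    commutativity and the independence of trivializations are all derived from exact sequences;
    cochains are computed with on a point only. Every transition matrix has entries of the form
    integer times character, so that identities between bundles become identities between integer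
    matrices. The price is to check that each nonzero entry has its exponent in the dual monoid of
    the orbit cone: characters are extended by 0, and multiplicativity is granted on that monoid.
    Smoothness and completeness concern the total fan; frames of the base and of the fibre are read
    off as diagonal blocks of adapted frames. *)

Lemma cvg_mx (T : Type) (K : topologicalType) m n (F : set_system T) {FF : Filter F}
    (f : T -> 'M[K]_(m, n)) (M : 'M[K]_(m, n)) :
  (forall i j, (fun x => f x i j) @ F --> M i j) -> f @ F --> M.
Proof.
move=> cf A [P MP sPA]; rewrite /= /nbhs /=.
have : \forall x \near F, forall i j, P i j (f x i j).
  by apply: filter_forall => i; apply: filter_forall => j; exact: cf.
by apply: filterS => x Px; apply: sPA.
Qed.

Lemma cvg_coord (T : Type) (K : numFieldType) m n (F : set_system T)
    (f : T -> 'M[K]_(m, n)) (M : 'M[K]_(m, n)) i j :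
  f @ F --> M -> (fun x => f x i j) @ F --> M i j.
Proof.
move=> fM.
exact: (cvg_comp f (fun N : 'M[K]_(m, n) => N i j) fM (@coord_continuous _ _ _ _ _ M)).
Qed.

Lemma cvg_mulmx (T : Type) (K : numFieldType) m n p (F : set_system T)
    {FF : Filter F} (f : T -> 'M[K]_(m, n)) (g : T -> 'M[K]_(n, p))
    (A : 'M[K]_(m, n)) (B : 'M[K]_(n, p)) :
  f @ F --> A -> g @ F --> B -> (fun x => f x *m g x) @ F --> A *m B.
Proof.
move=> fA gB; apply: cvg_mx => i j; rewrite mxE.
under eq_fun do rewrite mxE.
apply: cvg_big => [|k _]; first exact: add_continuous.
by apply: cvgM; apply: cvg_coord.
Qed.

Section RowMxExact.
Variables (K : fieldType) (r s : nat).

(** Matrices act on row vectors from the right, so this is a fibre of 0 -> E -> E + G -> G -> 0. The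
    next lemma reads the same sum as an extension in the other order. *)
Lemma row_mx_10_exact :
  [/\ row_free (row_mx 1%:M 0 : 'M[K]_(r, r + s)),
      (row_mx 1%:M 0 == kermx (col_mx 0 1%:M : 'M[K]_(r + s, s)))%MS &
      row_full (col_mx 0 1%:M : 'M[K]_(r + s, s))].
Proof.
have f10 : row_free (row_mx 1%:M 0 : 'M[K]_(r, r + s)).
  by rewrite /row_free -mxrank_tr tr_row_mx trmx0 trmx1 rank_col_mx0 mxrank1.
have f01 : row_full (col_mx 0 1%:M : 'M[K]_(r + s, s)).
  by rewrite /row_full rank_col_0mx mxrank1.
split=> //; apply/andP; split.
  by apply/sub_kermxP; rewrite mul_row_col mul1mx mul0mx addr0.
rewrite -{1}[kermx _]hsubmxK; have := mulmx_ker (col_mx 0 1%:M : 'M[K]_(r + s, s)).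
rewrite -{1}[kermx _]hsubmxK mul_row_col mulmx0 add0r mulmx1 => ->.
apply/submxP; exists (lsubmx (kermx (col_mx 0 1%:M : 'M[K]_(r + s, s)))).
by rewrite mul_mx_row mulmx1 mulmx0.
Qed.

Lemma row_mx_01_exact :
  [/\ row_free (row_mx 0 1%:M : 'M[K]_(s, r + s)),
      (row_mx 0 1%:M == kermx (col_mx 1%:M 0 : 'M[K]_(r + s, r)))%MS &
      row_full (col_mx 1%:M 0 : 'M[K]_(r + s, r))].
Proof.
have f01 : row_free (row_mx 0 1%:M : 'M[K]_(s, r + s)).
  by rewrite /row_free -mxrank_tr tr_row_mx trmx0 trmx1 rank_col_0mx mxrank1.
have f10 : row_full (col_mx 1%:M 0 : 'M[K]_(r + s, r)).
  by rewrite /row_full rank_col_mx0 mxrank1.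
split=> //; apply/andP; split.
  by apply/sub_kermxP; rewrite mul_row_col mul0mx mulmx0 addr0.
rewrite -{1}[kermx _]hsubmxK; have := mulmx_ker (col_mx 1%:M 0 : 'M[K]_(r + s, r)).
rewrite -{1}[kermx _]hsubmxK mul_row_col mulmx0 addr0 mulmx1 => ->.
apply/submxP; exists (rsubmx (kermx (col_mx 1%:M 0 : 'M[K]_(r + s, r)))).
by rewrite mul_mx_row mulmx1 mulmx0.
Qed.

Lemma idmx_0_exact :
  [/\ row_free (1%:M : 'M[K]_r), (1%:M == kermx (0 : 'M[K]_(r, 0)))%MS &
      row_full (0 : 'M[K]_(r, 0))].
Proof.
split; rewrite ?row_free_unit ?unitmx1 //.
  by apply/andP; split; [apply/sub_kermxP; rewrite mulmx0 | exact: submx1].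
by rewrite /row_full mxrank0.
Qed.

Lemma zeromx_1_exact :
  [/\ row_free (0 : 'M[K]_(0, r)), (0 : 'M[K]_(0, r)) == kermx (1%:M : 'M[K]_r) &
      row_full (1%:M : 'M[K]_r)]%MS.
Proof.
split; rewrite ?row_full_unit ?unitmx1 //.
  by rewrite /row_free mxrank0.
apply/andP; split; first exact: sub0mx.
by have := mulmx_ker (1%:M : 'M[K]_r); rewrite mulmx1 => ->; exact: sub0mx.
Qed.

End RowMxExact.

(* Transition functions over an arbitrary field: is_vbundle at K = C.  Keeping K
   abstract prevents the unfolding of the structures of C during unification. *)
Section Cocycles.
Variables (K : numFieldType) (X : topologicalType).
Implicit Types r s t : nat.

Definition is_transition (I : Type) (dom : I -> set X) r
    (g : I -> I -> X -> 'M[K]_r) : Prop :=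
  [/\ forall i, open (dom i),
      forall x, exists i, dom i x,
      forall i j x, dom i x -> dom j x -> {for x, continuous (g i j)},
      forall i x, dom i x -> g i i x = 1%:M &
      forall i j k x, dom i x -> dom j x -> dom k x ->
        g i k x = g i j x *m g j k x].

Lemma transition_unit (I : Type) (dom : I -> set X) r (g : I -> I -> X -> 'M[K]_r) i j x :
  is_transition dom g -> dom i x -> dom j x -> g i j x \in unitmx.
Proof.
move=> [_ _ _ g1 gM] ix jx.
by have := gM i j i x ix jx ix; rewrite g1 // => /esym/mulmx1_unit[].
Qed.

(** Continuity is only tested at points of an overlap, which is open. A jacobian can thus be
    replaced by a closed formula that holds on overlaps. *)
Lemma is_transition_ext (I : Type) (dom : I -> set X) r (g g' : I -> I -> X -> 'M[K]_r) :
  is_transition dom g -> (forall i j x, dom i x -> dom j x -> g' i j x = g i j x) ->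
  is_transition dom g'.
Proof.
move=> [odom cov cg g1 gM] gE; split; [exact: odom|exact: cov|..].
- move=> i j x ix jx; suff : g' i j y @[y --> x] --> g' i j x by [].
  rewrite (gE i j x ix jx); apply: cvg_trans (cg i j x ix jx); apply: near_eq_cvg.
  near=> y; apply/esym/gE; near: y; exact: open_nbhs_nbhs.
- by move=> i x ix; rewrite gE // g1.
- by move=> i j k x ix jx kx; rewrite !gE // -gM.
Unshelve. all: by end_near. Qed.

Section Exact.
Variables (r s t : nat) (I J L : Type).
Variables (domE : I -> set X) (E : I -> I -> X -> 'M[K]_r).
Variables (domF : J -> set X) (F : J -> J -> X -> 'M[K]_s).
Variables (domG : L -> set X) (G : L -> L -> X -> 'M[K]_t).
Variables (a : J -> I) (b : J -> L).
Variables (h : J -> X -> 'M[K]_(r, s)) (k : J -> X -> 'M[K]_(s, t)).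

(** Matrices given in one pair of trivializations over each chart of the middle bundle determine
    those in all pairs, by composing with transition functions. The intertwining relations make the
    result independent of the chart used; continuity and exactness follow. *)
Lemma transition_short_exact :
  is_transition domE E -> is_transition domF F -> is_transition domG G ->
  (forall i, domF i `<=` domE (a i)) -> (forall i, domF i `<=` domG (b i)) ->
  (forall i x, domF i x -> {for x, continuous (h i)}) ->
  (forall i x, domF i x -> {for x, continuous (k i)}) ->
  (forall i j x, domF i x -> domF j x ->
     h i x *m F i j x = E (a i) (a j) x *m h j x) ->
  (forall i j x, domF i x -> domF j x ->
     k i x *m G (b i) (b j) x = F i j x *m k j x) ->
  (forall i x, domF i x ->
     [/\ row_free (h i x), (h i x == kermx (k i x))%MS & row_full (k i x)]) ->
  exists (H : I -> J -> X -> 'M[K]_(r, s)) (Q : J -> L -> X -> 'M[K]_(s, t)),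
  [/\ (forall i j x, domE i x -> domF j x -> {for x, continuous (H i j)}) /\
      (forall i i' j j' x, domE i x -> domE i' x -> domF j x -> domF j' x ->
         H i j x *m F j j' x = E i i' x *m H i' j' x),
      (forall i j x, domF i x -> domG j x -> {for x, continuous (Q i j)}) /\
      (forall i i' j j' x, domF i x -> domF i' x -> domG j x -> domG j' x ->
         Q i j x *m G j j' x = F i i' x *m Q i' j' x) &
      forall i j l x, domE i x -> domF j x -> domG l x ->
        [/\ row_free (H i j x), (H i j x == kermx (Q j l x))%MS &
            row_full (Q j l x)]].
Proof.
move=> vE vF vG da db ch ck hF kF ex.
have [oE _ cE E1 EM] := vE; have [oF cov cF F1 FM] := vF; have [oG _ cG G1 GM] := vG.
(* An arbitrary chart at each point, with no continuity in the point. [HE] and [QE] replace it by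
   any fixed chart around the point, where continuity can be read. *)
pose g x := projT1 (cid (cov x)); have gx x : domF (g x) x := projT2 (cid (cov x)).
pose H e i x := E e (a (g x)) x *m h (g x) x *m F (g x) i x.
pose Q i e x := F i (g x) x *m k (g x) x *m G (b (g x)) e x.
have HE e i j x : domE e x -> domF i x -> domF j x ->
    H e i x = E e (a j) x *m h j x *m F j i x.
  move=> ex' ix jx; rewrite /H (FM (g x) j i) // mulmxA -(mulmxA _ (h _ _)) hF //.
  by rewrite mulmxA -(EM e (a (g x)) (a j)) //; apply: da.
have QE e i j x : domG e x -> domF i x -> domF j x ->
    Q i e x = F i j x *m k j x *m G (b j) e x.
  move=> ex' ix jx; rewrite /Q (GM (b (g x)) (b j) e) //; try exact: db.
  by rewrite mulmxA -(mulmxA _ (k _ _)) kF // mulmxA -(FM i (g x) j).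
exists H, Q; split.
- split.
    move=> e i x ex' ix.
    have cHx : E e (a i) y *m h i y @[y --> x] --> E e (a i) x *m h i x.
      by apply: cvg_mulmx; [apply: cE => //; exact: da | exact: ch].
    have HEx : H e i x = E e (a i) x *m h i x by rewrite (HE e i i) // F1 // mulmx1.
    suff: H e i y @[y --> x] --> H e i x by [].
    rewrite HEx; apply: cvg_trans cHx; apply: near_eq_cvg.
    near=> y.
    have ey : domE e y by near: y; exact: open_nbhs_nbhs.
    have iy : domF i y by near: y; exact: open_nbhs_nbhs.
    by rewrite (HE e i i) // F1 // mulmx1.
  move=> e e' i i' x ex' e'x ix i'x.
  rewrite (HE e i i') // (HE e' i' i') // F1 // mulmx1 -mulmxA -FM // F1 // mulmx1.
  by rewrite mulmxA -EM //; apply: da.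
- split.
    move=> i e x ix ex'.
    have cQx : k i y *m G (b i) e y @[y --> x] --> k i x *m G (b i) e x.
      by apply: cvg_mulmx; [exact: ck | apply: cG => //; exact: db].
    have QEx : Q i e x = k i x *m G (b i) e x by rewrite (QE e i i) // F1 // mul1mx.
    suff: Q i e y @[y --> x] --> Q i e x by [].
    rewrite QEx; apply: cvg_trans cQx; apply: near_eq_cvg.
    near=> y.
    have ey : domG e y by near: y; exact: open_nbhs_nbhs.
    have iy : domF i y by near: y; exact: open_nbhs_nbhs.
    by rewrite (QE e i i) // F1 // mul1mx.
  move=> i i' e e' x ix i'x ex' e'x.
  rewrite (QE e i i') // (QE e' i' i') // F1 // mul1mx -mulmxA -GM //; last exact: db.
  by rewrite mulmxA.
move=> e i l x ex' ix lx.
have [hf hk kf] := ex i x ix.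
have uE : E e (a i) x \in unitmx by apply: (transition_unit vE) => //; exact: da.
have uG : G (b i) l x \in unitmx by apply: (transition_unit vG) => //; exact: db.
rewrite (HE e i i) // (QE l i i) // F1 // mulmx1 mul1mx.
split.
- by rewrite /row_free eqmxMfull ?row_full_unit.
- have eh : (E e (a i) x *m h i x :=: h i x)%MS by apply: eqmxMfull; rewrite row_full_unit.
  have ek : (kermx (k i x *m G (b i) l x) :=: kermx (k i x))%MS.
    apply/eqmxP/andP; split; apply/sub_kermxP.
      by apply: (can_inj (mulmxK uG)); rewrite mul0mx -mulmxA mulmx_ker.
    by rewrite mulmxA mulmx_ker mul0mx.
  by rewrite !eh !ek.
- by rewrite /row_full mxrankMfree ?row_free_unit.
Unshelve. all: by end_near. Qed.

End Exact.

Section OneIndex.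
Variables (I : Type) (dom : I -> set X).

Lemma is_transition_sum r s (E : I -> I -> X -> 'M[K]_r) (G : I -> I -> X -> 'M[K]_s) :
  is_transition dom E -> is_transition dom G ->
  is_transition dom (fun i j x => block_mx (E i j x) 0 0 (G i j x)).
Proof.
move=> [odom cov cE E1 EM] [_ _ cG G1 GM]; split; [exact: odom|exact: cov|..].
- move=> i j x ix jx; apply: cvg_mx => a b.
  rewrite -[a]splitK -[b]splitK.
  case: (fintype.split a) (fintype.split b) => [a'|a'] [b'|b'] /=.
  + by under eq_fun do rewrite block_mxEul; rewrite block_mxEul; apply: cvg_coord; exact: cE.
  + by under eq_fun do rewrite block_mxEur mxE; rewrite block_mxEur mxE; exact: cvg_cst.
  + by under eq_fun do rewrite block_mxEdl mxE; rewrite block_mxEdl mxE; exact: cvg_cst.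
  + by under eq_fun do rewrite block_mxEdr; rewrite block_mxEdr; apply: cvg_coord; exact: cG.
- by move=> i x ix; rewrite E1 // G1 // -scalar_mx_block.
- move=> i j k x ix jx kx; rewrite mulmx_block !mulmx0 !mul0mx !addr0 !add0r.
  by rewrite -EM // -GM.
Qed.

Definition diag_trans r (g : 'I_r -> I -> I -> X -> K) i j x : 'M[K]_r :=
  diag_mx (\row_l g l i j x).

Lemma diag_transS r (g : 'I_r.+1 -> I -> I -> X -> K) i j x :
  diag_trans g i j x =
  block_mx (g ord0 i j x)%:M 0 0 (diag_trans (fun l => g (lift ord0 l)) i j x) :> 'M[K]_(1 + r).
Proof.
have -> : diag_trans g i j x = diag_mx (row_mx (g ord0 i j x)%:M (\row_l g (lift ord0 l) i j x)).
  rewrite /diag_trans; congr diag_mx; apply/rowP => a; rewrite !mxE.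
  case: splitP => [b|b] ab; rewrite !mxE.
    by rewrite [b]ord1 mulr1n; congr g; apply/val_inj; rewrite /= ab [b]ord1.
  by congr g; apply/val_inj; rewrite /= ab.
rewrite diag_mx_row; congr block_mx; apply/matrixP => a b.
by rewrite !ord1 !mxE.
Qed.

Lemma is_transition_diag r (g : 'I_r -> I -> I -> X -> K) :
  (forall i, open (dom i)) -> (forall x, exists i, dom i x) ->
  (forall l, is_transition dom (fun i j x => (g l i j x)%:M : 'M[K]_1)) ->
  is_transition dom (diag_trans g).
Proof.
move=> odom cov vg; split; [exact: odom|exact: cov|..].
- move=> i j x ix jx; apply: cvg_mx => a b; rewrite !mxE.
  under eq_fun do rewrite !mxE.
  case: (a == b); last first.
    by rewrite mulr0n; under eq_fun do rewrite mulr0n; exact: cvg_cst.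
  rewrite mulr1n; under eq_fun do rewrite mulr1n.
  have [_ _ /(_ i j x ix jx) /= cg _ _] := vg a.
  by have := cvg_coord (i := 0) (j := 0) cg; rewrite !mxE; under eq_fun do rewrite !mxE.
- move=> i x ix; apply/matrixP => a b; rewrite !mxE.
  have [_ _ _ /(_ i x ix) /= /matrixP/(_ 0 0) + _] := vg a.
  by rewrite !mxE /= !mulr1n => ->.
- move=> i j k x ix jx kx; rewrite mulmx_diag; congr diag_mx; apply/rowP => a; rewrite !mxE.
  have [_ _ _ _ /(_ i j k x ix jx kx) /= /matrixP/(_ 0 0)] := vg a.
  by rewrite -scalar_mxM !mxE /= !mulr1n => ->.
Qed.

End OneIndex.

Lemma is_transition_trivial r : is_transition (fun=> setT) (fun (_ _ : unit) _ => 1%:M : 'M[K]_r).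
Proof.
split.
- by move=> _; exact: openT.
- by move=> x; exists tt.
- by move=> _ _ x _ _; exact: cst_continuous.
- by [].
- by move=> *; rewrite mulmx1.
Qed.

End Cocycles.

(** * Consequences of the axioms for Chern polynomials *)

Section Chern.
Variables (R : realType) (c : chern_theory R) (X : topologicalType).
Local Notation C := (Cplx R).
Implicit Types r s t : nat.

Lemma chern_exact_local r s t (I J L : Type)
    (domE : I -> set X) (E : I -> I -> X -> 'M[C]_r)
    (domF : J -> set X) (F : J -> J -> X -> 'M[C]_s)
    (domG : L -> set X) (G : L -> L -> X -> 'M[C]_t)
    (a : J -> I) (b : J -> L)
    (h : J -> X -> 'M[C]_(r, s)) (k : J -> X -> 'M[C]_(s, t)) :
  is_transition domE E -> is_transition domF F -> is_transition domG G ->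
  (forall i, domF i `<=` domE (a i)) -> (forall i, domF i `<=` domG (b i)) ->
  (forall i x, domF i x -> {for x, continuous (h i)}) ->
  (forall i x, domF i x -> {for x, continuous (k i)}) ->
  (forall i j x, domF i x -> domF j x ->
     h i x *m F i j x = E (a i) (a j) x *m h j x) ->
  (forall i j x, domF i x -> domF j x ->
     k i x *m G (b i) (b j) x = F i j x *m k j x) ->
  (forall i x, domF i x ->
     [/\ row_free (h i x), (h i x == kermx (k i x))%MS & row_full (k i x)]) ->
  chern c (VBundle domF F) = cpoly_mul (chern c (VBundle domE E)) (chern c (VBundle domG G)).
Proof.
move=> vE vF vG da db ch ck hF kF ex.
have [H [Q [mH mQ eHQ]]] := transition_short_exact vE vF vG da db ch ck hF kF ex.
exact: (@chern_short_exact _ c _ _ _ _ (VBundle domE E) (VBundle domF F)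
  (VBundle domG G) H Q vE vF vG (And3 mH mQ eHQ)).
Qed.

Definition trivial_bundle r : vbundle R X r :=
  VBundle (fun _ : unit => setT) (fun _ _ _ => 1%:M).

Lemma is_vbundle_trivial r : is_vbundle (trivial_bundle r).
Proof. exact: (is_transition_trivial C X r). Qed.

Lemma chern_trivial0 : chern c (trivial_bundle 0) = cpoly1.
Proof.
apply: functional_extensionality_dep => -[|k].
  exact: (chern0 c (is_vbundle_trivial 0)).
exact: (chern_gt_rank c (is_vbundle_trivial 0)).
Qed.

Section OneBundle.
Variables (I : Type) (domE : I -> set X) (r : nat) (E : I -> I -> X -> 'M[C]_r).
Hypothesis vE : is_transition domE E.

(** For Chern polynomials the unit law is the exact sequence 0 -> 0 -> E -> E -> 0; the cup product
    is not unfolded. *)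
Lemma cpoly1_mul_chern :
  cpoly_mul cpoly1 (chern c (VBundle domE E)) = chern c (VBundle domE E).
Proof.
rewrite -chern_trivial0; apply/esym.
apply: (chern_exact_local (a := fun=> tt) (b := id) (h := fun _ _ => 0)
  (k := fun _ _ => 1%:M) (is_transition_trivial _ _ _) vE vE).
- by move=> ? ? ?.
- by move=> ? ? ?.
- by move=> i x _; exact: cst_continuous.
- by move=> i x _; exact: cst_continuous.
- by move=> i j x _ _; rewrite mulmx0 mul0mx.
- by move=> i j x _ _; rewrite mulmx1 mul1mx.
- by move=> i x _; exact: zeromx_1_exact.
Qed.

Lemma chern_mul_trivial0 (J : Type) (domJ : J -> set X) (F : J -> J -> X -> 'M[C]_r)
    (g : J -> I) :
  is_transition domJ F -> (forall j, domJ j `<=` domE (g j)) ->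
  (forall i j x, domJ i x -> domJ j x -> F i j x = E (g i) (g j) x) ->
  chern c (VBundle domJ F) =
  cpoly_mul (chern c (VBundle domE E)) (chern c (trivial_bundle 0)).
Proof.
move=> vF subJ FE.
apply: (chern_exact_local (a := g) (b := fun=> tt) (h := fun _ _ => 1%:M)
  (k := fun _ _ => 0) vE vF (is_transition_trivial _ _ _)).
- exact: subJ.
- by move=> ? ? ?.
- by move=> i x _; exact: cst_continuous.
- by move=> i x _; exact: cst_continuous.
- by move=> i j x ix jx; rewrite mulmx1 mul1mx; exact: FE.
- by move=> i j x _ _; rewrite mulmx0 mul0mx.
- by move=> i x _; exact: idmx_0_exact.
Qed.

(** Invariance under change of trivializations also comes from exact sequences: [F] and [E] are both
    middle terms of 0 -> E -> . -> 0 -> 0, so both have Chern polynomial c(E) c(0). *)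
Lemma chern_refine (J : Type) (domJ : J -> set X) (F : J -> J -> X -> 'M[C]_r) (g : J -> I) :
  is_transition domJ F -> (forall j, domJ j `<=` domE (g j)) ->
  (forall i j x, domJ i x -> domJ j x -> F i j x = E (g i) (g j) x) ->
  chern c (VBundle domJ F) = chern c (VBundle domE E).
Proof.
move=> vF subJ FE; rewrite (chern_mul_trivial0 vF subJ FE).
exact: (esym (@chern_mul_trivial0 _ domE E id vE (fun _ _ ix => ix) (fun _ _ _ _ _ => erefl))).
Qed.

End OneBundle.

Section OneIndex.
Variables (I : Type) (dom : I -> set X).

Lemma chern_exact r s t (E : I -> I -> X -> 'M[C]_r)
    (F : I -> I -> X -> 'M[C]_s) (G : I -> I -> X -> 'M[C]_t)
    (h : I -> X -> 'M[C]_(r, s)) (k : I -> X -> 'M[C]_(s, t)) :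
  is_transition dom E -> is_transition dom F -> is_transition dom G ->
  (forall i x, dom i x -> {for x, continuous (h i)}) ->
  (forall i x, dom i x -> {for x, continuous (k i)}) ->
  (forall i j x, dom i x -> dom j x -> h i x *m F i j x = E i j x *m h j x) ->
  (forall i j x, dom i x -> dom j x -> k i x *m G i j x = F i j x *m k j x) ->
  (forall i x, dom i x ->
     [/\ row_free (h i x), (h i x == kermx (k i x))%MS & row_full (k i x)]) ->
  chern c (VBundle dom F) = cpoly_mul (chern c (VBundle dom E)) (chern c (VBundle dom G)).
Proof.
move=> vE vF vG.
by apply: (chern_exact_local (a := id) (b := id) vE vF vG); move=> ? ? ?.
Qed.

(* A direct sum is an extension in both orders. *)
Lemma chern_mulC r s (E : I -> I -> X -> 'M[C]_r) (G : I -> I -> X -> 'M[C]_s) :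
  is_transition dom E -> is_transition dom G ->
  cpoly_mul (chern c (VBundle dom E)) (chern c (VBundle dom G)) =
  cpoly_mul (chern c (VBundle dom G)) (chern c (VBundle dom E)).
Proof.
move=> vE vG; have vS := is_transition_sum vE vG.
rewrite -(chern_exact (h := fun _ _ => row_mx 1%:M 0)
  (k := fun _ _ => col_mx 0 1%:M) vE vS vG).
- apply: (chern_exact (h := fun _ _ => row_mx 0 1%:M)
    (k := fun _ _ => col_mx 1%:M 0) vG vS vE).
  + by move=> i x _; exact: cst_continuous.
  + by move=> i x _; exact: cst_continuous.
  + by move=> i j x _ _; rewrite mul_row_block mul_mx_row !mulmx0 !mul0mx mul1mx mulmx1 !add0r.
  + by move=> i j x _ _; rewrite mul_block_col mul_col_mx !mulmx0 !mul0mx mul1mx mulmx1 !addr0.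
  + by move=> i x _; exact: row_mx_01_exact.
- by move=> i x _; exact: cst_continuous.
- by move=> i x _; exact: cst_continuous.
- by move=> i j x _ _; rewrite mul_row_block mul_mx_row !mulmx0 !mul0mx mul1mx mulmx1 !addr0.
- by move=> i j x _ _; rewrite mul_block_col mul_col_mx !mulmx0 !mul0mx mul1mx mulmx1 !add0r.
- by move=> i x _; exact: row_mx_10_exact.
Qed.

(** Each step splits off the first line bundle as a subbundle. The product is a right fold that
    [big_ord_recl] opens in the same order, so no associativity is involved. *)
Lemma chern_diag r (g : 'I_r -> I -> I -> X -> C) :
  (forall i, open (dom i)) -> (forall x, exists i, dom i x) ->
  (forall l, is_transition dom (fun i j x => (g l i j x)%:M : 'M[C]_1)) ->
  chern c (VBundle dom (diag_trans g)) =
  \big[cpoly_mul/cpoly1]_(l < r) chern c (VBundle dom (fun i j x => (g l i j x)%:M : 'M[C]_1)).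
Proof.
move=> odom cov; elim: r g => [|r IHr] g vg.
  have vD := is_transition_diag odom cov vg.
  rewrite big_ord0; apply: functional_extensionality_dep => -[|k].
    exact: (chern0 c (vD : is_vbundle (VBundle _ _))).
  exact: (chern_gt_rank c (vD : is_vbundle (VBundle _ _))).
have vg' l : is_transition dom (fun i j x => (g (lift ord0 l) i j x)%:M : 'M[C]_1).
  exact: vg.
rewrite big_ord_recl -(IHr _ vg').
apply: (@chern_exact 1 (1 + r) r _ _ _ (fun _ _ => row_mx 1%:M 0)
    (fun _ _ => col_mx 0 1%:M) (vg ord0) (is_transition_diag odom cov vg)
    (is_transition_diag odom cov vg')).
- by move=> i x _; exact: cst_continuous.
- by move=> i x _; exact: cst_continuous.
- move=> i j x _ _.
  by rewrite diag_transS mul_row_block mul_mx_row !mulmx0 !mul0mx mul1mx mulmx1 !addr0.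
- move=> i j x _ _.
  by rewrite diag_transS mul_block_col mul_col_mx !mulmx0 !mul0mx mul1mx mulmx1 !add0r.
- by move=> i x _; exact: row_mx_10_exact.
Qed.

End OneIndex.
End Chern.

Lemma alternating_sum_signs m : \sum_(i < m) (-1) ^+ i = (odd m)%:R :> int.
Proof.
elim: m => [|m IHm]; first by rewrite big_ord0.
by rewrite big_ord_recr IHm /= -signr_odd; case: (odd m).
Qed.

(* On a point the coboundary C^(2k+1) -> C^(2k+2) is an alternating sum of
   2k+3 equal terms, hence onto. *)
Lemma coh_point (R : realType) (P : topologicalType) k (a : coh R P k.+1.*2) :
  (forall x y : P, x = y) -> a = 0.
Proof.
move=> P1.
have S1 n (s s' : simplex R P n) : s = s' by apply/continuousEP => t; exact: P1.
rewrite -[a]reprK -(reprK 0); apply/eqP; rewrite -Quotient.idealrBE.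
set phi := repr a - repr 0; apply/asboolP => /=.
exists (fun s => cocycle_val phi (face (fun=> ord0) s)).
apply/funext => s; rewrite /codiff.
under eq_bigr do rewrite (S1 _ (face _ _) s).
by rewrite -mulr_suml alternating_sum_signs /= negbK odd_double mul1r.
Qed.

Lemma chern_point (R : realType) (c : chern_theory R) (P : topologicalType) r
    (E : vbundle R P r) : (forall x y : P, x = y) -> is_vbundle E -> chern c E = cpoly1.
Proof.
move=> P1 vE; apply: functional_extensionality_dep => -[|k]; first exact: chern0.
by rewrite (coh_point (chern c E k.+1)).
Qed.

(** The pullback of 1 need not be computed: over a point all ranks have the same Chern polynomial,
    so rank r has the same pullback as rank 0, where the answer is known. *)
Lemma chern_trivial (R : realType) (c : chern_theory R) (X : topologicalType) r :
  chern c (trivial_bundle R X r) = cpoly1.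
Proof.
have P1 (x y : 'rV[R]_0) : x = y by rewrite [x]thinmx0 [y]thinmx0.
pose f : continuousType X 'rV[R]_0 := mkcts (@cst_continuous X 'rV[R]_0 0).
have E s := chern_pullback c f (is_vbundle_trivial R 'rV[R]_0 s).
rewrite -(chern_trivial0 c X) (E r) -[LHS]/(cpoly_pullback f _) [RHS](E 0%N).
by rewrite !(chern_point c P1) //; exact: is_vbundle_trivial.
Qed.

(** * Cones and smooth fans *)

Lemma near_finite (T U : Type) (S : set U) (F : set_system T) {FF : Filter F}
    (P : U -> T -> Prop) :
  finite_set S ->
  (forall u, S u -> \forall t \near F, P u t) ->
  \forall t \near F, forall u, S u -> P u t.
Proof.
move=> /finite_setP[m].
elim: m S => [|m IHm] S.
  by rewrite II0 card_eq0 => /eqP -> _; apply: filterE => t u.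
move=> /eq_cardSP[u Su SDm] PS.
have := IHm _ SDm (fun v Sv => PS v (proj1 Sv)).
move=> /(filterI (PS u Su)); apply: filterS => t [Put Pt] v Sv.
by have [-> //|vu] := pselect (v = u); apply: Pt; split.
Qed.

(* Bartl's short proof, with denominators cleared: if m.b < 0 and m is nonnegative
   on all generators but the last one a_k, project along a_k onto the kernel of m. *)
Lemma farkas k n (a : 'M[int]_(k, n)) (b : 'rV[int]_n) :
  (exists (N : int) (c : 'rV[int]_k),
     [/\ 0 < N, forall i, 0 <= c 0 i & N *: b = c *m a]) \/
  (exists m : 'cV[int]_n, (forall i, 0 <= (a *m m) i 0) /\ (b *m m) 0 0 < 0).
Proof.
elim: k a b => [|k IHk] a b.
  have [->|b0] := eqVneq b 0.
    by left; exists 1, 0; split=> // [[]|] //; rewrite scaler0 mul0mx.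
  right; exists (- b^T); split=> [[]//|].
  rewrite mulmxN 2!mxE oppr_lt0 lt_neqAle; apply/andP; split; last first.
    by apply: sumr_ge0 => i _; rewrite mxE -expr2 sqr_ge0.
  apply: contraNneq b0 => s0; apply/eqP/rowP => i; rewrite mxE.
  move/esym/eqP: s0; rewrite psumr_eq0 => [/allP/(_ i (mem_index_enum i))|j _].
    by rewrite mxE -expr2 sqrf_eq0 => /eqP.
  by rewrite mxE -expr2 sqr_ge0.
move: a; rewrite -[k.+1]/(1 + k)%N => a; rewrite -[a]vsubmxK.
move: (usubmx a) (dsubmx a) => a1 a2 {a}.
have [[N [c [N0 c0 bE]]]|[m [am bm]]] := IHk a2 b.
  left; exists N, (row_mx 0 c : 'rV[int]_(1 + k)); split=> // [i|].
    by rewrite mxE; case: splitP => j _; rewrite ?mxE.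
  by rewrite mul_row_col mul0mx add0r.
have [d a1m] : exists d, a1 *m m = d%:M by exists ((a1 *m m) 0 0); exact: mx11_scalar.
have [t bmE] : exists t, b *m m = t%:M by exists ((b *m m) 0 0); exact: mx11_scalar.
move: bm; rewrite bmE mxE mulr1n => t0.
have [d0|d0] := leP 0 d.
  right; exists m; split=> [i|]; last by rewrite bmE mxE mulr1n.
  rewrite mul_col_mx mxE; case: splitP => j _ //.
  by rewrite [j]ord1 a1m mxE mulr1n.
(* Here [a1] is the only generator with negative pairing d. A vector v is sent to -d v + (v.m) a1,
   which is the projection of v along [a1] onto the kernel of m, scaled by -d > 0. *)
have [[N [c [N0 c0 bE]]]|[m' [am' bm']]] :=
    IHk (- d *: a2 + a2 *m m *m a1) (- d *: b + t *: a1).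
  (* Solving the projected relation for b: the coefficient of [a1] is c a2 m - N t, nonnegative
     because t = b.m < 0. *)
  left; exists (N * - d), (row_mx (c *m (a2 *m m) - (N * t)%:M) (- d *: c) : 'rV[int]_(1 + k)).
  split; first by rewrite mulr_gt0 // oppr_gt0.
    move=> i; rewrite mxE; case: splitP => j _.
      rewrite [j]ord1 2!mxE [X in _ + X]mxE [X in _ - X]mxE mulr1n subr_ge0 (@le_trans _ _ 0) //.
        by rewrite pmulr_rle0 // ltW.
      by apply: sumr_ge0 => l _; rewrite mulr_ge0 // am.
    by rewrite mxE mulr_ge0 // oppr_ge0 ltW.
  rewrite mul_row_col mulmxBl mul_scalar_mx.
  move: bE; rewrite scalerDr !scalerA mulmxDr -scalemxAr -scalemxAl !mulmxA => /eqP.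
  rewrite -subr_eq => /eqP <-.
  by rewrite [RHS]addrC subrKA addrK.
have [d' a1m'] : exists d, a1 *m m' = d%:M by exists ((a1 *m m') 0 0); exact: mx11_scalar.
(* This combination vanishes on [a1], and on b and the rows of [a2] it takes the value of m' at the
   projected vector. *)
right; exists (- d *: m' + d' *: m); split.
  move=> i; rewrite mul_col_mx mxE; case: splitP => j _.
    by rewrite [j]ord1 mulmxDr -!scalemxAr a1m' a1m !mxE !mulr1n mulNr (mulrC d) addNr.
  have := am' j; rewrite mulmxDl -scalemxAl -(mulmxA (a2 *m m)) a1m'.
  by rewrite mul_mx_scalar mulmxDr -!scalemxAr.
move: bm'; rewrite mulmxDl -!scalemxAl a1m' mulmxDr -!scalemxAr bmE.
by rewrite !scale_scalar_mx mulrC.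
Qed.

Section Coordinates.
Variables (R : realType) (n : nat).
Implicit Types (e : 'M[int]_n) (m : 'cV[int]_n) (x : 'rV[R]_n).

Lemma realmxM p q r (u : 'M[int]_(p, q)) (v : 'M[int]_(q, r)) :
  realmx R (u *m v) = realmx R u *m realmx R v.
Proof. exact: map_mxM. Qed.

Lemma realmx1 : realmx R (1%:M : 'M[int]_n) = 1%:M.
Proof. exact: map_mx1. Qed.

Lemma realmxE p q (u : 'M[int]_(p, q)) i j : realmx R u i j = (u i j)%:~R.
Proof. exact: mxE. Qed.

Lemma realmx_row p q (u : 'M[int]_(p, q)) i : realmx R (row i u) = row i (realmx R u).
Proof. exact: map_row. Qed.

Lemma realmx_inj p q : injective (@realmx R p q).
Proof.
by move=> u v /matrixP uv; apply/matrixP => i j; apply: (@intr_inj R); have := uv i j; rewrite !mxE.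
Qed.

Definition coord e x : 'rV[R]_n := x *m realmx R (invmx e).

Lemma coordK e x : e \in unitmx -> coord e x *m realmx R e = x.
Proof. by move=> ue; rewrite -mulmxA -realmxM mulVmx // realmx1 mulmx1. Qed.

Lemma coordKV e (a : 'rV[R]_n) : e \in unitmx -> coord e (a *m realmx R e) = a.
Proof. by move=> ue; rewrite /coord -mulmxA -realmxM mulmxV // realmx1 mulmx1. Qed.

Lemma coord_int e (u : 'rV[int]_n) : coord e (realmx R u) = realmx R (u *m invmx e).
Proof. by rewrite realmxM. Qed.

Lemma coord_row e i j : e \in unitmx -> coord e (realmx R (row i e)) 0 j = (i == j)%:R.
Proof. by move=> ue; rewrite coord_int -row_mul mulmxV // !mxE; case: (i == j). Qed.

Lemma pairing_coord e x (m : 'cV[R]_n) : e \in unitmx ->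
  (x *m m) 0 0 = \sum_i coord e x 0 i * (realmx R (row i e) *m m) 0 0.
Proof.
move=> ue; rewrite -{1}(coordK x ue) -mulmxA mxE; apply: eq_bigr => i _.
by congr (_ * _); rewrite realmx_row -row_mul [RHS]mxE.
Qed.

Lemma pairing_int (u : 'rV[int]_n) m :
  (realmx R u *m realmx R m) 0 0 = ((u *m m) 0 0)%:~R.
Proof. by rewrite -realmxM realmxE. Qed.

Lemma row_pairing e m i : (row i e *m m) 0 0 = (e *m m) i 0.
Proof. by rewrite -row_mul mxE. Qed.

Lemma cone_coordP e x : e \in unitmx ->
  cone R e x <-> forall j, 0 <= coord e x 0 j.
Proof.
move=> ue; split=> [[a a0 <-] j|x0]; first by rewrite coordKV // a0.
by exists (coord e x) => //; exact: coordK.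
Qed.

Lemma cone_add k (u : 'M[int]_(k, n)) x y : cone R u x -> cone R u y -> cone R u (x + y).
Proof.
move=> [a a0 <-] [b b0 <-]; exists (a + b); last by rewrite mulmxDl.
by move=> i; rewrite mxE addr_ge0.
Qed.

Lemma cone_scale k (u : 'M[int]_(k, n)) (t : R) x : 0 <= t -> cone R u x -> cone R u (t *: x).
Proof.
move=> t0 [a a0 <-]; exists (t *: a); last by rewrite scalemxAl.
by move=> i; rewrite mxE mulr_ge0.
Qed.

Lemma cone0 k (u : 'M[int]_(k, n)) : cone R u 0.
Proof. by exists 0; [move=> i; rewrite mxE | rewrite mul0mx]. Qed.

Lemma cone_gen k (u : 'M[int]_(k, n)) i : cone R u (realmx R (row i u)).
Proof.
exists (delta_mx 0 i); last by rewrite -rowE realmx_row.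
by move=> j; rewrite mxE ler0n.
Qed.

Lemma cone_rowsub k (j : 'I_k -> 'I_n) e : bijective j -> cone R (rowsub j e) = cone R e.
Proof.
move=> [g jK gK]; apply/seteqP; split=> x.
  move=> [a a0 <-]; rewrite mulmx_sum_row.
  apply: (big_ind (cone R e)) => [|y z|l _]; [exact: cone0|exact: cone_add|].
  by rewrite -realmx_row row_rowsub; apply: cone_scale; [exact: a0 | exact: cone_gen].
move=> [a a0 <-]; exists (\row_l a 0 (j l)) => [l|]; first by rewrite mxE.
rewrite !mulmx_sum_row [RHS](reindex j) /=; last by exists g => i _; [exact: jK|exact: gK].
by apply: eq_bigr => l _; rewrite mxE -!realmx_row row_rowsub.
Qed.

End Coordinates.
Arguments coord {R n} e x.

(** * Faces, rays and separating functionals in a fan *)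

Section FanLemmas.
Variables (R : realType) (n : nat) (Sigma : set (set 'rV[R]_n)).
Hypothesis fanS : is_fan Sigma.
Implicit Types (e : 'M[int]_n) (m : 'cV[int]_n) (x : 'rV[R]_n) (sigma tau : set 'rV[R]_n).

(** An ordered basis of N spanning a cone of the fan, hence one chart C^n. Reordering the rows gives
    another frame of the same cone. *)
Definition frame e : Prop := e \in unitmx /\ Sigma (cone R e).

Lemma face_subset tau sigma : is_face tau sigma -> tau `<=` sigma.
Proof. by move=> [m _ ->] x []. Qed.

Lemma fan_face tau sigma : Sigma tau -> Sigma sigma -> tau `<=` sigma -> is_face tau sigma.
Proof.
have [_ _ _ ax] := fanS; move=> St Ss ts.
have [+ _] := ax _ _ Ss St; suff -> : sigma `&` tau = tau by [].
by apply/seteqP; split=> [x []//|x tx]; split=> //; exact: ts.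
Qed.

Lemma fan_cone_add sigma x y : Sigma sigma -> sigma x -> sigma y -> sigma (x + y).
Proof.
have [_ rp _ _] := fanS; move=> /rp[[k [u ->]] _]; exact: cone_add.
Qed.

Lemma fan_cone_scale sigma (t : R) x : Sigma sigma -> 0 <= t -> sigma x -> sigma (t *: x).
Proof.
have [_ rp _ _] := fanS; move=> /rp[[k [u ->]] _]; exact: cone_scale.
Qed.

Lemma fan_cone0 sigma : Sigma sigma -> sigma 0.
Proof.
have [_ rp _ _] := fanS; move=> /rp[[k [u ->]] _]; exact: cone0.
Qed.

Lemma fan_cone_sum sigma I (r : seq I) (P : pred I) (F : I -> 'rV[R]_n) : Sigma sigma ->
  (forall i, P i -> sigma (F i)) -> sigma (\sum_(i <- r | P i) F i).
Proof.
move=> Ss sF; apply: (big_ind sigma) => //; first exact: fan_cone0.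
by move=> x y; exact: fan_cone_add.
Qed.

(** The functional cutting out the face is nonnegative on the rows of [e], and a vanishing sum of
    nonnegative terms has zero terms. So a face of the cone is spanned by the generators that it
    contains. *)
Lemma face_coordP tau e x : Sigma tau -> frame e -> tau `<=` cone R e ->
  tau x <-> (forall i, 0 <= coord e x 0 i) /\
            (forall i, ~ tau (realmx R (row i e)) -> coord e x 0 i = 0).
Proof.
move=> St [ue Se] te; have [m m0 tauE] := fan_face St Se te.
have em i : 0 <= (realmx R (row i e) *m m) 0 0 by apply: m0; exact: cone_gen.
have tP i : tau (realmx R (row i e)) <-> (realmx R (row i e) *m m) 0 0 = 0.
  by rewrite tauE; split=> [[]//|h]; split=> //; exact: cone_gen.
split=> [tx|[x0 xt]].
  have x0 i : 0 <= coord e x 0 i by have /cone_coordP := te x tx; exact.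
  split=> // i /tP/eqP mi0.
  move: tx; rewrite tauE => -[_]; rewrite (pairing_coord x m ue) => /eqP.
  rewrite psumr_eq0 => [/allP/(_ i (mem_index_enum i))|j _]; last by rewrite mulr_ge0.
  by rewrite /= mulf_eq0 (negbTE mi0) orbF => /eqP.
rewrite tauE; split; first exact/cone_coordP.
rewrite (pairing_coord x m ue) big1 // => i _.
by have [/tP->|/xt->] := pselect (tau (realmx R (row i e))); rewrite ?mulr0 ?mul0r.
Qed.

Lemma face_sub tau e sigma : Sigma tau -> frame e -> tau `<=` cone R e -> Sigma sigma ->
  (forall i, tau (realmx R (row i e)) -> sigma (realmx R (row i e))) -> tau `<=` sigma.
Proof.
move=> St fe te Ss ts x tx; have [ue _] := fe; have [x0 xN] := (face_coordP x St fe te).1 tx.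
rewrite -(coordK x ue) mulmx_sum_row; apply: (fan_cone_sum _ Ss) => i _.
have [ti|/xN->] := pselect (tau (realmx R (row i e))); last first.
  by rewrite scale0r; exact: fan_cone0.
by rewrite -realmx_row; apply: (fan_cone_scale Ss) => //; exact: ts.
Qed.

Lemma dual_monoid_frameP tau e m : Sigma tau -> frame e -> tau `<=` cone R e ->
  dual_monoid tau m <-> forall i, tau (realmx R (row i e)) -> 0 <= (e *m m) i 0.
Proof.
move=> St fe te; have [ue _] := fe; split=> [tm i /tm|em x tx].
  by rewrite pairing_int row_pairing ler0z.
have [x0 xt] := (face_coordP x St fe te).1 tx.
rewrite (pairing_coord x _ ue) sumr_ge0 // => i _.
have [ti|/xt->] := pselect (tau (realmx R (row i e))); last by rewrite mul0r.
by rewrite mulr_ge0 // pairing_int row_pairing ler0z em.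
Qed.

Lemma perp_frameP tau e m : Sigma tau -> frame e -> tau `<=` cone R e ->
  perp tau m <-> forall i, tau (realmx R (row i e)) -> (e *m m) i 0 = 0.
Proof.
move=> St fe te; have [ue _] := fe; split=> [tm i /tm/eqP|em x tx].
  by rewrite pairing_int row_pairing intr_eq0 => /eqP.
have [x0 xt] := (face_coordP x St fe te).1 tx.
rewrite (pairing_coord x _ ue) big1 // => i _.
have [ti|/xt->] := pselect (tau (realmx R (row i e))); last by rewrite mul0r.
by rewrite pairing_int row_pairing em // mulr0.
Qed.

Lemma frame_row_primitive e l : e \in unitmx -> primitive (row l e).
Proof.
move=> ue k v lE; have := congr1 (fun u => (u *m invmx e) 0 l) lE.
rewrite -row_mul mulmxV // -scalemxAl [RHS]mxE 2!mxE eqxx => /esym/(congr1 absz)/eqP.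
by rewrite abszM muln_eq1 -abszE => /andP[/eqP -> _].
Qed.

Lemma frame_subcone (J : pred 'I_n) e : frame e ->
  Sigma [set x | cone R e x /\ forall i, J i -> coord e x 0 i = 0].
Proof.
have [_ _ faces _] := fanS; move=> [ue Se]; apply: faces Se _.
pose m : 'cV[R]_n := realmx R (invmx e) *m \col_i (J i)%:R.
have mE x : (x *m m) 0 0 = \sum_(i | J i) coord e x 0 i.
  rewrite mulmxA mxE [RHS]big_mkcond; apply: eq_bigr => i _; rewrite [X in _ * X]mxE.
  by case: (J i); rewrite ?mulr1 ?mulr0.
exists m => [x /(cone_coordP x ue) x0|]; first by rewrite mE sumr_ge0.
apply/seteqP; split=> x /= [ex xJ]; split=> //; first by rewrite mE big1.
have x0 := (cone_coordP x ue).1 ex.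
move: xJ; rewrite mE => /eqP; rewrite psumr_eq0 // => /allP xl i Ji.
by have /(_ i (mem_index_enum i)) := xl; rewrite Ji => /eqP.
Qed.

Lemma fan_zero e : frame e -> Sigma [set 0].
Proof.
move=> fe; have [ue _] := fe; have := frame_subcone predT fe; congr Sigma.
apply/seteqP; split=> x /= => [[_ x0]|->].
  rewrite -(coordK x ue) (_ : coord e x = 0) ?mul0mx //; apply/rowP => l.
  by rewrite x0 // mxE.
by split=> [|i _]; [exact: cone0 | rewrite /coord mul0mx mxE].
Qed.

Lemma cone_rowE e l : e \in unitmx ->
  cone R (row l e) = [set x | cone R e x /\ forall i, i != l -> coord e x 0 i = 0].
Proof.
move=> ue; apply/seteqP; split=> x /= => [[a a0 <-]|[/(cone_coordP x ue) x0 xl]]; last first.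
  exists (coord e x 0 l)%:M; first by move=> i; rewrite (ord1 i) mxE mulr1n.
  rewrite mul_scalar_mx -[RHS](coordK x ue) [RHS]mulmx_sum_row (bigD1 l) //= big1 ?addr0 => [|i il].
    by rewrite realmx_row.
  by rewrite xl // scale0r.
have -> : a *m realmx R (row l e) = a 0 0 *: realmx R (row l e).
  by rewrite {1}[a]mx11_scalar mul_scalar_mx.
split=> [|i il]; first by apply: cone_scale => //; exact: cone_gen.
by rewrite /coord -scalemxAl mxE -[_ *m _]/(coord e _) coord_row // eq_sym (negbTE il) mulr0.
Qed.

Lemma frame_row_cone e l : frame e -> Sigma (cone R (row l e)).
Proof. by move=> fe; rewrite cone_rowE; [exact: (frame_subcone (predC1 l)) | case: fe]. Qed.

(** The ray is a face of the cone of [e], so it contains a generator [row l e]. Then u is a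
    nonnegative integer multiple of that row, and primitivity makes the factor 1. *)
Lemma ray_in_frame e u : frame e -> primitive u -> Sigma (cone R u) ->
  cone R e (realmx R u) -> exists l, u = row l e.
Proof.
move=> fe pu Su eu; have [ue _] := fe.
have ue' : cone R u `<=` cone R e.
  move=> _ [a a0 <-]; rewrite {1}[a]mx11_scalar mul_scalar_mx.
  by apply: cone_scale => //; apply: a0.
have cu : cone R u (realmx R u) by have := cone_gen R u 0; rewrite row_id.
have [u0 uN] := (face_coordP _ Su fe ue').1 cu.
have uE : u = (u *m invmx e) *m e by rewrite mulmxKV.
have [l ul] : exists l, (u *m invmx e) 0 l != 0.
  apply/existsP; rewrite -negb_forall; apply/negP => /forallP uz.
  have /pu/esym : u = 0 *: (0 : 'rV_n).
    rewrite scale0r uE; apply/rowP => j; rewrite mxE big1 ?mxE // => i _.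
    by rewrite (eqP (uz i)) mul0r.
  by rewrite normr0.
have [a a0 aE] : cone R u (realmx R (row l e)).
  apply: contrapT => /uN; rewrite coord_int realmxE => /eqP.
  by rewrite intr_eq0 (negbTE ul).
have dE i : (l == i)%:R = a 0 0 * ((u *m invmx e) 0 i)%:~R.
  have {}aE : realmx R (row l e) = a 0 0 *: realmx R u.
    by rewrite -aE {1}[a]mx11_scalar mul_scalar_mx.
  rewrite -(coord_row R l i ue) aE /coord -scalemxAl mxE.
  by rewrite -[_ *m _]/(coord e _) coord_int realmxE.
have an0 : a 0 0 != 0.
  by apply/eqP => a00; have := dE l; rewrite a00 mul0r eqxx => /eqP; rewrite oner_eq0.
have uE' : u = (u *m invmx e) 0 l *: row l e.
  rewrite {1}uE mulmx_sum_row (bigD1 l) //= big1 ?addr0 // => i il.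
  have := dE i; rewrite eq_sym (negbTE il) => /esym/eqP.
  by rewrite mulf_eq0 (negbTE an0) intr_eq0 => /eqP ->; rewrite scale0r.
exists l; have := pu _ _ uE'.
rewrite ger0_norm => [u1|]; first by rewrite uE' u1 scale1r.
by have := u0 l; rewrite coord_int realmxE ler0z.
Qed.

(* The supporting hyperplane of the common face, perturbed by Farkas' lemma. *)
Lemma half_separation e e' i : frame e -> frame e' -> ~ cone R e' (realmx R (row i e)) ->
  exists m, [/\ forall j, 0 <= (e *m m) j 0, forall j, (e' *m m) j 0 <= 0 & 0 < (e *m m) i 0].
Proof.
move=> [ue Se] [ue' Se'] ei.
(* Farkas is applied to -e_i and the generators e, -e'. A functional is the one sought. A relation
   instead puts N e_i plus a point of the first cone into the second cone, hence into the common
   face; a face containing such a sum contains e_i. *)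
have [[N [c [N0 c0]]]|[m [em im]]] := farkas (col_mx e (- e')) (- row i e); last first.
  exists m; split=> [j|j|].
  - by have := em (lshift n j); rewrite mul_col_mx col_mxEu.
  - by have := em (rshift n j); rewrite mul_col_mx col_mxEd mulNmx mxE oppr_ge0.
  - by move: im; rewrite mulNmx mxE row_pairing oppr_lt0.
rewrite -[c]hsubmxK mul_row_col mulmxN scalerN => /eqP.
rewrite eqr_oppLR opprB => /eqP cE; exfalso; apply: ei.
have [_ _ _ /(_ _ _ Se Se')[[m m0 mE] _]] := fanS.
have c1 : cone R e (realmx R (lsubmx c *m e)).
  exists (realmx R (lsubmx c)); last by rewrite realmxM.
  by move=> j /=; rewrite realmxE ler0z [X in _ <= X]mxE c0.
have c2 : cone R e' (realmx R (rsubmx c *m e')).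
  exists (realmx R (rsubmx c)); last by rewrite realmxM.
  by move=> j /=; rewrite realmxE ler0z [X in _ <= X]mxE c0.
have rE : realmx R (rsubmx c *m e') = realmx R (lsubmx c *m e) + N%:~R *: realmx R (row i e).
  have -> : rsubmx c *m e' = lsubmx c *m e + N *: row i e by rewrite cE addrC subrK.
  by apply/rowP => j; rewrite !mxE rmorphD rmorphM.
have Ni : cone R e (N%:~R *: realmx R (row i e)).
  by apply: cone_scale; [rewrite ler0z ltW | exact: cone_gen].
have : (cone R e `&` cone R e') (realmx R (rsubmx c *m e')).
  by split=> //; rewrite rE; exact: cone_add.
rewrite mE => -[_]; rewrite rE mulmxDl mxE => /eqP.
rewrite paddr_eq0 ?m0 // => /andP[_]; rewrite -scalemxAl mxE mulf_eq0 intr_eq0 gt_eqF //=.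
move=> /eqP im0; suff : (cone R e `&` cone R e') (realmx R (row i e)) by case.
by rewrite mE; split=> //; exact: cone_gen.
Qed.

(** The separation lemma of toric geometry. Summing the functionals of [half_separation] over i
    makes every generator outside the other cone strictly positive; the difference of two such sums,
    one for each side, serves both cones. *)
Lemma frame_separation e e' : frame e -> frame e' ->
  exists m, [/\ forall j, 0 <= (e *m m) j 0, forall j, (e' *m m) j 0 <= 0,
    forall j, (e *m m) j 0 = 0 -> cone R e' (realmx R (row j e)) &
    forall j, (e' *m m) j 0 = 0 -> cone R e (realmx R (row j e'))].
Proof.
suff half f f' : frame f -> frame f' -> exists m,
    [/\ forall j, 0 <= (f *m m) j 0, forall j, (f' *m m) j 0 <= 0 &
      forall j, (f *m m) j 0 = 0 -> cone R f' (realmx R (row j f))].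
  move=> fe fe'; have [m [me me' ms]] := half _ _ fe fe'.
  have [m' [m'e' m'e m's]] := half _ _ fe' fe.
  exists (m - m'); split=> j; rewrite mulmxBr mxE [X in _ + X]mxE.
  - by rewrite addr_ge0 // oppr_ge0.
  - by rewrite subr_le0 (le_trans (me' j)) ?m'e'.
  - by move=> /eqP; rewrite paddr_eq0 ?oppr_ge0 // => /andP[/eqP/ms].
  - by move=> /eqP; rewrite naddr_eq0 ?oppr_le0 // oppr_eq0 => /andP[_ /eqP/m's].
move=> ff ff'.
have /choice[m mP] : forall i, exists m : 'cV[int]_n,
    [/\ forall j, 0 <= (f *m m) j 0, forall j, (f' *m m) j 0 <= 0 &
      ~ cone R f' (realmx R (row i f)) -> 0 < (f *m m) i 0].
  move=> i; have [fi|/(half_separation ff ff')[m [? ? ?]]] :=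
    pselect (cone R f' (realmx R (row i f))); last by exists m.
  by exists 0; split=> // j; rewrite mulmx0 mxE.
exists (\sum_i m i); split=> j; rewrite mulmx_sumr summxE.
- by rewrite sumr_ge0 // => i _; have [-> _ _] := mP i.
- by rewrite sumr_le0 // => i _; have [_ -> _] := mP i.
- move=> /eqP; rewrite psumr_eq0 => [/allP/(_ j (mem_index_enum j)) /eqP mj0|i _].
    by apply: contrapT; have [_ _ mj] := mP j => /mj; rewrite mj0 ltxx.
  by have [-> _ _] := mP i.
Qed.

End FanLemmas.

Lemma horner_near0_neq0 (R : realType) (q : {poly R}) :
  q != 0 -> \forall t \near 0^'+, q.[t] != 0.
Proof.
move=> q0; have [m [p]] := multiplicity_XsubC q 0; rewrite q0 /= => p0 ->.
have p_neq0 : \forall t \near (0 : R), p.[t] != 0.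
  exact: (cvgr_neq0 _ (@continuous_horner R p 0) p0).
near=> t; rewrite subr0 hornerM hornerXn mulf_neq0 ?expf_neq0 //.
  by near: t; apply: cvg_within.
Unshelve. all: by end_near. Qed.

(** * Maximal cones of a smooth complete fan *)

Section Completeness.
Variables (R : realType) (n : nat) (Sigma : set (set 'rV[R]_n)).
Hypothesis fanS : is_fan Sigma.
Hypothesis smoothS : smooth_fan Sigma.
Hypothesis completeS : complete_fan Sigma.
Implicit Types (e : 'M[int]_n) (x u w : 'rV[R]_n) (sigma tau : set 'rV[R]_n).

(** If some basis vector is missing among the generators, its dual vector vanishes on the cone;
    otherwise the generators are the whole basis in some order. *)
Lemma frame_or_hyperplane sigma : Sigma sigma ->
  (exists2 e, frame Sigma e & sigma = cone R e) \/
  (exists2 c : 'cV[R]_n, c != 0 & forall x, sigma x -> (x *m c) 0 0 = 0).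
Proof.
move=> Ss; have [e [k [j [ue inj_j sE]]]] := smoothS Ss.
have [[i ij]|j_onto] := pselect (exists i, forall l, j l != i).
  right; exists (realmx R (col i (invmx e))).
    apply/eqP => c0; have /realmx_inj c0' : realmx R (col i (invmx e)) = realmx R 0.
      by rewrite c0; apply/matrixP => ? ?; rewrite !mxE.
    have := congr1 (fun M : 'M[int]_n => M i i) (mulmxV ue); rewrite mxE [RHS]mxE eqxx.
    rewrite big1 => [/eqP|l _]; first by rewrite eq_sym oner_eq0.
    by have /colP/(_ l) := c0'; rewrite !mxE => ->; rewrite mulr0.
  move=> x; rewrite sE => -[a _ <-]; rewrite -mulmxA -realmxM.
  have -> : rowsub j e *m col i (invmx e) = 0.
    apply/colP => l; rewrite mxE [RHS]mxE; under eq_bigr do rewrite !mxE.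
    by have := congr1 (fun M : 'M[int]_n => M (j l) i) (mulmxV ue); rewrite !mxE (negbTE (ij l)).
  by rewrite mxE big1 // => l _; rewrite !mxE mulr0.
have jS i : exists l, j l = i.
  by apply: contrapT => jN; apply: j_onto; exists i => l; apply/eqP => jl; apply: jN; exists l.
have [g gK] := choice jS.
left; suff sE' : sigma = cone R e by exists e; rewrite // /frame -sE'.
by rewrite sE cone_rowsub //; exists g => i //; exact: inj_j.
Qed.

(* A point moving off x along the moment curve leaves every hyperplane at once. *)
Lemma frame_cover x : exists2 e, frame Sigma e & cone R e x.
Proof.
apply: contrapT => xN.
pose v (t : R) : 'rV[R]_n := x + \row_k t ^+ k.+1.
pose q (c : 'cV[R]_n) : {poly R} := ((x *m c) 0 0)%:P + \sum_k c k 0 *: 'X^(k.+1).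
have vq c t : (v t *m c) 0 0 = (q c).[t].
  rewrite mulmxDl mxE hornerD hornerC horner_sum; congr (_ + _).
  by rewrite mxE; apply: eq_bigr => k _; rewrite mxE hornerZ hornerXn mulrC.
have q0 c : (q c).[0] = (x *m c) 0 0.
  rewrite hornerD hornerC horner_sum big1 ?addr0 // => k _.
  by rewrite hornerZ hornerXn expr0n mulr0.
have qN0 c : c != 0 -> q c != 0.
  apply: contra_neq => qc0; apply/colP => k.
  have := congr1 (fun p : {poly R} => p`_k.+1) qc0.
  rewrite coef0 coefD coefC /= add0r coef_sum (bigD1 k) //= big1 ?addr0 => [|l lk].
    by rewrite coefZ coefXn eqxx mulr1 mxE.
  rewrite coefZ coefXn eqSS (_ : (k == l :> nat) = false) ?mulr0 //.
  by apply/negbTE; rewrite eq_sym.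
(* For small t > 0 the point [v t] misses every cone: a frame cone without x has a coordinate that
   is negative at x and stays so, and any other cone lies in a hyperplane, where a nonzero
   polynomial in t would have to vanish. *)
have : \forall t \near 0^'+, forall sigma, Sigma sigma -> ~ sigma (v t).
  have [[finS _] _ _ _] := fanS; apply: near_finite finS _ => sigma Ss.
  have [[e fe sE]|[c c0 sc]] := frame_or_hyperplane Ss.
    have [ue _] := fe.
    have [j xj] : exists j, coord e x 0 j < 0.
      apply: contrapT => xj; apply: xN; exists e => //; apply/cone_coordP => // j.
      by rewrite leNgt; apply/negP => xj0; apply: xj; exists j.
    pose c := col j (realmx R (invmx e)).
    have cE y : (y *m c) 0 0 = coord e y 0 j by rewrite /c !mxE; apply: eq_bigr => k _; rewrite mxE.
    have : \forall t \near (0 : R), (q c).[t] < 0.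
      by apply: (cvgr_lt _ (@continuous_horner R (q c) 0)); rewrite q0 cE.
    move=> qx; suff: \forall t \near 0^'+, (q c).[t] < 0.
      apply: filterS => t; rewrite -vq cE sE => vt.
      by move=> /(cone_coordP _ ue)/(_ j); rewrite leNgt vt.
    exact: cvg_within.
  apply: filterS (horner_near0_neq0 (qN0 _ c0)) => t; rewrite -vq => vt /sc vt0.
  by rewrite vt0 eqxx in vt.
move=> vN'; have [t vN] := @filter_ex _ _ (at_right_proper_filter 0) _ vN'.
have [sigma Ss sv] : support Sigma (v t) by rewrite completeS.
exact: (vN _ Ss sv).
Qed.

(** This expresses that the star of tau is complete: modulo the span of tau, every direction w lies
    in some maximal cone around tau. For w = 0 it puts tau in a chart; with logarithms of
    coordinates as w it gives compactness. *)
Lemma frame_extend tau w : Sigma tau ->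
  exists e v, [/\ frame Sigma e, tau `<=` cone R e, tau v & cone R e (v + w)].
Proof.
move=> St; have [e0 [k [j0 [_ _ tE]]]] := smoothS St.
(* The sum of the generators is interior to tau: by [v_int], a functional that is nonnegative on tau
   and vanishes at v vanishes on tau. Hence a cone of the fan containing v contains tau. *)
pose v := \sum_l realmx R (row (j0 l) e0).
have vT : tau v.
  by apply: (fan_cone_sum fanS _ St) => l _; rewrite tE -row_rowsub; exact: cone_gen.
have v_int (m : 'cV[R]_n) : (forall x, tau x -> 0 <= (x *m m) 0 0) ->
    (v *m m) 0 0 = 0 -> forall x, tau x -> (x *m m) 0 0 = 0.
  move=> m0 /eqP; rewrite mulmx_suml summxE psumr_eq0 => [/allP vm x|l _]; last first.
    by apply: m0; rewrite tE -row_rowsub; exact: cone_gen.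
  rewrite tE => -[a _ <-]; rewrite -mulmxA mxE big1 // => l _.
  have /(_ l (mem_index_enum l))/eqP := vm.
  by rewrite -row_rowsub realmx_row -row_mul mxE => ->; rewrite mulr0.
apply: contrapT => eN.
(* A frame cone with a negative coordinate at v misses N v + w for large N; one that contains v
   contains tau, and would be a solution with N v in place of v. *)
have : \forall N \near \oo, forall sigma, Sigma sigma ->
    ~ exists e, [/\ frame Sigma e, sigma = cone R e & sigma (N%:R *: v + w)].
  have [[finS _] _ _ ax] := fanS; apply: near_finite finS _ => sigma Ss.
  have [[e [fe sE]]|sN] := pselect (exists e, frame Sigma e /\ sigma = cone R e); last first.
    by apply: filterE => N [e [fe sE _]]; apply: sN; exists e.
  have [ue Se] := fe.
  have [[j vj]|vN] := pselect (exists j, coord e v 0 j < 0).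
    near=> N; move=> [_ [_ _]]; rewrite sE => /(cone_coordP _ ue)/(_ j).
    rewrite /coord mulmxDl -scalemxAl mxE [X in X + _]mxE leNgt => /negP; apply.
    rewrite -ltrBrDr sub0r -ltrN2 opprK -mulrN -ltr_pdivrMr ?oppr_gt0 //.
    by near: N; exact: nbhs_infty_gtr.
  have ve : cone R e v.
    by apply/cone_coordP => // j; rewrite leNgt; apply/negP => vj; apply: vN; exists j.
  have te : tau `<=` cone R e.
    have [[m m0 mE] _] := ax _ _ St Se => x tx.
    have : (tau `&` cone R e) v by [].
    rewrite mE => -[_ /(v_int _ m0) vm].
    by have : (tau `&` cone R e) x; [rewrite mE; split=> //; exact: vm | case].
  apply: filterE => N [_ [_ _]]; rewrite sE => vw; apply: eN; exists e, (N%:R *: v).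
  by split=> //; apply: (fan_cone_scale fanS St).
move=> uN'; have [N uN] := filter_ex uN'; have [e fe eu] := frame_cover (N%:R *: v + w).
by apply: (uN _ (proj2 fe)); exists e.
Unshelve. all: by end_near. Qed.

Lemma frame_face tau : Sigma tau -> exists2 e, frame Sigma e & tau `<=` cone R e.
Proof. by move=> /(frame_extend 0)[e [v [fe te _ _]]]; exists e. Qed.

End Completeness.

(** * Frames adapted to a twisted product *)

Lemma sorting_bijection (b f : nat) (S : {pred 'I_(b + f)}) :
  #|S| = b -> exists2 g : 'I_(b + f) -> 'I_(b + f), bijective g &
    (forall k, g (lshift f k) \in S) /\ (forall k, g (rshift b k) \notin S).
Proof.
move=> Sb; have SCf : #|[predC S]| = f.
  by apply/eqP; rewrite -(eqn_add2l b) -[X in (X + _)%N]Sb cardC card_ord.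
pose g (i : 'I_(b + f)) := match fintype.split i with
  | inl k => enum_val (cast_ord (esym Sb) k)
  | inr k => enum_val (cast_ord (esym SCf) k)
  end.
have gl k : g (lshift f k) = enum_val (cast_ord (esym Sb) k).
  by rewrite /g -[lshift f k]/(unsplit (inl k)) unsplitK.
have gr k : g (rshift b k) = enum_val (cast_ord (esym SCf) k).
  by rewrite /g -[rshift b k]/(unsplit (inr k)) unsplitK.
have glS k : g (lshift f k) \in S by rewrite gl; exact: enum_valP.
have grS k : g (rshift b k) \notin S by rewrite gr; have := enum_valP (cast_ord (esym SCf) k); rewrite inE.
exists g => //; apply: injF_bij => i j.
rewrite -(splitK i) -(splitK j); case: (fintype.split i) (fintype.split j) => [k|k] [l|l] /=.
- by rewrite !gl => /enum_val_inj/cast_ord_inj ->.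
- by move=> gE; have := grS l; rewrite -gE glS.
- by move=> gE; have := grS k; rewrite gE glS.
- by rewrite !gr => /enum_val_inj/cast_ord_inj ->.
Qed.

Lemma rank_rowsub (F : fieldType) k n (s : 'I_k -> 'I_n) (A : 'M[F]_n) :
  injective s -> A \in unitmx -> \rank (rowsub s A) = k.
Proof.
move=> inj_s uA.
have sE : rowsub s 1%:M *m (rowsub s 1%:M)^T = 1%:M :> 'M[F]_k.
  apply/matrixP => i j; rewrite !mxE (bigD1 (s i)) //= !mxE eqxx mul1r big1 => [|l li].
    by rewrite addr0 (inj_eq inj_s) eq_sym.
  by rewrite !mxE eq_sym (negbTE li) mul0r.
rewrite rowsubE mxrankMfree ?row_free_unit //; apply/eqP; rewrite eqn_leq rank_leq_row /=.
by rewrite -{1}(mxrank1 F k) -sE mxrankM_maxl.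
Qed.

Section TwistedFan.
Variables (R : realType) (b f : nat).
Variables (SigmaB : set (set 'rV[R]_b)) (SigmaF : set (set 'rV[R]_f)).
Variables (Phi : 'rV[R]_b -> 'rV[R]_f).
Local Notation Sigma := (twisted_product SigmaB Phi SigmaF).
Hypothesis fanB : is_fan SigmaB.
Hypothesis fanF : is_fan SigmaF.
Hypothesis Phi_linear : conewise_linear SigmaB Phi.
Hypothesis fanS : is_fan Sigma.
Hypothesis smoothS : smooth_fan Sigma.
Hypothesis completeS : complete_fan Sigma.
Implicit Types (sigma : set 'rV[R]_b) (tau : set 'rV[R]_f) (e : 'M[int]_(b + f)).

Definition adapted_frame e : Prop :=
  [/\ frame Sigma e, dlsubmx e = 0, frame SigmaB (ulsubmx e) & frame SigmaF (drsubmx e)].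

Lemma Phi0 sigma : SigmaB sigma -> Phi 0 = 0.
Proof.
move=> Bs; have [_ /(_ _ Bs)[[L PhiL] _]] := Phi_linear.
by rewrite PhiL ?mul0mx //; exact: (fan_cone0 fanB Bs).
Qed.

Definition twisted_sum sigma tau : set 'rV[R]_(b + f) :=
  [set row_mx x (Phi x) + row_mx 0 y | x in sigma & y in tau].

Lemma mul_realmx_block (a : 'rV[R]_(b + f)) e : dlsubmx e = 0 ->
  a *m realmx R e = row_mx (lsubmx a *m realmx R (ulsubmx e))
    (lsubmx a *m realmx R (ursubmx e) + rsubmx a *m realmx R (drsubmx e)).
Proof.
move=> dl0; have eB : e = block_mx (ulsubmx e) (ursubmx e) 0 (drsubmx e) by rewrite -dl0 submxK.
rewrite {1}eB /realmx map_block_mx -{1}[a]hsubmxK mul_row_block.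
have -> : map_mx intr (0 : 'M[int]_(f, b)) = 0 :> 'M[R]_(f, b) by exact: map_mx0.
by rewrite mulmx0 addr0.
Qed.

Section OneCone.
Variables (sigma : set 'rV[R]_b) (tau : set 'rV[R]_f).
Hypotheses (Bs : SigmaB sigma) (Ft : SigmaF tau).

Lemma twisted_suml x : sigma x -> twisted_sum sigma tau (row_mx x (Phi x)).
Proof.
move=> sx; exists x => //; exists 0; first exact: (fan_cone0 fanF Ft).
by rewrite row_mx0 addr0.
Qed.

Lemma twisted_sumr y : tau y -> twisted_sum sigma tau (row_mx 0 y).
Proof.
move=> ty; exists 0; first exact: (fan_cone0 fanB Bs).
by exists y => //; rewrite (Phi0 Bs) row_mx0 add0r.
Qed.

Lemma twisted_sum_lsubmx z : twisted_sum sigma tau z -> sigma (lsubmx z).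
Proof. by move=> [x sx [y _ <-]]; rewrite add_row_mx row_mxKl addr0. Qed.

Lemma twisted_sum_rsubmx y : twisted_sum sigma tau (row_mx 0 y) -> tau y.
Proof.
move=> [x _ [y' ty']]; rewrite add_row_mx addr0 => /eq_row_mx[-> <-].
by rewrite (Phi0 Bs) add0r.
Qed.

Variable (E : 'M[int]_(b + f)).
Hypotheses (fE : frame Sigma E) (EE : cone R E = twisted_sum sigma tau).
Let S := [pred i | lsubmx (row i E) != 0].

(* Extremal generators do not decompose into a base and a fibre part. *)
Lemma twisted_generator i : i \in S -> let x := realmx R (lsubmx (row i E)) in
  realmx R (row i E) = row_mx x (Phi x).
Proof.
move=> iS /=; have [uE _] := fE.
have := cone_gen R E i; rewrite EE => -[x sx [y ty xyE]].
have /(cone_coordP _ uE) cx : cone R E (row_mx x (Phi x)) by rewrite EE; exact: twisted_suml.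
have /(cone_coordP _ uE) cy : cone R E (row_mx 0 y) by rewrite EE; exact: twisted_sumr.
(* The coordinates of the two parts are nonnegative and add up to a unit vector, so both parts are
   multiples of row i. The fibre part has zero base component while row i has not, so its factor is
   0. *)
have cS j : coord E (row_mx x (Phi x)) 0 j + coord E (row_mx 0 y) 0 j = (i == j)%:R.
  by rewrite -(coord_row R i j uE) -xyE /coord mulmxDl [RHS]mxE.
have yE : row_mx 0 y = coord E (row_mx 0 y) 0 i *: realmx R (row i E).
  rewrite -{1}(coordK (row_mx 0 y) uE) mulmx_sum_row (bigD1 i) //= big1 ?addr0 ?realmx_row // => j ji.
  have /eqP := cS j; rewrite [i == j]eq_sym (negbTE ji) paddr_eq0 // => /andP[_ /eqP ->].
  by rewrite scale0r.
have d0 : coord E (row_mx 0 y) 0 i = 0.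
  have := congr1 lsubmx yE; rewrite row_mxKl.
  move: (coord _ _ _ _) => d; rewrite linearZ /= => /esym/eqP.
  rewrite scaler_eq0 => /orP[/eqP//|/eqP l0].
  move: iS; rewrite inE => /eqP[]; apply: (@realmx_inj R).
  by rewrite /realmx map_lsubmx -/(realmx R _) l0; apply/matrixP => ? ?; rewrite !mxE.
have y0 : row_mx 0 y = 0 :> 'rV[R]_(b + f) by rewrite yE d0 scale0r.
rewrite y0 addr0 in xyE.
suff -> : realmx R (lsubmx (row i E)) = x by [].
by rewrite /realmx map_lsubmx -/(realmx R _) -xyE row_mxKl.
Qed.

(** At most b: these generators are independent and lie on the graph of the linear map L. At least
    b: the base components of all generators span R^b, and those outside [S] contribute 0. *)
Lemma card_base_generators : #|S| = b.
Proof.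
have [uE _] := fE.
have uER : realmx R E \in unitmx.
  have : realmx R E *m realmx R (invmx E) = 1%:M by rewrite -realmxM mulmxV // realmx1.
  by case/mulmx1_unit.
pose s : 'I_#|S| -> 'I_(b + f) := enum_val.
have [_ /(_ _ Bs)[[L PhiL] _]] := Phi_linear.
apply/eqP; rewrite eqn_leq; apply/andP; split.
  have sE : rowsub s (realmx R E) = realmx R (rowsub s (lsubmx E)) *m row_mx 1%:M L.
    apply/row_matrixP => i; rewrite row_rowsub -realmx_row twisted_generator; last exact: enum_valP.
    rewrite row_mul mul_mx_row mulmx1 -realmx_row row_rowsub.
    have -> : row (s i) (lsubmx E) = lsubmx (row (s i) E) by apply/rowP => j; rewrite !mxE.
    rewrite PhiL //; have := cone_gen R E (s i); rewrite EE => /twisted_sum_lsubmx.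
    by rewrite /realmx map_lsubmx.
  have <- : \rank (rowsub s (realmx R E)) = #|S|.
    by apply: rank_rowsub => //; exact: enum_val_inj.
  by rewrite sE (leq_trans (mxrankM_maxl _ _)) // rank_leq_col.
rewrite -[X in (X <= _)%N](_ : \rank (realmx R (lsubmx E)) = b); last first.
  rewrite /realmx map_lsubmx -/(realmx R E).
  have -> : lsubmx (realmx R E) = realmx R E *m col_mx 1%:M 0.
    by rewrite -[X in X *m _]hsubmxK mul_row_col mulmx1 mulmx0 addr0.
  by rewrite eqmxMfull ?row_full_unit // rank_col_mx0 mxrank1.
apply: (@leq_trans (\rank (rowsub s (realmx R (lsubmx E))))); last exact: rank_leq_row.
apply/mxrankS/row_subP => i.
have [iS|] := boolP (i \in S).
  by rewrite -(enum_rankK_in iS iS) -[enum_val _]/(s _) -row_rowsub row_sub.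
rewrite inE negbK => /eqP i0.
suff -> : row i (realmx R (lsubmx E)) = 0 by exact: sub0mx.
have iE : row i (lsubmx E) = lsubmx (row i E) by apply/rowP => j; rewrite !mxE.
rewrite -realmx_row iE i0; by apply/matrixP => ? ?; rewrite !mxE.
Qed.

(** Putting the generators of [S] first makes the basis block triangular. Its determinant is then
    the product of those of the diagonal blocks, so both blocks are integral bases. *)
Lemma adapt_frame : exists2 e, adapted_frame e & cone R e = cone R E.
Proof.
have [uE SE] := fE.
have [g bij_g [gl gr]] := sorting_bijection card_base_generators.
pose e := rowsub g E.
have eE : cone R e = cone R E by exact: cone_rowsub.
have ue : e \in unitmx.
  have -> : e = row_perm (perm (bij_inj bij_g)) E.
    by apply/matrixP => i j; rewrite !mxE permE.
  by rewrite row_permE unitmx_mul unitmx_perm.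
have dl0 : dlsubmx e = 0.
  apply/matrixP => i j; rewrite !mxE.
  have := gr i; rewrite inE negbK => /eqP/rowP/(_ j); by rewrite !mxE.
have eB : e = block_mx (ulsubmx e) (ursubmx e) 0 (drsubmx e) by rewrite -dl0 submxK.
have [ul ur] : ulsubmx e \in unitmx /\ drsubmx e \in unitmx.
  by move: ue; rewrite !unitmxE eB det_ublock unitrM -eB => /andP[].
have aM := mul_realmx_block _ dl0.
have ulE : cone R (ulsubmx e) = sigma.
  apply/seteqP; split=> x.
    move=> [a a0 <-]; rewrite mulmx_sum_row; apply: (fan_cone_sum fanB _ Bs) => i _.
    apply: (fan_cone_scale fanB Bs); first exact: a0.
    rewrite -realmx_row; have := cone_gen R e (lshift f i); rewrite eE EE => /twisted_sum_lsubmx.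
    by congr (sigma _); apply/rowP => j; rewrite !mxE.
  move=> sx; have := twisted_suml sx; rewrite -EE -eE => -[a a0 xE].
  exists (lsubmx a) => [i|]; first by rewrite mxE.
  by have := congr1 lsubmx xE; rewrite aM !row_mxKl.
have drE : cone R (drsubmx e) = tau.
  apply/seteqP; split=> y.
    move=> [a a0 <-]; rewrite mulmx_sum_row; apply: (fan_cone_sum fanF _ Ft) => i _.
    apply: (fan_cone_scale fanF Ft); first exact: a0.
    rewrite -realmx_row; have := cone_gen R e (rshift b i); rewrite eE EE => ei.
    apply: twisted_sum_rsubmx; rewrite (_ : row_mx _ _ = realmx R (row (rshift b i) e)) //.
    rewrite -[RHS]hsubmxK; congr row_mx; apply/rowP => j; rewrite !mxE //.
    by have /matrixP/(_ i j) := dl0; rewrite !mxE => ->.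
  move=> ty; have := twisted_sumr ty; rewrite -EE -eE => -[a a0 yE].
  exists (rsubmx a) => [i|]; first by rewrite mxE.
  move: yE; rewrite aM => /eq_row_mx[al <-].
  suff -> : lsubmx a = 0 by rewrite mul0mx add0r.
  by rewrite -(mulmx1 (lsubmx a)) -(realmx1 R b) -(mulmxV ul) realmxM mulmxA al mul0mx.
exists e => //; split=> //; split=> //; [by rewrite eE | by rewrite ulE | by rewrite drE].
Qed.

End OneCone.

Lemma adapted_cover t : Sigma t -> exists2 e, adapted_frame e & t `<=` cone R e.
Proof.
move=> St; have [E fE tE] := frame_face fanS smoothS completeS St.
have [_ [sigma Bs [tau Ft stE]]] := fE.
have [e ae eE] := adapt_frame Bs Ft fE (esym stE).
by exists e => //; rewrite eE.
Qed.

Lemma adapted_proj e z : adapted_frame e -> cone R e z -> cone R (ulsubmx e) (lsubmx z).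
Proof.
move=> [_ dl0 _ _] [a a0 <-]; rewrite mul_realmx_block // row_mxKl.
by exists (lsubmx a) => // i; rewrite mxE.
Qed.

(** The base inherits its frames from the total fan, as upper left blocks of adapted frames around
    the sum of sigma and any cone of the fibre. *)
Lemma base_frame_cover sigma : SigmaB sigma ->
  exists2 e, frame SigmaB e & sigma `<=` cone R e.
Proof.
move=> Bs; have [[_ [tau Ft]] _ _ _] := fanF.
have St : Sigma (twisted_sum sigma tau) by exists sigma => //; exists tau.
have [e ae te] := adapted_cover St; have [_ _ fB _] := ae.
exists (ulsubmx e) => // x sx.
by have := adapted_proj ae (te _ (twisted_suml Ft sx)); rewrite row_mxKl.
Qed.

Section Rays.
Variables (r : nat) (u : 'I_r -> 'rV[int]_f).
Hypothesis rays : ray_generators SigmaF u.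
Let u' i : 'rV[int]_(b + f) := row_mx 0 (u i).

Lemma fibre_ray_primitive i : primitive (u' i).
Proof.
have [_ /(_ (u i))[_ ui]] := rays; have [pu _] : primitive (u i) /\ SigmaF (cone R (u i)).
  by apply: ui; exists i.
move=> k v /(congr1 rsubmx); rewrite row_mxKr linearZ /=; exact: pu.
Qed.

Lemma fibre_ray_cone i : Sigma (cone R (u' i)).
Proof.
have [_ /(_ (u i))[_ ui]] := rays; have [_ Fu] : primitive (u i) /\ SigmaF (cone R (u i)).
  by apply: ui; exists i.
have [[_ [sigma Bs]] _ _ _] := fanB; have [e fe _] := base_frame_cover Bs.
have B0 := fan_zero fanB fe.
exists [set 0] => //; exists (cone R (u i)) => //; apply/seteqP; split=> z.
  move=> [x /= -> [_ [a a0 <-] <-]]; rewrite (Phi0 Bs) row_mx0 add0r; exists a => //.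
  rewrite /u' /realmx map_row_mx mul_mx_row; congr row_mx.
  by have -> : map_mx intr (0 : 'M[int]_(1, b)) = 0 :> 'M[R]_(1, b); [exact: map_mx0 | rewrite mulmx0].
move=> [a a0 <-]; exists 0 => //; exists (a *m realmx R (u i)); first by exists a.
rewrite (Phi0 Bs) row_mx0 add0r /u' /realmx map_row_mx mul_mx_row; congr row_mx.
by have -> : map_mx intr (0 : 'M[int]_(1, b)) = 0 :> 'M[R]_(1, b); [exact: map_mx0 | rewrite mulmx0].
Qed.

Lemma adapted_row_ray e l : adapted_frame e -> exists i, row (rshift b l) e = u' i.
Proof.
move=> [_ dl0 _ fF]; have [_ /(_ (row l (drsubmx e)))[ul _]] := rays.
have [|i li] := ul.
  by split; [apply: frame_row_primitive; case: fF | exact: frame_row_cone].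
exists i; rewrite /u' -li -[LHS]hsubmxK; congr row_mx; apply/rowP => j; rewrite !mxE //.
by have /matrixP/(_ l j) := dl0; rewrite !mxE.
Qed.

(** The ray is generated by some row of [e]. Were it one of the first b rows, the corresponding row
    of the base frame would be 0, which is not primitive. *)
Lemma fibre_ray_row e i : adapted_frame e -> cone R e (realmx R (u' i)) ->
  exists l, u' i = row (rshift b l) e.
Proof.
move=> [fe dl0 [ul _] _] ei.
have [l0 lE] := ray_in_frame fanS fe (fibre_ray_primitive (i := i)) (fibre_ray_cone i) ei.
rewrite -[l0]splitK in lE; case: (fintype.split l0) lE => k /= lE; last by exists k.
have k0 : row k (ulsubmx e) = 0.
  have := congr1 lsubmx lE; rewrite row_mxKl => k0.
  by apply/rowP => j; have /rowP/(_ j) := k0; rewrite !mxE.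
have /(_ 0 0) := @frame_row_primitive _ _ k ul.
by rewrite k0 scale0r normr0 => /(_ erefl)/eqP.
Qed.

End Rays.

End TwistedFan.

(** * Characters and the analytic topology *)

Section Monomials.
Variables (K : fieldType) (n : nat).
Implicit Types (z : 'rV[K]_n) (k m : 'cV[int]_n).

(* With 0 ^ k = 0 for every k != 0, negative exponents included. *)
Definition monomial k z : K := \prod_i z 0 i ^ k i 0.

Lemma monomial0 z : monomial 0 z = 1.
Proof. by rewrite /monomial big1 // => i _; rewrite mxE. Qed.

Lemma monomialD k m z : (forall i, z 0 i = 0 -> 0 <= k i 0 /\ 0 <= m i 0) ->
  monomial (k + m) z = monomial k z * monomial m z.
Proof.
move=> km; rewrite /monomial -big_split; apply: eq_bigr => i _; rewrite mxE /=.
have [zi0|zi0] := eqVneq (z 0 i) 0; last by rewrite expfzDr.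
by have [k0 m0] := km i zi0; rewrite exprzD_ss // k0 m0.
Qed.

Lemma monomial_neq0 k z : monomial k z != 0 <-> forall i, z 0 i = 0 -> k i 0 = 0.
Proof.
rewrite /monomial; split=> [/prodf_neq0 h i zi0|h].
  by have := h i isT; rewrite expfz_eq0 zi0 eqxx andbT negbK => /eqP.
apply/prodf_neq0 => i _; rewrite expfz_eq0 negb_and negbK.
by have [/h->|] := eqVneq (z 0 i) 0; rewrite ?eqxx ?orbT.
Qed.

Lemma monomial_delta j z : monomial (delta_mx j 0) z = z 0 j.
Proof.
rewrite /monomial (bigD1 j) //= big1 => [|i ij]; last by rewrite mxE (negbTE ij).
by rewrite mxE !eqxx mulr1.
Qed.

Section Character.
Variables (e : 'M[int]_n) (I : 'I_n -> Prop) (chi : 'cV[int]_n -> K).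
Let D m := forall i, I i -> 0 <= (e *m m) i 0.
Let P m := forall i, I i -> (e *m m) i 0 = 0.
Hypothesis ue : e \in unitmx.
Hypothesis chi0 : chi 0 = 1.
Hypothesis chiD : forall m m', D m -> D m' -> chi (m + m') = chi m * chi m'.
Hypothesis chi_neq0 : forall m, chi m != 0 <-> P m.

Let PD m : P m -> D m. Proof. by move=> Pm i /Pm ->. Qed.

Let chiPD m m' : P m -> P m' -> chi (m + m') = chi m * chi m'.
Proof. by move=> /PD Dm /PD Dm'; exact: chiD. Qed.

Let P0 : P 0. Proof. by move=> i _; rewrite mulmx0 mxE. Qed.

Let PDD m m' : P m -> P m' -> P (m + m').
Proof. by move=> Pm Pm' i Ii; rewrite mulmxDr mxE Pm // Pm' // addr0. Qed.

Let PN m : P m -> P (- m).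
Proof. by move=> Pm i Ii; rewrite mulmxN mxE Pm // oppr0. Qed.

Let chiN m : P m -> chi (- m) = (chi m)^-1.
Proof.
move=> Pm; have cm := (chi_neq0 m).2 Pm; apply: (mulfI cm).
by rewrite -(chiPD Pm (PN Pm)) subrr chi0 mulfV.
Qed.

Let PMn m l : P m -> P (m *+ l).
Proof. by move=> Pm; elim: l => [|l IHl]; rewrite ?mulr0n ?mulrS //; exact: PDD. Qed.

Let chiMn m l : P m -> chi (m *+ l) = chi m ^+ l.
Proof.
by move=> Pm; elim: l => [|l IHl]; rewrite ?mulr0n // mulrS exprS chiPD ?IHl //; exact: PMn.
Qed.

Let chiZ m l : P m -> chi (l *: m) = chi m ^ l.
Proof.
move=> Pm; rewrite -[l]intz scaler_int; case: l => l; first by rewrite intz -pmulrn chiMn.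
by rewrite !NegzE intz mulrNz -pmulrn chiN ?chiMn //; exact: PMn.
Qed.

Let dual j : e *m col j (invmx e) = delta_mx j 0.
Proof. by rewrite colE mulmxA mulmxV // mul1mx. Qed.

(** A character is determined by its values on the dual basis. On [P], expand m in that basis; off
    [P] both sides are 0, which is where the convention on negative powers of 0 matches the
    extension of characters by 0. So the formula holds for every m. *)
Lemma character_monomial m :
  chi m = monomial (e *m m) (\row_j chi (col j (invmx e))).
Proof.
have [Pm|PNm] := pselect (P m); last first.
  have -> : chi m = 0 by apply/eqP; apply: contrapT => /negP/chi_neq0.
  apply/esym/eqP; apply: contrapT => /negP/monomial_neq0 mz; apply: PNm => i Ii; apply: mz.
  rewrite mxE; apply/eqP; apply: contrapT => /negP/chi_neq0/(_ i Ii).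
  by rewrite dual mxE !eqxx => /eqP; rewrite oner_eq0.
have mE : m = \sum_i (e *m m) i 0 *: col i (invmx e).
  rewrite -{1}(mulKmx ue m); apply/colP => j; rewrite mxE summxE.
  by apply: eq_bigr => i _; rewrite !mxE mulrC.
have Pt i : P ((e *m m) i 0 *: col i (invmx e)).
  move=> j Ij; rewrite -scalemxAr dual mxE [X in _ * X]mxE eqxx andbT.
  by have [<-|] := eqVneq j i; rewrite ?mulr0 // mulr1 Pm.
have -> : chi m = \prod_i chi ((e *m m) i 0 *: col i (invmx e)).
  rewrite {1}mE; suff [] : chi (\sum_i (e *m m) i 0 *: col i (invmx e)) =
      \prod_i chi ((e *m m) i 0 *: col i (invmx e)) /\
      P (\sum_i (e *m m) i 0 *: col i (invmx e)) by [].
  elim: (index_enum _) => [|i s [IHs Ps]]; first by rewrite !big_nil.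
  by rewrite !big_cons chiPD ?IHs //; split=> //; exact: PDD.
apply: eq_bigr => i _; rewrite mxE.
have [->|mi0] := eqVneq ((e *m m) i 0) 0; first by rewrite scale0r chi0.
apply: chiZ => j Ij; rewrite dual !mxE andbT.
have [ji|//] := eqVneq j i.
by move: mi0; rewrite -ji Pm ?eqxx.
Qed.

End Character.
End Monomials.

Lemma cvg_exprz (T : Type) (K : numFieldType) (F : set_system T) {FF : Filter F}
    (f : T -> K) (a : K) (k : int) :
  f @ F --> a -> (a != 0) || (0 <= k) -> (fun t => f t ^ k) @ F --> a ^ k.
Proof.
move=> fa; case: k => k ak.
  elim: k {ak} => [|k IHk]; first exact: cvg_cst.
  under eq_fun do rewrite -exprnP exprS; rewrite -exprnP exprS.
  exact: cvgM.
rewrite orbF in ak; rewrite !NegzE.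
under eq_fun do rewrite -exprnN; rewrite -exprnN.
apply: cvgV; first by rewrite expf_neq0.
elim: {ak} k.+1 => [|l IHl]; first exact: cvg_cst.
under eq_fun do rewrite exprS; rewrite exprS.
exact: cvgM.
Qed.

Lemma cvg_monomial (T : Type) (K : numFieldType) n (F : set_system T) {FF : Filter F}
    (f : T -> 'rV[K]_n) (z : 'rV[K]_n) (k : 'cV[int]_n) :
  f @ F --> z -> (forall i, z 0 i = 0 -> 0 <= k i 0) ->
  (fun t => monomial k (f t)) @ F --> monomial k z.
Proof.
move=> fz kz; apply: cvg_big => [|i _]; first exact: mul_continuous.
apply: cvg_exprz; first exact: cvg_coord.
by have [/kz->|] := eqVneq (z 0 i) 0; rewrite ?orbT.
Qed.

(** * Coordinates of a chart and their inverse *)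

Section ToricVariety.
Variables (R : realType) (n : nat) (Sigma : set (set 'rV[R]_n)).
Hypothesis fanS : is_fan Sigma.
Local Notation K := (Cplx R).
Local Notation X := (toric_variety Sigma).
Implicit Types (e : 'M[int]_n) (m : 'cV[int]_n) (x y : X) (sigma tau : set 'rV[R]_n).

Lemma toric_chartP sigma x : Sigma sigma -> toric_chart sigma x <-> orbit_cone x `<=` sigma.
Proof.
move=> Ss; split; first exact: face_subset.
by move=> xs; apply: (fan_face fanS) => //; exact: orbit_cone_in.
Qed.

Lemma toric_ext x y : orbit_cone x = orbit_cone y -> character x = character y -> x = y.
Proof.
case: x y => [s c Ss c0 cD cN] [s' c' Ss' c0' cD' cN'] /= ss cc.
move: Ss' c0' cD' cN'; rewrite -ss -cc => Ss' c0' cD' cN'.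
by congr ToricPoint; exact: Prop_irrelevance.
Qed.

Definition toric_coord e x : 'rV[K]_n := \row_j character x (col j (invmx e)).

Lemma character_frame e x m : frame Sigma e -> orbit_cone x `<=` cone R e ->
  character x m = monomial (e *m m) (toric_coord e x).
Proof.
move=> fe xe; have [ue _] := fe; have Sx := orbit_cone_in x.
apply: (character_monomial (I := fun i => orbit_cone x (realmx R (row i e))) ue).
- exact: character0.
- move=> m1 m2 D1 D2.
  by apply: characterD; apply/(dual_monoid_frameP fanS _ Sx fe xe).
- move=> m1; split=> [/character_neq0/(perp_frameP fanS _ Sx fe xe)//|P1].
  exact/character_neq0/(perp_frameP fanS _ Sx fe xe).
Qed.

Lemma toric_coord_eq0 e x j : frame Sigma e -> orbit_cone x `<=` cone R e ->
  toric_coord e x 0 j = 0 <-> orbit_cone x (realmx R (row j e)).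
Proof.
move=> fe xe; have [ue _] := fe; have Sx := orbit_cone_in x; rewrite mxE.
have dual : e *m col j (invmx e) = delta_mx j 0 by rewrite colE mulmxA mulmxV // mul1mx.
have xP : perp (orbit_cone x) (col j (invmx e)) <-> ~ orbit_cone x (realmx R (row j e)).
  split=> [/(perp_frameP fanS _ Sx fe xe) P xj|xj].
    by have /eqP := P j xj; rewrite dual mxE !eqxx oner_eq0.
  apply/(perp_frameP fanS _ Sx fe xe) => i xi; rewrite dual mxE eqxx andbT.
  by have [ij|//] := eqVneq i j; case: xj; rewrite -ij.
split=> [xj|xj].
  by apply: contrapT => /xP/character_neq0; rewrite xj eqxx.
by apply/eqP; apply: contrapT => /negP/character_neq0/xP; exact.
Qed.

Lemma toric_coord_inj e x y : frame Sigma e -> orbit_cone x `<=` cone R e ->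
  orbit_cone y `<=` cone R e -> toric_coord e x = toric_coord e y -> x = y.
Proof.
move=> fe xe ye xy; apply: toric_ext; last first.
  by apply/funext => m; rewrite (character_frame m fe xe) (character_frame m fe ye) xy.
have Sx := orbit_cone_in x; have Sy := orbit_cone_in y.
have xyI i : orbit_cone x (realmx R (row i e)) <-> orbit_cone y (realmx R (row i e)).
  by rewrite -(toric_coord_eq0 i fe xe) -(toric_coord_eq0 i fe ye) xy.
apply/seteqP; split=> z.
  move=> /(face_coordP fanS z Sx fe xe)[z0 zN].
  by apply/(face_coordP fanS z Sy fe ye); split=> // i; rewrite -xyI; exact: zN.
move=> /(face_coordP fanS z Sy fe ye)[z0 zN].
by apply/(face_coordP fanS z Sx fe xe); split=> // i; rewrite xyI; exact: zN.
Qed.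

Section Point.
Variables (e : 'M[int]_n) (fe : frame Sigma e) (z : 'rV[K]_n).

(** The orbit cone of the point with coordinates z is spanned by the generators whose coordinate is
    0. *)
Let tau : set 'rV[R]_n :=
  [set v | cone R e v /\ forall i, z 0 i != 0 -> coord e v 0 i = 0].

Let tau_in : Sigma tau. Proof. exact: frame_subcone. Qed.

Let tau_sub : tau `<=` cone R e. Proof. by move=> v []. Qed.

Let tau_row i : tau (realmx R (row i e)) <-> z 0 i = 0.
Proof.
have [ue _] := fe; split=> [[_ zi]|zi].
  apply/eqP; apply: contrapT => /negP/zi/eqP; rewrite coord_row // eqxx oner_eq0.
  exact/negP.
split=> [|j zj]; first exact: cone_gen.
by rewrite coord_row //; have [ij|//] := eqVneq i j; move: zj; rewrite -ij zi eqxx.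
Qed.

Let chi m : K := monomial (e *m m) z.

Let chi0 : chi 0 = 1.
Proof. by rewrite /chi mulmx0; exact: monomial0. Qed.

Let chiD m m' : dual_monoid tau m -> dual_monoid tau m' -> chi (m + m') = chi m * chi m'.
Proof.
move=> /(dual_monoid_frameP fanS _ tau_in fe tau_sub) Dm.
move=> /(dual_monoid_frameP fanS _ tau_in fe tau_sub) Dm'.
rewrite /chi mulmxDr; apply: monomialD => i /tau_row ti.
by split; [exact: Dm | exact: Dm'].
Qed.

Let chi_neq0 m : chi m != 0 <-> perp tau m.
Proof.
split=> [/monomial_neq0 mz|/(perp_frameP fanS _ tau_in fe tau_sub) P].
  by apply/(perp_frameP fanS _ tau_in fe tau_sub) => i /tau_row; exact: mz.
by apply/monomial_neq0 => i /tau_row; exact: P.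
Qed.

Definition toric_point : X := ToricPoint tau_in chi0 chiD chi_neq0.

Lemma toric_point_sub : orbit_cone toric_point `<=` cone R e.
Proof. exact: tau_sub. Qed.

Lemma toric_pointK : toric_coord e toric_point = z.
Proof.
apply/rowP => j; rewrite mxE /= /chi colE mulmxA mulmxV ?mul1mx; last by case: fe.
exact: monomial_delta.
Qed.

End Point.

Lemma toric_subbase_open U : toric_subbase U -> open (U : set X).
Proof.
move=> bU; exists [set U]; last by rewrite bigcup_set1.
move=> _ ->; exists [fset U]%fset; last by rewrite set_fset1 bigcap_set1.
by move=> V; rewrite inE => /eqP ->; exact/mem_set.
Qed.

Lemma toric_chart_open sigma : Sigma sigma -> open (toric_chart sigma : set X).
Proof.
move=> Ss; apply: toric_subbase_open; exists sigma, 0, setT; split=> //.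
- by move=> v _; rewrite /realmx map_mx0 mulmx0 mxE.
- exact: openT.
- by apply/seteqP; split=> x // [].
Qed.

Lemma character_cvg x m :
  dual_monoid (orbit_cone x) m -> (fun y => character y m) @ x --> character x m.
Proof.
move=> xm A; rewrite [in X in X -> _]nbhsE => -[V [oV Vx] VA].
have Sx := orbit_cone_in x.
pose U : set X := [set y | toric_chart (orbit_cone x) y /\ V (character y m)].
have Ux : nbhs x U.
  apply: open_nbhs_nbhs; split; last by split=> //; exact/toric_chartP.
  by apply: toric_subbase_open; exists (orbit_cone x), m, V.
suff : nbhs x ((fun y => character y m) @^-1` A) by [].
by apply: filterS Ux => y [_ Vy]; exact: VA.
Qed.

Lemma cvg_toric (F : set_system X) {FF : Filter F} x :
  (forall U, toric_subbase U -> U x -> F U) -> F --> x.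
Proof.
move=> FU A; rewrite [in X in X -> _]nbhsE => -[_ [[B sB <-] [C BC Cx]] sUA].
apply: filterS sUA _; apply: (@filterS _ _ _ C); first by move=> y Cy; exists C.
have [D sD CE] := sB _ BC; rewrite -CE; apply: filter_bigI => E DE.
apply: FU; last by rewrite -CE in Cx; exact: Cx.
by have := sD _ DE => /set_mem.
Qed.

Lemma toric_coord_cvg e x : frame Sigma e -> orbit_cone x `<=` cone R e ->
  toric_coord e @ x --> toric_coord e x.
Proof.
move=> fe xe; have [ue _] := fe; apply: (@cvg_mx _ _ _ _ _ (nbhs_filter x)) => i j; rewrite ord1 mxE.
under eq_fun do rewrite mxE.
apply: character_cvg; apply/(dual_monoid_frameP fanS _ (orbit_cone_in x) fe xe) => k _.
by rewrite colE mulmxA mulmxV // mul1mx mxE ler0n.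
Qed.

(** Near z no nonzero coordinate becomes 0, so the orbit cone can only lose generators and stays in
    sigma. The character is a monomial whose exponent is nonnegative wherever z has a zero
    coordinate, hence continuous at z. *)
Lemma toric_point_continuous e (fe : frame Sigma e) : continuous (toric_point fe).
Proof.
move=> z; have FF : Filter (toric_point fe @ z) := fmap_filter _ (nbhs_filter z).
apply: (@cvg_toric _ FF) => _ [sigma [m [V [Ss sm oV ->]]]] [zs Vz].
have [ue Se] := fe.
have zs' := (toric_chartP _ Ss).1 zs.
have zJ i : z 0 i = 0 -> sigma (realmx R (row i e)).
  move=> zi; apply: zs'.
  by apply/(toric_coord_eq0 i fe (@toric_point_sub e fe z)); rewrite toric_pointK.
have chart_near : \forall w \near z, toric_chart sigma (toric_point fe w).
  have wz : nbhs z [set w : 'rV[K]_n | forall i, ~ sigma (realmx R (row i e)) -> w 0 i != 0].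
    apply: (@filter_forall _ _ (fun i (w : 'rV[K]_n) => ~ sigma (realmx R (row i e)) -> w 0 i != 0) _ (nbhs_filter z)) => i.
    have [si|si] := pselect (sigma (realmx R (row i e))).
      by apply: filterE => w /(_ si).
    apply: (@filterS _ _ _ [set w : 'rV[K]_n | w 0 i != 0]) => [w wi _ //|].
    have zi : z 0 i != 0 by apply/eqP => /zJ.
    exact: (cvgr_neq0 _ (@coord_continuous K 1 n 0 i z) zi).
  apply: filterS wz => w wz; apply/toric_chartP => //.
  apply: (face_sub fanS (orbit_cone_in _) fe (@toric_point_sub e fe w) Ss) => i.
  move=> /(toric_coord_eq0 i fe (@toric_point_sub e fe w)); rewrite toric_pointK => wi.
  by apply: contrapT => /(wz i); rewrite wi eqxx.
have V_near : \forall w \near z, V (character (toric_point fe w) m).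
  have : character (toric_point fe w) m @[w --> z] --> character (toric_point fe z) m.
    apply: (@cvg_monomial _ _ _ _ (nbhs_filter z) id z) => // i /zJ/sm.
    by rewrite pairing_int row_pairing ler0z.
  by apply; exact: open_nbhs_nbhs.
by apply: filterS2 chart_near V_near => w wc wV; split.
Qed.

End ToricVariety.

(** * Compactness and separation *)

Lemma compact_bigcup_finite (T : topologicalType) (U : Type) (S : set U) (G : U -> set T) :
  finite_set S -> (forall u, S u -> compact (G u)) -> compact (\bigcup_(u in S) G u).
Proof.
move=> /finite_setP[m].
elim: m S => [|m IHm] S.
  by rewrite II0 card_eq0 => /eqP -> _; rewrite bigcup_set0; exact: compact0.
move=> /eq_cardSP[u Su SDm] cG.
rewrite (_ : \bigcup_(v in S) G v = G u `|` \bigcup_(v in S `\ u) G v).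
  by apply: compactU; [exact: cG | apply: IHm SDm _ => v [Sv _]; exact: cG].
apply/seteqP; split=> [x [v Sv Gvx]|x [Gux|[v [Sv _] Gvx]]]; [|by exists u|by exists v].
by have [vu|vu] := pselect (v = u); [left; rewrite -vu | right; exists v].
Qed.

Section ComplexNumbers.
Variable R : realType.
Local Notation K := (Cplx R).

(** The norm of [K] takes values in [K] itself; a real modulus is needed to take [ln]. *)
Definition cabs (z : K) : R := Normc.normc (z : R[i]).

Lemma cabsM (z w : K) : cabs (z * w) = cabs z * cabs w.
Proof. exact: Normc.normcM. Qed.

Lemma cabsV (z : K) : cabs z^-1 = (cabs z)^-1.
Proof. exact: Normc.normcV. Qed.

Lemma cabs1 : cabs 1 = 1.
Proof. exact: Normc.normc1. Qed.

Lemma cabs_gt0 (z : K) : z != 0 -> 0 < cabs z.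
Proof.
move=> z0; rewrite lt_neqAle; apply/andP; split.
  by apply: contra_neq z0 => /esym/Normc.eq0_normc.
by rewrite /cabs; case: (z : R[i]) => a b /=; exact: sqrtr_ge0.
Qed.

Lemma ln_cabsX (z : K) (k : int) : z != 0 -> ln (cabs (z ^ k)) = k%:~R * ln (cabs z).
Proof.
have nat_case (w : K) (l : nat) : w != 0 -> ln (cabs (w ^+ l)) = l%:R * ln (cabs w).
  move=> w0; elim: l => [|l IHl]; first by rewrite expr0 cabs1 ln1 mul0r.
  rewrite exprS cabsM lnM ?posrE ?cabs_gt0 ?expf_neq0 // IHl.
  by rewrite -[l.+1%:R]natr1 mulrDl mul1r addrC.
move=> z0; case: k => k; first by rewrite -exprnP nat_case // pmulrn.
rewrite NegzE -exprnN cabsV lnV ?posrE ?cabs_gt0 ?expf_neq0 // nat_case //.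
by rewrite mulrNz mulNr pmulrn.
Qed.

Lemma ln_cabs_monomial n (k : 'cV[int]_n) (z : 'rV[K]_n) :
  (forall i, z 0 i = 0 -> k i 0 = 0) ->
  ln (cabs (monomial k z)) = \sum_i (k i 0)%:~R * ln (cabs (z 0 i)).
Proof.
move=> kz; rewrite /monomial; suff [] : ln (cabs (\prod_i z 0 i ^ k i 0)) =
    \sum_i (k i 0)%:~R * ln (cabs (z 0 i)) /\ \prod_i z 0 i ^ k i 0 != 0 by [].
elim: (index_enum _) => [|i s [IHs s0]]; first by rewrite !big_nil cabs1 ln1 oner_neq0.
have zk0 : z 0 i ^ k i 0 != 0.
  by have [/kz->|zi0] := eqVneq (z 0 i) 0; [exact: oner_neq0 | exact: expfz_neq0].
rewrite !big_cons mulf_neq0 //; split=> //.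
rewrite cabsM lnM ?posrE ?cabs_gt0 // IHs; congr (_ + _).
have [zi0|zi0] := eqVneq (z 0 i) 0; last exact: ln_cabsX.
by rewrite kz // mul0r expr0z cabs1 ln1.
Qed.

(** A square containing the unit disc replaces it, since its compactness is that of a product of two
    segments. *)
Definition csquare : set K := [set (Complex a b : R[i]) | a in `[-1, 1] & b in `[-1, 1]].

Lemma csquare_cabs (z : K) : cabs z <= 1 -> csquare z.
Proof.
case: z => a b; rewrite /cabs /= => ab1.
have ab (x y : R) : Num.sqrt (x ^+ 2 + y ^+ 2) <= 1 -> x \in `[-1, 1].
  move=> xy; rewrite in_itv /= -ler_norml -sqrtr_sqr (le_trans _ xy) //.
  by rewrite ler_sqrt ?lerDl ?sqr_ge0 // addr_ge0 ?sqr_ge0.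
exists a; first exact: ab ab1.
by exists b => //; apply: (ab b a); rewrite addrC.
Qed.

Lemma cvg_complex (T : Type) (F : set_system T) {FF : Filter F} (f g : T -> R) (a b : R) :
  f @ F --> a -> g @ F --> b ->
  (fun t => (Complex (f t) (g t) : R[i]) : K) @ F --> ((Complex a b : R[i]) : K).
Proof.
(* The radius is a positive element of [K]; in the order of the complex numbers this means a
   positive real part and a zero imaginary part. *)
move=> fa gb; apply/cvgrPdist_lt => -[e e'] /[!ltcE] /= /andP[/eqP -> e0].
near=> t; rewrite -[ltLHS]/(`|Complex a b - Complex (f t) (g t) : R[i]|) normc_def ltcE /=.
rewrite eqxx /= (@le_lt_trans _ _ (`|a - f t| + `|b - g t|)) //.
  rewrite -(@ler_pXn2r _ 2) ?nnegrE ?sqrtr_ge0 ?addr_ge0 // sqr_sqrtr ?addr_ge0 ?sqr_ge0 //.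
  by rewrite [leRHS]sqrrD !real_normK ?num_real // lerD2r lerDl mulrn_wge0 ?mulr_ge0.
rewrite (splitr e) ltrD //.
  by near: t; apply/(cvgrPdist_lt _ _).1; rewrite ?divr_gt0.
by near: t; apply/(cvgrPdist_lt _ _).1; rewrite ?divr_gt0.
Unshelve. all: by end_near. Qed.

Lemma csquare_compact : compact csquare.
Proof.
pose g (p : R * R) : K := (Complex p.1 p.2 : R[i]).
have -> : csquare = g @` (`[-1, 1] `*` `[-1, 1]).
  apply/seteqP; split=> z; first by move=> [a a1 [b b1 <-]]; exists (a, b).
  by move=> [[a b] [/= a1 b1] <-]; exists a => //; exists b.
apply: continuous_compact; last by apply: compact_setX; exact: segment_compact.
apply: continuous_subspaceT => p.
by apply: cvg_complex; [exact: cvg_fst | exact: cvg_snd].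
Qed.

End ComplexNumbers.

(** * Toric varieties of smooth complete fans are compact and Hausdorff *)

Section HausdorffCompact.
Variables (R : realType) (n : nat) (Sigma : set (set 'rV[R]_n)).
Hypothesis fanS : is_fan Sigma.
Hypothesis smoothS : smooth_fan Sigma.
Hypothesis completeS : complete_fan Sigma.
Local Notation K := (Cplx R).
Local Notation X := (toric_variety Sigma).

Lemma toric_cluster_chart e (x y : X) : frame Sigma e -> orbit_cone x `<=` cone R e ->
  orbit_cone y `<=` cone R e -> cluster (nbhs x) y -> x = y.
Proof.
move=> fe xe ye xy; apply: (toric_coord_inj fanS fe xe ye).
apply: norm_hausdorff => A B Ax By.
have [w [Aw Bw]] := xy _ _ (toric_coord_cvg fanS fe xe Ax) (toric_coord_cvg fanS fe ye By).
by exists (toric_coord e w).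
Qed.

(** Let m separate the two cones. If m is a unit at x or at y, both points lie in one chart.
    Otherwise chi^m vanishes at x and chi^(-m) at y, so both have modulus below 1 on suitable
    neighbourhoods, while their product is 1 at a common point. *)
Lemma toric_hausdorff : hausdorff_space X.
Proof.
move=> x y xy.
have [e fe xe] := frame_face fanS smoothS completeS (orbit_cone_in x).
have [e' fe' ye'] := frame_face fanS smoothS completeS (orbit_cone_in y).
have [m [em e'm ms ms']] := frame_separation fanS fe fe'.
have Sx := orbit_cone_in x; have Sy := orbit_cone_in y.
have [xm|xm] := pselect (perp (orbit_cone x) m).
  apply: (toric_cluster_chart fe' _ ye' xy).
  apply: (face_sub fanS Sx fe xe (proj2 fe')) => i xi; apply: ms.
  exact: (perp_frameP fanS m Sx fe xe).1.
have [ym|ym] := pselect (perp (orbit_cone y) m).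
  apply: (toric_cluster_chart fe xe _ xy).
  apply: (face_sub fanS Sy fe' ye' (proj2 fe)) => i yi; apply: ms'.
  exact: (perp_frameP fanS m Sy fe' ye').1.
exfalso.
have zero_char (w : X) m' : ~ perp (orbit_cone w) m' -> character w m' = 0.
  by move=> wm; apply/eqP; apply: contrapT => /negP/character_neq0.
have dm (w : X) : orbit_cone w `<=` cone R e -> dual_monoid (orbit_cone w) m.
  by move=> we; apply/(dual_monoid_frameP fanS m (orbit_cone_in w) fe we) => i _; exact: em.
have dNm (w : X) : orbit_cone w `<=` cone R e' -> dual_monoid (orbit_cone w) (- m).
  move=> we; apply/(dual_monoid_frameP fanS (- m) (orbit_cone_in w) fe' we) => i _.
  by rewrite mulmxN mxE oppr_ge0.
have small (w : X) m' : dual_monoid (orbit_cone w) m' -> character w m' = 0 ->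
    nbhs w [set w' | `|character w' m'| < 1].
  move=> wm w0; have := character_cvg fanS wm; rewrite w0 => /cvgr0_norm_lt; apply.
  exact: ltr01.
have Nm0 : character y (- m) = 0.
  apply: zero_char => yNm; apply: ym => v /yNm; rewrite /realmx map_mxN mulmxN mxE.
  by move=> /eqP; rewrite oppr_eq0 => /eqP.
have Ux := open_nbhs_nbhs (conj (toric_chart_open (proj2 fe)) ((toric_chartP fanS x (proj2 fe)).2 xe)).
have Uy := open_nbhs_nbhs (conj (toric_chart_open (proj2 fe')) ((toric_chartP fanS y (proj2 fe')).2 ye')).
have [w [[/(toric_chartP fanS w (proj2 fe)) we wm] [/(toric_chartP fanS w (proj2 fe')) we' wNm]]] :=
  xy _ _ (filterI Ux (small _ _ (dm _ xe) (zero_char _ _ xm)))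
         (filterI Uy (small _ _ (dNm _ ye') Nm0)).
have := characterD (dm w we) (dNm w we'); rewrite subrr character0 => /(congr1 Num.norm).
rewrite normr1 normrM => w1; have : `|character w m| * `|character w (- m)| < 1.
  exact: (mulr_ilt1 (normr_ge0 _) (normr_ge0 _) wm wNm).
by rewrite -w1 ltxx.
Qed.

Definition polysquare : set 'rV[K]_n := [set z | forall i, csquare (z ord0 i)].

(** A cone around the orbit cone in the direction w of minus the logarithms of the moduli gives
    coordinates of modulus at most 1. Every frame of that cone is allowed, because the proof of
    compactness fixes one frame for each cone. *)
Lemma toric_point_polysquare (x : X) :
  exists2 e0, frame Sigma e0 & forall e, frame Sigma e -> cone R e = cone R e0 ->
    orbit_cone x `<=` cone R e /\ forall j, cabs (toric_coord e x 0 j) <= 1.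
Proof.
have Sx := orbit_cone_in x.
have [E fE xE] := frame_face fanS smoothS completeS Sx; have [uE _] := fE.
(* Where a coordinate of x is 0 the entry is only the default value of [ln]. It does not affect
   [wm], since an m in the perp pairs to 0 with that row. *)
pose w : 'rV[R]_n := (\row_i - ln (cabs (toric_coord E x 0 i))) *m realmx R E.
have wm m : perp (orbit_cone x) m ->
    (w *m realmx R m) 0 0 = - ln (cabs (character x m)).
  move=> xm; rewrite (character_frame fanS m fE xE) ln_cabs_monomial; last first.
    move=> i /(toric_coord_eq0 fanS i fE xE).
    exact: (perp_frameP fanS m Sx fE xE).1.
  rewrite -mulmxA -realmxM mxE -sumrN; apply: eq_bigr => i _.
  by rewrite realmxE [X in X * _]mxE mulrC mulrN.
have [e0 [v [fe0 xe0 xv vw]]] := frame_extend fanS smoothS completeS w Sx.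
exists e0 => // e fe ee0; have [ue _] := fe.
have xe : orbit_cone x `<=` cone R e by rewrite ee0.
split=> // j; have [xj|xj] := pselect (orbit_cone x (realmx R (row j e))).
  by rewrite (toric_coord_eq0 fanS j fe xe).2 // /cabs Normc.normc0 ler01.
have zj : toric_coord e x 0 j != 0.
  by apply/eqP => /(toric_coord_eq0 fanS j fe xe).
have xmj : perp (orbit_cone x) (col j (invmx e)).
  by apply/character_neq0; move: zj; rewrite mxE.
have vj : coord e v 0 j = 0 by have [_] := (face_coordP fanS v Sx fe xe).1 xv; apply.
have : 0 <= coord e (v + w) 0 j by move: j {zj xj xmj vj}; apply/cone_coordP => //; rewrite ee0.
rewrite /coord mulmxDl mxE -/(coord e v) vj add0r.
have -> : (w *m realmx R (invmx e)) 0 j = (w *m realmx R (col j (invmx e))) 0 0.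
  by rewrite !mxE; apply: eq_bigr => l _; rewrite !mxE.
rewrite wm // oppr_ge0 -ln1 ler_ln ?posrE ?ltr01 ?cabs_gt0 //; last by move: zj; rewrite mxE.
by rewrite [toric_coord _ _ _ _]mxE.
Qed.

Lemma toric_compact : compact [set: X].
Proof.
(* One chosen frame for each maximal cone, so that the union is indexed by the finite set
   [Sigma]. *)
pose G sigma : set X :=
  match pselect (exists e, frame Sigma e /\ cone R e = sigma) with
  | left He => toric_point fanS (proj1 (projT2 (cid He))) @` polysquare
  | right _ => set0
  end.
have [[finS _] _ _ _] := fanS.
have -> : [set: X] = \bigcup_(sigma in Sigma) G sigma.
  apply/seteqP; split=> // x _.
  have [e0 [ue0 Se0] xe0] := toric_point_polysquare x.
  exists (cone R e0) => //; rewrite /G.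
  case: pselect => [He|[]]; last by exists e0.
  case: (cid He) => e [fe ee0] /=; have [xe x1] := xe0 e fe ee0.
  exists (toric_coord e x); first by move=> i; exact: csquare_cabs.
  apply: (toric_coord_inj fanS fe _ xe); first exact: toric_point_sub.
  exact: toric_pointK.
apply: compact_bigcup_finite finS _ => sigma _; rewrite /G.
case: pselect => [He|_]; last exact: compact0.
apply: continuous_compact.
  by apply: continuous_subspaceT; exact: toric_point_continuous.
exact: (@rV_compact K n (fun=> @csquare R) (fun=> @csquare_compact R)).
Qed.

End HausdorffCompact.

(** * Monomial charts and the tangent bundle *)

Section MonomialDerivative.
Variable K : numFieldType.

Lemma is_derive_exprz (a : K) (k : int) : (a != 0) || (0 <= k) ->
  is_derive a (1 : K) (fun t : K => t ^ k) (k%:~R * a ^ (k - 1)).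
Proof.
have nat_case (l : nat) : is_derive a (1 : K) (fun t : K => t ^+ l) (l%:R * a ^+ l.-1).
  have := @is_deriveX K K id l a 1 1 (is_derive_id a 1).
  by rewrite /GRing.scale /= mulr1 exprfctE.
case: k => k ak.
  case: k {ak} => [|k]; first by rewrite mul0r; exact: is_derive_cst.
  have -> : Posz k.+1 - 1 = k by rewrite -addn1 PoszD addrK.
  exact: nat_case.
rewrite orbF in ak; have ak0 : a ^+ k.+1 != 0 by rewrite expf_neq0.
have [dk kE] := nat_case k.+1.
have -> : (fun t : K => t ^ Negz k) = (fun t : K => (t ^+ k.+1)^-1) by [].
pose f := fun t : K => t ^+ k.+1.
apply: (DeriveDef (@derivableV _ _ f _ _ ak0 dk)).
rewrite (@deriveV _ _ f _ _ ak0 dk) {}/f kE /GRing.scale /=.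
rewrite NegzE mulrNz -opprD -PoszD addn1 -exprnN mulNr mulNr pmulrn; congr (- _).
rewrite mulrCA; congr (_ * _); rewrite -exprM -exprVn.
apply: (mulfI (expf_neq0 (k.+1 * 2) ak)); rewrite mulrA divff ?expf_neq0 // mul1r.
rewrite exprVn; apply: (mulIf (expf_neq0 k.+2 ak)); rewrite mulfVK ?expf_neq0 //.
by rewrite -exprD; congr (_ ^+ _); rewrite muln2 -addnn !addSn !addnS.
Qed.

Variable n : nat.
Implicit Types (z : 'rV[K]_n) (k : 'cV[int]_n).

Lemma differentiable_exprz_coord (i : 'I_n) (l : int) z : (z 0 i != 0) || (0 <= l) ->
  differentiable (fun w : 'rV[K]_n => w 0 i ^ l : K) z.
Proof.
have nat_case (q : nat) : differentiable (fun w : 'rV[K]_n => w 0 i ^+ q : K) z.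
  case: q => [|q]; first exact: differentiable_cst.
  have := @differentiableX K _ (fun w : 'rV[K]_n => w 0 i : K) q z (differentiable_coord _ _ _).
  by rewrite exprfctE.
case: l => l zl; first exact: nat_case.
rewrite orbF in zl; apply: differentiableV; first exact: nat_case.
exact: expf_neq0.
Qed.

Lemma differentiable_monomial k z : (forall i, z 0 i = 0 -> 0 <= k i 0) ->
  differentiable (monomial k : 'rV[K]_n -> K) z.
Proof.
move=> kz; have -> : (monomial k : 'rV[K]_n -> K) = fun w => \prod_i w 0 i ^ k i 0 by [].
elim: (index_enum _) => [|i s IHs].
  by under eq_fun do rewrite big_nil; exact: differentiable_cst.
under eq_fun do rewrite big_cons.
apply: (differentiableM (f := fun w : 'rV[K]_n => w 0 i ^ k i 0 : K)) => //.
by apply: differentiable_exprz_coord; have [/kz->|] := eqVneq (z 0 i) 0; rewrite ?orbT.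
Qed.

(** When z_i = 0 and k_i = 0 the monomial on the right has a negative exponent at 0, but its
    coefficient k_i is 0, as is the derivative. *)
Lemma derive_monomial k z i : (forall i, z 0 i = 0 -> 0 <= k i 0) ->
  'D_(delta_mx 0 i) (monomial k : 'rV[K]_n -> K) z =
  (k i 0)%:~R * monomial (k - delta_mx i 0) z.
Proof.
move=> kz; pose G := \prod_(l | l != i) z 0 l ^ k l 0.
have zi : (z 0 i != 0) || (0 <= k i 0).
  by have [/kz->|] := eqVneq (z 0 i) 0; rewrite ?orbT.
have [di dE] := is_derive_exprz zi.
pose g (t : K) := t ^ k i 0.
have lineE : (fun h : K => h^-1 *: (((monomial k : 'rV[K]_n -> K) \o shift z)
      (h *: delta_mx 0 i) - monomial k z)) =
    (fun h : K => h^-1 *: (((G \o* g) \o shift (z 0 i)) (h *: (1 : K)) - (G \o* g) (z 0 i))).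
  apply/funext => h /=; congr (_ *: (_ - _)); rewrite /monomial (bigD1 i) //=.
  rewrite !mxE !eqxx /=; congr (_ * _).
  by apply: eq_bigr => l li; rewrite !mxE (negbTE li) mulr0 add0r.
rewrite /derive lineE -/(derive (G \o* g) (z 0 i) 1) deriveMr // dE mulrC -mulrA; congr (_ * _).
rewrite /monomial [RHS](bigD1 i) //= !mxE !eqxx; congr (_ * _).
by apply: eq_bigr => l li; rewrite !mxE (negbTE li) subr0.
Qed.

Lemma diff_monomial k z i : (forall i, z 0 i = 0 -> 0 <= k i 0) ->
  'd (monomial k : 'rV[K]_n -> K) z (delta_mx 0 i) =
  (k i 0)%:~R * monomial (k - delta_mx i 0) z.
Proof.
by move=> kz; rewrite -derive_monomial // deriveE //; exact: differentiable_monomial.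
Qed.

Section MonomialMap.
Variables (p : nat) (k : 'I_p -> 'cV[int]_n) (z : 'rV[K]_n).
Hypothesis kz : forall j i, z 0 i = 0 -> 0 <= k j i 0.
Let M (w : 'rV[K]_n) : 'rV[K]_p := \row_j monomial (k j) w.

Lemma differentiable_monomial_map : differentiable M z.
Proof.
have -> : M = \sum_j (fun w : 'rV[K]_n => (monomial (k j) w : K) *: (delta_mx 0 j : 'rV[K]_p)).
  apply/funext => w; rewrite [LHS]row_sum_delta fct_sumE.
  by apply: eq_bigr => j _; rewrite mxE.
apply: differentiable_sum => j.
by apply: differentiableZl; apply: differentiable_monomial; exact: kz.
Qed.

Lemma jacobian_monomial_map i j :
  jacobian M z i j = (k j i 0)%:~R * monomial (k j - delta_mx i 0) z.
Proof.
have dM := differentiable_monomial_map.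
have -> : jacobian M z i j = ('D_(delta_mx 0 i) M z) 0 j.
  by rewrite deriveEjacobian // -rowE [RHS]mxE.
rewrite -derive_monomial; last exact: kz.
apply/esym/cvg_lim => //.
have := cvg_coord (i := 0) (j := j) (diff_derivable (v := delta_mx 0 i) dM).
suff -> : (fun h : K => h^-1 *: ((monomial (k j) \o shift z) (h *: delta_mx 0 i) - monomial (k j) z)) =
    (fun h : K => (h^-1 *: ((M \o shift z) (h *: delta_mx 0 i) - M z)) 0 j) by [].
by apply/funext => h; rewrite /= !mxE.
Qed.

End MonomialMap.
End MonomialDerivative.

(** * Integer matrices twisted by characters *)

Section WeightedMatrices.
Variables (K : numFieldType) (n : nat) (chi : 'cV[int]_n -> K) (D : 'cV[int]_n -> Prop).
Hypothesis chi0 : chi 0 = 1.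
Hypothesis chiD : forall m m', D m -> D m' -> chi (m + m') = chi m * chi m'.

(** The matrix of a torus-equivariant bundle map: u and v are the weights of the source and target
    frames. Tangent, divisor and Euler matrices all have this form, and they multiply as their
    integer parts do. *)
Definition weighted_mx p q (A : 'M[int]_(p, q)) (u : 'I_p -> 'cV[int]_n)
    (v : 'I_q -> 'cV[int]_n) : 'M[K]_(p, q) :=
  \matrix_(i, j) ((A i j)%:~R * chi (v j - u i)).

(** Only nonzero entries are constrained: under a zero coefficient the exponent may leave the monoid
    on which chi is multiplicative and continuous. *)
Definition weights_compatible p q (A : 'M[int]_(p, q)) (u : 'I_p -> 'cV[int]_n)
    (v : 'I_q -> 'cV[int]_n) : Prop :=
  forall i j, A i j != 0 -> D (v j - u i).

Lemma mul_weighted_mx p q r (A : 'M[int]_(p, q)) (B : 'M[int]_(q, r)) u v w :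
  weights_compatible A u v -> weights_compatible B v w ->
  weighted_mx A u v *m weighted_mx B v w = weighted_mx (A *m B) u w.
Proof.
move=> cA cB; apply/matrixP => i k; rewrite !mxE rmorph_sum mulr_suml.
apply: eq_bigr => j _; rewrite !mxE rmorphM /=.
have [->|Aij] := eqVneq (A i j) 0; first by rewrite !mul0r.
have [->|Bjk] := eqVneq (B j k) 0; first by rewrite !mul0r !mulr0 mul0r.
have -> : w k - u i = (v j - u i) + (w k - v j) by rewrite [RHS]addrC subrKA.
by rewrite (chiD (cA i j Aij) (cB j k Bjk)) mulrACA.
Qed.

Lemma weighted_mx1 p (u : 'I_p -> 'cV[int]_n) : weighted_mx 1%:M u u = 1%:M.
Proof.
apply/matrixP => i j; rewrite !mxE.
by have [->|ij] := eqVneq i j; rewrite ?mul0r // subrr chi0 mulr1.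
Qed.

End WeightedMatrices.

Section Charts.
Variables (R : realType) (n : nat) (Sigma : set (set 'rV[R]_n)).
Hypothesis fanS : is_fan Sigma.
Hypothesis coverS : forall tau, Sigma tau -> exists2 e, frame Sigma e & tau `<=` cone R e.
Local Notation K := (Cplx R).
Local Notation X := (toric_variety Sigma).
Implicit Types (e : 'M[int]_n) (m : 'cV[int]_n) (x : X).

Definition frame_chart e : chart R X n := Chart (toric_chart (cone R e)) (toric_coord e).

Lemma toric_atlasP (c : chart R X n) :
  toric_atlas Sigma c <-> exists2 e, frame Sigma e & c = frame_chart e.
Proof.
split=> [[e [ue Se dE mE]]|[e [ue Se] ->]]; last by exists e.
by exists e; [split | case: c dE mE => d m /= -> ->].
Qed.

Lemma frame_chartP e x : frame Sigma e ->
  chart_dom (frame_chart e) x <-> orbit_cone x `<=` cone R e.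
Proof. by move=> [_ Se]; exact: (toric_chartP fanS). Qed.

Lemma frame_dual_monoid e tau j : Sigma tau -> frame Sigma e -> tau `<=` cone R e ->
  dual_monoid tau (col j (invmx e)).
Proof.
move=> St fe te; have [ue _] := fe; apply/(dual_monoid_frameP fanS _ St fe te) => i _.
by rewrite colE mulmxA mulmxV // mul1mx mxE ler0n.
Qed.

Lemma exponent_ge0 e x m i : frame Sigma e -> orbit_cone x `<=` cone R e ->
  dual_monoid (orbit_cone x) m -> toric_coord e x 0 i = 0 -> 0 <= (e *m m) i 0.
Proof.
move=> fe xe xm /(toric_coord_eq0 fanS i fe xe).
exact: (dual_monoid_frameP fanS m (orbit_cone_in x) fe xe).1.
Qed.

(** The chart is onto all of C^n, so the partial inverse is a true inverse for every z and its
    default value never occurs. *)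
Lemma frame_chart_inv e (x : X) (z : 'rV[K]_n) : frame Sigma e ->
  orbit_cone (chart_inv (frame_chart e) x z) `<=` cone R e /\
  toric_coord e (chart_inv (frame_chart e) x z) = z.
Proof.
move=> fe; have zI : (toric_coord e @` (toric_chart (cone R e) : set X)) z.
  exists (toric_point fanS fe z); last exact: toric_pointK.
  by apply/(toric_chartP fanS _ (proj2 fe)); exact: toric_point_sub.
split.
  apply/(toric_chartP fanS _ (proj2 fe)).
  apply: (@surjpinv_image_sub _ _ (fun=> x) _ _ (toric_coord e) (fun _ yI => yI)).
  by exists z.
exact: (pinvK (fun=> x) (mem_set zI)).
Qed.

Lemma character_chart_inv e m (x : X) : frame Sigma e ->
  (fun y : X => character y m) \o chart_inv (frame_chart e) x = monomial (e *m m).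
Proof.
move=> fe; apply/funext => z /=; have [xe xz] := frame_chart_inv x z fe.
by rewrite (character_frame fanS m fe xe) xz.
Qed.

Lemma transition_frame e e' (x : X) : frame Sigma e ->
  transition (frame_chart e) (frame_chart e') x =
  fun z => \row_j monomial (e *m col j (invmx e')) z.
Proof.
move=> fe; apply/funext => z; apply/rowP => j; rewrite 2!mxE.
exact: (congr1 (fun g => g z) (character_chart_inv (col j (invmx e')) x fe)).
Qed.

Lemma frame_chart_is_chart e : frame Sigma e -> is_chart (frame_chart e).
Proof.
move=> fe; split=> /=.
- exact: toric_chart_open (proj2 fe).
- by move=> x /(frame_chartP x fe) xe; exact: (toric_coord_cvg fanS fe xe).
- move=> x y /set_mem/(frame_chartP x fe) xe /set_mem/(frame_chartP y fe) ye.
  exact: (toric_coord_inj fanS fe xe ye).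
- move=> V oV Vd.
  have -> : toric_coord e @` V = toric_point fanS fe @^-1` V.
    apply/seteqP; split=> [_ [x Vx <-]|z Vz] /=; last first.
      by exists (toric_point fanS fe z) => //; exact: toric_pointK.
    have /(frame_chartP x fe) xe := Vd _ Vx.
    suff -> : toric_point fanS fe (toric_coord e x) = x by [].
    apply: (toric_coord_inj fanS fe _ xe); first exact: toric_point_sub.
    exact: toric_pointK.
  by apply: open_comp oV => z _; exact: toric_point_continuous.
Qed.

Lemma frame_chart_differentiable e e' x : frame Sigma e -> frame Sigma e' ->
  orbit_cone x `<=` cone R e -> orbit_cone x `<=` cone R e' ->
  differentiable (transition (frame_chart e) (frame_chart e') x) (toric_coord e x).
Proof.
move=> fe fe' xe xe'; rewrite transition_frame //.
apply: differentiable_monomial_map => j i.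
by apply: exponent_ge0 => //; exact: (frame_dual_monoid _ (orbit_cone_in x)).
Qed.

Lemma toric_complex_manifold : complex_manifold (toric_atlas Sigma).
Proof.
split.
- by move=> c /toric_atlasP[e fe ->]; exact: frame_chart_is_chart.
- move=> x; have [e fe xe] := coverS (orbit_cone_in x).
  exists (frame_chart e); first by apply/toric_atlasP; exists e.
  exact/(frame_chartP x fe).
- move=> c c' /toric_atlasP[e fe ->] /toric_atlasP[e' fe' ->] x.
  move=> /(frame_chartP x fe) xe /(frame_chartP x fe') xe'.
  by split; exact: frame_chart_differentiable.
Qed.

Definition dual_basis e (j : 'I_n) : 'cV[int]_n := col j (invmx e).

(* The jacobian of z'_j = prod_i z_i ^ a_ij has entries
   a_ij chi(m'_j - m_i). *)
Definition tangent_trans e e' x : 'M[K]_n :=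
  weighted_mx (character x) (e *m invmx e') (dual_basis e) (dual_basis e').

Lemma jacobian_frame e e' x : frame Sigma e -> frame Sigma e' ->
  orbit_cone x `<=` cone R e -> orbit_cone x `<=` cone R e' ->
  jacobian (transition (frame_chart e) (frame_chart e') x) (toric_coord e x) =
  tangent_trans e e' x.
Proof.
move=> fe fe' xe xe'; have [ue _] := fe; rewrite transition_frame //.
apply/matrixP => i j; rewrite jacobian_monomial_map; last first.
  by move=> l k; apply: exponent_ge0 => //; exact: (frame_dual_monoid _ (orbit_cone_in x)).
have -> : (e *m col j (invmx e')) i 0 = (e *m invmx e') i j.
  by rewrite colE mulmxA -colE mxE.
have -> : delta_mx i 0 = e *m dual_basis e i :> 'cV[int]_n.
  by rewrite [dual_basis _ _]colE mulmxA mulmxV // mul1mx.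
by rewrite [RHS]mxE (character_frame fanS _ fe xe) mulmxBr.
Qed.

Lemma mul_dual_basis e i : e \in unitmx -> e *m dual_basis e i = delta_mx i 0.
Proof. by move=> ue; rewrite [dual_basis _ _]colE mulmxA mulmxV // mul1mx. Qed.

(** Subtracting the dual vector lowers only the pairing with row i. If that row lies in tau, the
    pairing is a nonzero nonnegative integer, hence at least 1. This makes the entries of jacobians
    regular. *)
Lemma dual_monoid_sub e tau m i : Sigma tau -> frame Sigma e -> tau `<=` cone R e ->
  dual_monoid tau m -> (e *m m) i 0 != 0 -> dual_monoid tau (m - dual_basis e i).
Proof.
move=> St fe te tm mi; have [ue _] := fe.
apply/(dual_monoid_frameP fanS _ St fe te) => k tk.
have mk := (dual_monoid_frameP fanS _ St fe te).1 tm k tk.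
rewrite mulmxBr mxE [X in _ + X]mxE mul_dual_basis //.
rewrite [X in _ - X]mxE eqxx andbT subr_ge0; have [ki|_] := eqVneq k i; last exact: mk.
by rewrite -gtz0_ge1 lt_neqAle eq_sym ki mi -ki mk.
Qed.

Lemma frame_weights_compatible e e' tau : Sigma tau -> frame Sigma e -> frame Sigma e' ->
  tau `<=` cone R e -> tau `<=` cone R e' ->
  weights_compatible (dual_monoid tau) (e *m invmx e') (dual_basis e) (dual_basis e').
Proof.
move=> St fe fe' te te' i j aij; apply: dual_monoid_sub => //; first exact: frame_dual_monoid.
by rewrite /dual_basis colE mulmxA -colE mxE.
Qed.

Lemma weighted_mx_cvg p q (A : 'M[int]_(p, q)) u v x :
  weights_compatible (dual_monoid (orbit_cone x)) A u v ->
  (fun y => weighted_mx (character y) A u v) @ x --> weighted_mx (character x) A u v.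
Proof.
move=> cA; apply: (@cvg_mx _ _ _ _ _ (nbhs_filter x)) => i j; rewrite mxE.
under eq_fun do rewrite mxE.
have [->|Aij] := eqVneq (A i j) 0.
  by rewrite mul0r; under eq_fun do rewrite mul0r; exact: cvg_cst.
by apply: cvgM; [exact: cvg_cst | apply: (character_cvg fanS); exact: cA].
Qed.

Section Atlas.
Variables (I : Type) (e_ : I -> 'M[int]_n).
Hypothesis fe_ : forall i, frame Sigma (e_ i).
Hypothesis cover_ : forall x, exists i, orbit_cone x `<=` cone R (e_ i).

Definition frame_dom i : set X := toric_chart (cone R (e_ i)).

Lemma frame_domP i x : frame_dom i x <-> orbit_cone x `<=` cone R (e_ i).
Proof. exact: (toric_chartP fanS x (proj2 (fe_ i))). Qed.

Lemma is_transition_weighted r (A : I -> I -> 'M[int]_r) (u : I -> 'I_r -> 'cV[int]_n) :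
  (forall i, A i i = 1%:M) ->
  (forall i j k, A i k = A i j *m A j k) ->
  (forall i j x, orbit_cone x `<=` cone R (e_ i) -> orbit_cone x `<=` cone R (e_ j) ->
     weights_compatible (dual_monoid (orbit_cone x)) (A i j) (u i) (u j)) ->
  is_transition frame_dom (fun i j x => weighted_mx (character x) (A i j) (u i) (u j)).
Proof.
move=> A1 AM cA; split.
- by move=> i; exact: toric_chart_open (proj2 (fe_ i)).
- by move=> x; have [i xi] := cover_ x; exists i; apply/frame_domP.
- by move=> i j x /frame_domP xi /frame_domP xj; apply: weighted_mx_cvg; exact: cA.
- by move=> i x _; rewrite A1; apply: weighted_mx1; exact: character0.
- move=> i j k x /frame_domP xi /frame_domP xj /frame_domP xk; rewrite (AM i j k).
  apply/esym/(mul_weighted_mx (D := dual_monoid (orbit_cone x))).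
  + exact: characterD.
  + exact: cA.
  + exact: cA.
Qed.

Lemma is_transition_tangent :
  is_transition frame_dom (fun i j => tangent_trans (e_ i) (e_ j)).
Proof.
have ue_ i : e_ i \in unitmx by case: (fe_ i).
apply: is_transition_weighted.
- by move=> i; rewrite mulmxV.
- by move=> i j k; rewrite mulmxA mulmxKV.
- by move=> i j x; exact: (frame_weights_compatible (orbit_cone_in x)).
Qed.

End Atlas.

Definition atlas_frame (c : toric_atlas Sigma) : 'M[int]_n :=
  sval (cid2 ((toric_atlasP (set_val c)).1 (set_valP c))).

Lemma atlas_frameP c : frame Sigma (atlas_frame c) /\ set_val c = frame_chart (atlas_frame c).
Proof. by rewrite /atlas_frame; case: cid2. Qed.

Lemma is_transition_tangent_bundle :
  is_transition (fun c : toric_atlas Sigma => chart_dom (set_val c))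
    (@vb_trans _ _ _ (tangent_bundle (toric_atlas Sigma))).
Proof.
have domE : (fun c : toric_atlas Sigma => chart_dom (set_val c)) = frame_dom atlas_frame.
  by apply/funext => c; rewrite (atlas_frameP c).2.
have fA c : frame Sigma (atlas_frame c) := (atlas_frameP c).1.
rewrite domE; apply: is_transition_ext (is_transition_tangent fA _) _ => [x|c c' x].
  have [e fe xe] := coverS (orbit_cone_in x).
  have eA : toric_atlas Sigma (frame_chart e) by apply/toric_atlasP; exists e.
  exists (exist _ (frame_chart e) (mem_set eA)).
  apply/(frame_domP fA); rewrite -domE; exact/(frame_chartP x fe).
move=> /(frame_domP fA) xc /(frame_domP fA) xc' /=.
rewrite (atlas_frameP c).2 (atlas_frameP c').2.
exact: jacobian_frame.
Qed.

(** Any covering family of frames may replace the full atlas; it is used with the adapted frames. *)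
Lemma chern_tangent_frames (t : chern_theory R) (I : Type) (e_ : I -> 'M[int]_n) :
  (forall i, frame Sigma (e_ i)) -> (forall x, exists i, orbit_cone x `<=` cone R (e_ i)) ->
  chern t (VBundle (frame_dom e_) (fun i j => tangent_trans (e_ i) (e_ j))) =
  chern t (tangent_bundle (toric_atlas Sigma)).
Proof.
move=> fe_ cover_.
have eA i : toric_atlas Sigma (frame_chart (e_ i)) by apply/toric_atlasP; exists (e_ i).
apply: (chern_refine (g := fun i => exist _ (frame_chart (e_ i)) (mem_set (eA i)))
  t is_transition_tangent_bundle (is_transition_tangent fe_ cover_)).
- by move=> i x.
- move=> i j x /(frame_domP fe_) xi /(frame_domP fe_) xj /=.
  by rewrite jacobian_frame.
Qed.

End Charts.

(** * Line bundles of invariant divisors *)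

Section Divisor.
Variables (R : realType) (n : nat) (Sigma : set (set 'rV[R]_n)).
Hypothesis fanS : is_fan Sigma.
Hypothesis coverS : forall tau, Sigma tau -> exists2 e, frame Sigma e & tau `<=` cone R e.
Local Notation K := (Cplx R).
Local Notation X := (toric_variety Sigma).
Implicit Types (e : 'M[int]_n) (m : 'cV[int]_n) (x : X).
Variable u : 'rV[int]_n.
Hypothesis primitive_u : primitive u.
Hypothesis ray_u : Sigma (cone R u).

Lemma row_frame_inj e k l : e \in unitmx -> row k e = row l e -> k = l.
Proof.
move=> ue kl; have := congr1 (fun v => (v *m invmx e) 0 k) kl.
rewrite -!row_mul mulmxV // !mxE eqxx; have [//|_ /eqP] := eqVneq l k.
by rewrite oner_eq0.
Qed.

(* The exponent of the local equation of the divisor of u in the chart of e. *)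
Definition divisor_weight e : 'cV[int]_n :=
  if [pick l | row l e == u] is Some l then dual_basis e l else 0.

Lemma divisor_weight_row e l : e \in unitmx -> row l e = u -> divisor_weight e = dual_basis e l.
Proof.
move=> ue lu; rewrite /divisor_weight; case: pickP => [k /eqP ku|/(_ l)]; last by rewrite lu eqxx.
by congr (dual_basis e _); apply: (row_frame_inj ue); rewrite ku lu.
Qed.

Lemma mul_divisor_weight e k : e \in unitmx ->
  (e *m divisor_weight e) k 0 = (row k e == u)%:R.
Proof.
move=> ue; rewrite /divisor_weight; case: pickP => [l /eqP lu|->]; last by rewrite mulmx0 mxE.
rewrite mul_dual_basis // mxE eqxx andbT -lu.
by have [->|kl] := eqVneq k l; [rewrite eqxx | case: eqP => // /(row_frame_inj ue)/eqP; rewrite (negbTE kl)].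
Qed.

Section OneCone.
Variables (tau : set 'rV[R]_n) (St : Sigma tau).

Lemma divisor_weight_dual e : frame Sigma e -> tau `<=` cone R e ->
  dual_monoid tau (divisor_weight e).
Proof.
move=> fe te; apply/(dual_monoid_frameP fanS _ St fe te) => k _.
by rewrite mul_divisor_weight ?ler0n //; case: fe.
Qed.

(** Generators of tau are rows of both frames, and both weights take the value 1 on u and 0 on the
    other generators. So the quotient of two local equations is a unit. *)
Lemma divisor_weight_perp e e' : frame Sigma e -> frame Sigma e' ->
  tau `<=` cone R e -> tau `<=` cone R e' -> perp tau (divisor_weight e' - divisor_weight e).
Proof.
move=> fe fe' te te'; have [ue _] := fe; have [ue' _] := fe'.
apply/(perp_frameP fanS _ St fe te) => k tk.
rewrite mulmxBr mxE [X in _ + X]mxE mul_divisor_weight //.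
have [k' kk'] := ray_in_frame fanS fe' (frame_row_primitive (l := k) ue)
  (frame_row_cone fanS k fe) (te' _ tk).
by rewrite -row_pairing kk' row_pairing mul_divisor_weight // subrr.
Qed.

Lemma perp_divisor_weight e : frame Sigma e -> tau `<=` cone R e ->
  perp tau (divisor_weight e) <-> ~ tau (realmx R u).
Proof.
move=> fe te; have [ue _] := fe; split=> [/(perp_frameP fanS _ St fe te) P tu|tu].
  have [l lE] := ray_in_frame fanS fe primitive_u ray_u (te _ tu).
  have := P l; rewrite -lE => /(_ tu)/eqP.
  by rewrite mul_divisor_weight // lE eqxx oner_eq0.
apply/(perp_frameP fanS _ St fe te) => k tk; rewrite mul_divisor_weight //.
by case: eqP => // ku; case: tu; rewrite -ku.
Qed.

End OneCone.

Lemma character_divisor_eq0 e x : frame Sigma e -> orbit_cone x `<=` cone R e ->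
  character x (divisor_weight e) = 0 <-> orbit_cone x (realmx R u).
Proof.
move=> fe xe; have xP := perp_divisor_weight (orbit_cone_in x) fe xe.
split=> [x0|xu]; first by apply: contrapT => /xP/character_neq0; rewrite x0 eqxx.
by apply/eqP; apply: contrapT => /negP/character_neq0/xP.
Qed.

(** The closure of O(rho) is the union of the orbits whose cone contains rho. Charts are open, which
    gives one inclusion; for the other, x is a limit of points of O(rho) inside one chart. *)
Lemma toric_divisorP x : toric_divisor Sigma (cone R u) x <-> orbit_cone x (realmx R u).
Proof.
split=> [Dx|xu].
  have Sx := orbit_cone_in x.
  have Ux : nbhs x (toric_chart (orbit_cone x) : set X).
    apply: open_nbhs_nbhs; split; first exact: toric_chart_open.
    exact/(toric_chartP fanS x Sx).
  have [y [yu /(toric_chartP fanS y Sx) yx]] := Dx _ Ux.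
  by apply: yx; rewrite yu; have := cone_gen R u 0; rewrite row_id.
have [e fe xe] := coverS (orbit_cone_in x); have [ue _] := fe.
have [l lE] := ray_in_frame fanS fe primitive_u ray_u (xe _ xu).
have zl : toric_coord e x 0 l = 0 by apply/(toric_coord_eq0 fanS l fe xe); rewrite -lE.
(* All zero coordinates except the l-th are moved to t. For t != 0 only the l-th vanishes, so the
   orbit cone is the ray; at t = 0 the point is x. *)
pose z (t : K) : 'rV[K]_n := \row_i
  (if (toric_coord e x 0 i == 0) && (i != l) then t else toric_coord e x 0 i).
have z0 : z 0 = toric_coord e x.
  apply/rowP => i; rewrite mxE; case: ifP => // /andP[/eqP -> _] //.
have cz : z t @[t --> (0 : K)] --> z 0.
  apply: (@cvg_mx _ _ _ _ _ (nbhs_filter (0 : K))) => i j; rewrite mxE; under eq_fun do rewrite mxE.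
  by case: ifP => _; [exact: cvg_id | exact: cvg_cst].
have xE : toric_point fanS fe (z 0) = x.
  apply: (toric_coord_inj fanS fe _ xe); first exact: toric_point_sub.
  by rewrite toric_pointK.
move=> B Bx.
have zB : \forall t \near (0 : K), B (toric_point fanS fe (z t)).
  have zB0 : nbhs (z 0) (toric_point fanS fe @^-1` B).
    by apply: (@toric_point_continuous _ _ _ fanS e fe); rewrite xE.
  exact: cz _ zB0.
have [t [Bt t0]] := filter_ex (filterI (nbhs_dnbhs zB) (nbhs_dnbhs_neq (0 : K))).
exists (toric_point fanS fe (z t)); split=> //=.
rewrite lE cone_rowE //; apply/seteqP; split=> v /= [ev vl]; split=> // i.
  move=> il; apply: vl; rewrite mxE il andbT.
  by case: ifP => // /negbT.
have [->|il _] := eqVneq i l; last exact: vl.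
by rewrite mxE eqxx andbF zl eqxx.
Qed.

Lemma defining_function_divisor e : frame Sigma e ->
  defining_function (toric_atlas Sigma) (toric_divisor Sigma (cone R u))
    (toric_chart (cone R e)) (fun x => character x (divisor_weight e)).
Proof.
move=> fe; have [ue _] := fe.
split.
- apply/seteqP; split=> x /=.
    move=> [/toric_divisorP xu /(toric_chartP fanS x (proj2 fe)) xe]; split.
      exact/(toric_chartP fanS x (proj2 fe)).
    exact/(character_divisor_eq0 fe xe).
  move=> [/(toric_chartP fanS x (proj2 fe)) xe /(character_divisor_eq0 fe xe) xu].
  by split; [exact/toric_divisorP | exact/(toric_chartP fanS x (proj2 fe))].
- move=> c x /(toric_atlasP _)[e' fe' ->] /(toric_chartP fanS x (proj2 fe)) xe.
  move=> /(frame_chartP fanS x fe') xe'.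
  have -> := character_chart_inv fanS (divisor_weight e) x fe'.
  apply: differentiable_monomial => i; apply: (exponent_ge0 fanS fe' xe').
  exact: divisor_weight_dual (orbit_cone_in x) _ fe xe.
- move=> c x /(toric_atlasP _)[e' fe' ->] /(toric_chartP fanS x (proj2 fe)) xe.
  move=> /(frame_chartP fanS x fe') xe' /toric_divisorP xu.
  have [ue' _] := fe'.
  have [l lE] := ray_in_frame fanS fe primitive_u ray_u (xe _ xu).
  have [l' lE'] := ray_in_frame fanS fe' primitive_u ray_u (xe' _ xu).
  (* Along the coordinate of u in the second chart the exponent is 1, so the derivative is the
     quotient of the two local equations, which is a unit. *)
  exists (delta_mx 0 l').
  have -> := character_chart_inv fanS (divisor_weight e) x fe'.
  rewrite diff_monomial; last first.
    move=> i; apply: (exponent_ge0 fanS fe' xe').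
    exact: divisor_weight_dual (orbit_cone_in x) _ fe xe.
  rewrite -row_pairing -lE' lE row_pairing mul_divisor_weight // -lE eqxx mul1r.
  rewrite -(mul_dual_basis l' ue') -mulmxBr -(character_frame fanS _ fe' xe').
  apply/character_neq0; rewrite -(divisor_weight_row ue' (esym lE')).
  exact: (divisor_weight_perp (orbit_cone_in x)).
Qed.

Section Atlas.
Variables (I : Type) (e_ : I -> 'M[int]_n).
Hypothesis fe_ : forall i, frame Sigma (e_ i).
Hypothesis cover_ : forall x, exists i, orbit_cone x `<=` cone R (e_ i).

Definition divisor_trans i j x : K := character x (divisor_weight (e_ j) - divisor_weight (e_ i)).

Lemma is_transition_divisor :
  is_transition (@frame_dom _ _ Sigma _ e_) (fun i j x => (divisor_trans i j x)%:M : 'M[K]_1).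
Proof.
apply: (is_transition_ext (is_transition_weighted fanS fe_ cover_
  (A := fun _ _ => 1%:M) (u := fun i _ => divisor_weight (e_ i)) _ _ _)).
- by [].
- by move=> *; rewrite mulmx1.
- move=> i j x xi xj p q _ v xv.
  by rewrite (divisor_weight_perp (orbit_cone_in x) (fe_ i) (fe_ j) xi xj xv).
- by move=> i j x _ _; apply/matrixP => p q; rewrite !ord1 !mxE mul1r.
Qed.

Lemma chern_divisor_frames (c : chern_theory R) :
  compact [set: X] -> hausdorff_space X ->
  chern c (VBundle (@frame_dom _ _ Sigma _ e_) (fun i j x => (divisor_trans i j x)%:M : 'M[K]_1)) =
  cpoly_lin (poincare_dual (toric_atlas Sigma) (toric_divisor Sigma (cone R u))).
Proof.
move=> cX hX; apply: chern_divisor => //.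
- exact: toric_complex_manifold.
- exact: is_transition_divisor.
exists (fun i x => character x (divisor_weight (e_ i))); split=> /=.
  by move=> i; exact: defining_function_divisor.
move=> i j x /(frame_domP fanS fe_) xi /(frame_domP fanS fe_) xj.
have Dd : dual_monoid (orbit_cone x) (divisor_weight (e_ j) - divisor_weight (e_ i)).
  move=> v xv; rewrite (divisor_weight_perp (orbit_cone_in x) (fe_ i) (fe_ j) xi xj xv).
  exact: lexx.
have Di := divisor_weight_dual (orbit_cone_in x) (fe_ i) xi.
by rewrite [X in _ * X]mxE eqxx mulr1n -(characterD Di Dd) addrC subrK.
Qed.

End Atlas.
End Divisor.

(** * The relative tangent bundle *)

Lemma block_mul_invmx (b f : nat) (e e' : 'M[int]_(b + f)) :
  e' \in unitmx -> ulsubmx e' \in unitmx -> drsubmx e' \in unitmx ->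
  dlsubmx e = 0 -> dlsubmx e' = 0 ->
  [/\ dlsubmx (e *m invmx e') = 0,
      ulsubmx (e *m invmx e') = ulsubmx e *m invmx (ulsubmx e') &
      drsubmx (e *m invmx e') = drsubmx e *m invmx (drsubmx e')].
Proof.
move=> ue' ul' ur' dl0 dl0'.
set A := e *m invmx e'.
have e'E : e' = block_mx (ulsubmx e') (ursubmx e') 0 (drsubmx e') by rewrite -dl0' submxK.
have eE : block_mx (ulsubmx A) (ursubmx A) (dlsubmx A) (drsubmx A) *m
    block_mx (ulsubmx e') (ursubmx e') 0 (drsubmx e') = e by rewrite submxK -e'E mulmxKV.
rewrite mulmx_block !mulmx0 !addr0 in eE.
have edl : dlsubmx A *m ulsubmx e' = 0 by rewrite -dl0 -[in RHS]eE block_mxKdl.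
have edl0 : dlsubmx A = 0 by rewrite -[LHS](mulmxK ul') edl mul0mx.
split=> //; first by rewrite -[in RHS]eE block_mxKul mulmxK.
by rewrite -[in RHS]eE block_mxKdr edl0 mul0mx add0r mulmxK.
Qed.

Lemma mul_row_single (K : nzRingType) (r f : nat) (a : 'rV[K]_r) (A : 'M[K]_(r, f)) l k :
  A l k = 1 -> (forall l', l' != l -> a 0 l' = 0 \/ A l' k = 0) -> (a *m A) 0 k = a 0 l.
Proof.
move=> lk aA; rewrite mxE (bigD1 l) //= lk mulr1 big1 ?addr0 // => l' /aA[->|->].
  by rewrite mul0r.
by rewrite mulr0.
Qed.

(** [D] becomes singular on the divisors, but it stays injective on the kernel of [U]. The image of
    that kernel lies in the kernel of [A], and both have dimension r - f. *)
Lemma diag_ker_exact (K : fieldType) (r f : nat) (D : 'M[K]_r) (A U : 'M[K]_(r, f))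
    (P : 'M[K]_f) :
  D *m A = U *m P -> row_full A -> row_full U ->
  (forall a : 'rV[K]_r, a *m D = 0 -> a *m U = 0 -> a = 0) ->
  [/\ row_free (row_base (kermx U) *m D),
      (row_base (kermx U) *m D == kermx A)%MS & row_full A].
Proof.
move=> DA fA fU inj; have WU : row_base (kermx U) *m U = 0.
  by apply/sub_kermxP; rewrite eq_row_base.
have fW : row_free (row_base (kermx U) *m D).
  apply/inj_row_free => a; rewrite mulmxA => aD.
  apply: (row_free_inj (row_base_free (kermx U))); rewrite mul0mx.
  by apply: inj aD _; rewrite -mulmxA WU mulmx0.
split=> //.
have sub : (row_base (kermx U) *m D <= kermx A)%MS.
  by apply/sub_kermxP; rewrite -mulmxA DA mulmxA WU mul0mx.
rewrite -(mxrank_leqif_eq sub) (eqP fW) !mxrank_ker.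
by rewrite (eqP fA) (eqP fU).
Qed.

Section TransitionPullback.
Variables (K : numFieldType) (X Y : topologicalType) (p : X -> Y).

Lemma is_transition_pullback (I : Type) (dom : I -> set Y) r (g : I -> I -> Y -> 'M[K]_r) :
  continuous p -> is_transition dom g ->
  is_transition (fun i => p @^-1` dom i) (fun i j x => g i j (p x)).
Proof.
move=> cp [odom cov cg g1 gM]; split.
- by move=> i; apply: open_comp (odom i) => x _; exact: cp.
- by move=> x; exact: cov.
- by move=> i j x ix jx; apply: (continuous_comp (cp x)); exact: cg.
- by move=> i x; exact: g1.
- by move=> i j k x; exact: gM.
Qed.

End TransitionPullback.

(** * Vertical and horizontal parts of the tangent bundle *)

Section FiberedToric.
Variables (R : realType) (b f r : nat).
Variables (SigmaB : set (set 'rV[R]_b)) (SigmaF : set (set 'rV[R]_f)).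
Variables (Phi : 'rV[R]_b -> 'rV[R]_f).
Local Notation Sigma := (twisted_product SigmaB Phi SigmaF).
Hypothesis fanB : is_fan SigmaB.
Hypothesis fanF : is_fan SigmaF.
Hypothesis Phi_linear : conewise_linear SigmaB Phi.
Hypothesis fanS : is_fan Sigma.
Hypothesis smoothS : smooth_fan Sigma.
Hypothesis completeS : complete_fan Sigma.
Local Notation K := (Cplx R).
Local Notation X := (toric_variety Sigma).
Variable p : continuousType X (toric_variety SigmaB).
Hypothesis p_proj : is_toric_morphism Sigma SigmaB (col_mx 1%:M 0) p.
Variable u : 'I_r -> 'rV[int]_f.
Hypothesis rays : ray_generators SigmaF u.
Variable c : chern_theory R.

Let coverS tau (St : Sigma tau) := frame_face fanS smoothS completeS St.

(** All bundles below are trivialized over the charts of adapted frames, so that sequences are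
    checked chart by chart over one index type. *)
Let I := {e : 'M[int]_(b + f) | adapted_frame SigmaB SigmaF Phi e}.
Let E (i : I) : 'M[int]_(b + f) := sval i.

Let aE i : adapted_frame SigmaB SigmaF Phi (E i).
Proof. exact: svalP. Qed.

Let fE i : frame Sigma (E i). Proof. by case: (aE i). Qed.
Let fB i : frame SigmaB (ulsubmx (E i)). Proof. by case: (aE i). Qed.
Let uE i : E i \in unitmx. Proof. by case: (fE i). Qed.
Let uB i : ulsubmx (E i) \in unitmx. Proof. by case: (fB i). Qed.
Let uF i : drsubmx (E i) \in unitmx. Proof. by case: (aE i) => _ _ _ []. Qed.
Let dl0 i : dlsubmx (E i) = 0. Proof. by case: (aE i). Qed.

Let coverE (x : X) : exists i, orbit_cone x `<=` cone R (E i).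
Proof.
have [e ae xe] := adapted_cover fanB fanF Phi_linear fanS smoothS completeS (orbit_cone_in x).
by exists (exist _ e ae).
Qed.

Local Notation dom := (@frame_dom _ _ Sigma _ E).

Let domP i x : dom i x <-> orbit_cone x `<=` cone R (E i).
Proof. exact: (frame_domP fanS fE). Qed.

Let TX i j (x : X) : 'M[K]_(b + f) := tangent_trans (E i) (E j) x.
Let TV i j (x : X) : 'M[K]_f := weighted_mx (character x)
  (drsubmx (E i) *m invmx (drsubmx (E j)))
  (fun k => dual_basis (E i) (rshift b k)) (fun k => dual_basis (E j) (rshift b k)).
Let TB i j (x : X) : 'M[K]_b := weighted_mx (character x)
  (ulsubmx (E i) *m invmx (ulsubmx (E j)))
  (fun k => dual_basis (E i) (lshift f k)) (fun k => dual_basis (E j) (lshift f k)).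

Let EE i j := block_mul_invmx (uE j) (uB j) (uF j) (dl0 i) (dl0 j).

Let tTX : is_transition dom TX. Proof. exact: (is_transition_tangent fanS fE coverE). Qed.

Let tTV : is_transition dom TV.
Proof.
apply: (is_transition_weighted fanS fE coverE).
- by move=> i; rewrite mulmxV.
- by move=> i j k; rewrite mulmxA mulmxKV.
- move=> i j x xi xj k l; have [_ _ <-] := EE i j; rewrite 2!mxE.
  exact: (frame_weights_compatible fanS (orbit_cone_in x) (fE i) (fE j) xi xj).
Qed.

Let tTB : is_transition dom TB.
Proof.
apply: (is_transition_weighted fanS fE coverE).
- by move=> i; rewrite mulmxV.
- by move=> i j k; rewrite mulmxA mulmxKV.
- move=> i j x xi xj k l; have [_ <- _] := EE i j; rewrite 2!mxE.
  exact: (frame_weights_compatible fanS (orbit_cone_in x) (fE i) (fE j) xi xj).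
Qed.

Let TXE i j x : TX i j x = block_mx (TB i j x) (ursubmx (TX i j x)) 0 (TV i j x).
Proof.
have [dl ul dr] := EE i j.
rewrite -[LHS]submxK; congr block_mx; apply/matrixP => k l.
- have ulE : (E i *m invmx (E j)) (lshift f k) (lshift f l) =
      (ulsubmx (E i) *m invmx (ulsubmx (E j))) k l by rewrite -ul [RHS]mxE [RHS]mxE.
  by rewrite [LHS]mxE [LHS]mxE [LHS]mxE [RHS]mxE ulE.
- have dlE : (E i *m invmx (E j)) (rshift b k) (lshift f l) = 0.
    by have /matrixP/(_ k l) := dl; rewrite [LHS]mxE [LHS]mxE [RHS]mxE.
  by rewrite [LHS]mxE [LHS]mxE [LHS]mxE [RHS]mxE dlE mul0r.
- have drE : (E i *m invmx (E j)) (rshift b k) (rshift b l) =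
      (drsubmx (E i) *m invmx (drsubmx (E j))) k l by rewrite -dr [RHS]mxE [RHS]mxE.
  by rewrite [LHS]mxE [LHS]mxE [LHS]mxE [RHS]mxE drE.
Qed.

Lemma chern_relative_tangent :
  chern c (tangent_bundle (toric_atlas Sigma)) =
  cpoly_mul (chern c (VBundle dom TV)) (chern c (VBundle dom TB)).
Proof.
rewrite -(chern_tangent_frames fanS coverS c fE coverE).
apply: (chern_exact (h := fun _ _ => row_mx 0 1%:M) (k := fun _ _ => col_mx 1%:M 0) c tTV tTX tTB).
- by move=> i x _; exact: cst_continuous.
- by move=> i x _; exact: cst_continuous.
- move=> i j x _ _; rewrite TXE mul_row_block mul_mx_row !mulmx0 !mul0mx mul1mx mulmx1.
  by rewrite !add0r.
- move=> i j x _ _; rewrite TXE mul_block_col mul_col_mx !mulmx0 !mul0mx mul1mx mulmx1.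
  by rewrite !addr0.
- by move=> i x _; exact: row_mx_01_exact.
Qed.

Let coverB tau (Bt : SigmaB tau) := base_frame_cover fanB fanF Phi_linear fanS smoothS completeS Bt.

Let projE (v : 'rV[R]_(b + f)) : v *m realmx R (col_mx 1%:M 0) = lsubmx v.
Proof.
rewrite /realmx map_col_mx -{1}[v]hsubmxK mul_row_col.
have -> : map_mx intr (0 : 'M[int]_(f, b)) = 0 :> 'M[R]_(f, b) by exact: map_mx0.
have -> : map_mx intr (1%:M : 'M[int]_b) = 1%:M :> 'M[R]_b by exact: map_mx1.
by rewrite mulmx0 addr0 mulmx1.
Qed.

Let proj_chart i x : dom i x -> orbit_cone (p x) `<=` cone R (ulsubmx (E i)).
Proof.
move=> xi; apply/(toric_chartP fanB _ (proj2 (fB i))).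
apply: (p_proj (proj2 (fE i)) (proj2 (fB i)) _ xi).1 => v vi.
by rewrite projE; exact: (adapted_proj (aE i)).
Qed.

Let dual_basis_proj i k :
  col_mx 1%:M 0 *m dual_basis (ulsubmx (E i)) k = dual_basis (E i) (lshift f k).
Proof.
have A0 : E i *m (col_mx 1%:M 0 *m dual_basis (ulsubmx (E i)) k) = delta_mx (lshift f k) 0.
  rewrite mulmxA -{1}[E i]submxK dl0 mul_block_col !mulmx1 !mulmx0 !addr0 mul_col_mx mul0mx.
  rewrite mul_dual_basis //; apply/colP => l; rewrite [LHS]mxE [RHS]mxE.
  case: splitP => l' ll'; rewrite mxE -!val_eqE /= ll' //.
  by rewrite gtn_eqF // ltn_addr.
by rewrite -[LHS](mulKmx (uE i)) A0 -[RHS](mulKmx (uE i)) mul_dual_basis.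
Qed.

Lemma chern_base_tangent :
  chern c (VBundle dom TB) = cpoly_pullback p (chern c (tangent_bundle (toric_atlas SigmaB))).
Proof.
have vB := is_transition_tangent_bundle fanB coverB.
have eA i : toric_atlas SigmaB (frame_chart SigmaB (ulsubmx (E i))).
  by apply/toric_atlasP; exists (ulsubmx (E i)).
have vB' : is_vbundle (tangent_bundle (toric_atlas SigmaB)) by exact: vB.
rewrite -(chern_pullback c p vB').
apply: (chern_refine c (is_transition_pullback (@cts_fun _ _ p) vB) tTB
  (g := fun i => exist _ (frame_chart SigmaB (ulsubmx (E i))) (mem_set (eA i)))).
- move=> i x xi; exact/(frame_chartP fanB (p x) (fB i))/proj_chart.
- move=> i j x xi xj.
  have pi := proj_chart xi; have pj := proj_chart xj.
  rewrite [RHS](jacobian_frame fanB (fB i) (fB j) pi pj).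
  apply/matrixP => k l; rewrite [LHS]mxE [RHS]mxE.
  have [->|A0] := eqVneq ((ulsubmx (E i) *m invmx (ulsubmx (E j))) k l) 0.
    by rewrite !mul0r.
  congr (_ * _).
  (* The toric morphism relates characters only on the dual monoid of a base cone containing the
     image of the orbit cone. On the common face of the two base cones the weights of nonzero
     entries lie in that monoid; the zero entries were set aside for this reason. *)
  pose sigma := cone R (ulsubmx (E i)) `&` cone R (ulsubmx (E j)).
  have [_ _ faces /(_ _ _ (proj2 (fB i)) (proj2 (fB j)))[face_i _]] := fanB.
  have Bs : SigmaB sigma by exact: (faces _ _ (proj2 (fB i)) face_i).
  have xs v : orbit_cone x v -> sigma (v *m realmx R (col_mx 1%:M 0)).
    move=> xv; rewrite projE; split.
      by apply: (adapted_proj (aE i)); exact: (domP i x).1.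
    by apply: (adapted_proj (aE j)); exact: (domP j x).1.
  have xx : toric_chart (orbit_cone x) x by exact/(toric_chartP fanS x (orbit_cone_in x)).
  have [_ ->] := p_proj (orbit_cone_in x) Bs xs xx.
    by rewrite mulmxBr !dual_basis_proj.
  apply: (frame_weights_compatible fanB Bs (fB i) (fB j)) A0.
  + by move=> v [].
  + by move=> v [].
Qed.

(** * The relative Euler sequence *)

Let u' l : 'rV[int]_(b + f) := row_mx 0 (u l).
Let mu i l := divisor_weight (u' l) (E i).
Let V := diag_trans (fun l i j (x : X) => divisor_trans (u' l) E i j x : K).

Let prim l : primitive (u' l). Proof. exact: (fibre_ray_primitive rays). Qed.
Let ray l : Sigma (cone R (u' l)).
Proof. exact: (fibre_ray_cone fanB fanF Phi_linear fanS smoothS completeS rays). Qed.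

Let tL l : is_transition dom (fun i j x => (divisor_trans (u' l) E i j x)%:M : 'M[K]_1).
Proof. exact: (is_transition_divisor fanS (u' l) fE coverE). Qed.

Let tV : is_transition dom V.
Proof. by have [odom cov _ _ _] := tTX; exact: (is_transition_diag odom cov tL). Qed.

Lemma chern_fibre_divisors :
  chern c (VBundle dom V) =
  \big[cpoly_mul/cpoly1]_(l < r)
    cpoly_lin (poincare_dual (toric_atlas Sigma) (toric_divisor Sigma (cone R (row_mx 0 (u l))))).
Proof.
have [odom cov _ _ _] := tTX; rewrite (chern_diag c odom cov tL).
have cX := toric_compact fanS smoothS completeS.
have hX := toric_hausdorff fanS smoothS completeS.
apply: eq_bigr => l _.
exact: (chern_divisor_frames fanS coverS (@prim l) (ray l) fE coverE c cX hX).
Qed.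

Let U : 'M[int]_(r, f) := \matrix_l u l.
Let Q i : 'M[int]_(r, f) := U *m invmx (drsubmx (E i)).
Let db i k := dual_basis (E i) (rshift b k).
Let euler i (x : X) : 'M[K]_(r, f) := weighted_mx (character x) (Q i) (mu i) (db i).

Let QE i l k : Q i l k = (u' l *m db i k) 0 0.
Proof.
have -> : u' l = row_mx 0 (u l *m invmx (drsubmx (E i))) *m E i.
  by rewrite -{2}[E i]submxK dl0 mul_row_block !mul0mx mulmx0 !add0r mulmxKV.
rewrite -mulmxA mul_dual_basis // -colE [RHS]mxE row_mxEr.
by rewrite -[u l](rowK u) -row_mul [RHS]mxE.
Qed.

Let Q_row i l k k' : u' l = row (rshift b k) (E i) -> Q i l k' = (k == k')%:R.
Proof.
move=> lE; rewrite QE lE row_pairing mul_dual_basis // mxE eqxx andbT.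
by rewrite -!val_eqE /= eqn_add2l.
Qed.

(** A ray outside the chart has local equation 1, that is, weight 0; a ray inside is one of the last
    f rows of the frame. *)
Let ray_cases i l : (exists2 k, u' l = row (rshift b k) (E i) & mu i l = db i k) \/ mu i l = 0.
Proof.
rewrite /mu /divisor_weight; case: pickP => [a /eqP la|_]; [left|by right].
have [|k kE] := fibre_ray_row fanB fanF Phi_linear fanS smoothS completeS rays (i := l) (aE i).
  by rewrite -/(u' l) -la; exact: cone_gen.
by exists k => //; congr dual_basis; apply: (row_frame_inj (uE i)); rewrite la -kE.
Qed.

(** For a ray in the chart the row of [Q] is a unit vector, and its nonzero entry has weight 0. For
    the other rays the weight is a dual basis vector, so no poles arise. *)
Let euler_compatible i x : dom i x ->
  weights_compatible (dual_monoid (orbit_cone x)) (Q i) (mu i) (db i).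
Proof.
move=> /domP xi l k Qlk; case: (ray_cases i l) => [[k' lE ->]|->]; last first.
  by rewrite subr0; exact: (frame_dual_monoid fanS _ (orbit_cone_in x) (fE i) xi).
move: Qlk; rewrite (Q_row _ lE); have [->|//] := eqVneq k' k => _.
by rewrite subrr => v _; rewrite /realmx map_mx0 mulmx0 mxE.
Qed.

Let mu_perp i j l x : dom i x -> dom j x -> perp (orbit_cone x) (mu j l - mu i l).
Proof.
by move=> /domP xi /domP xj; exact: (divisor_weight_perp fanS _ (orbit_cone_in x) (fE i) (fE j) xi xj).
Qed.

Let perp_dual (tau : set 'rV[R]_(b + f)) m : perp tau m -> dual_monoid tau m.
Proof. by move=> tm v tv; rewrite (tm v tv). Qed.

Let VE i j x : V i j x = weighted_mx (character x) 1%:M (mu i) (mu j).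
Proof.
apply/matrixP => l l'; rewrite [LHS]mxE [RHS]mxE [X in X *+ _]mxE mxE.
by have [->|_] := eqVneq l l'; [rewrite mulr1n mul1r | rewrite mulr0n mul0r].
Qed.

Let euler_trans i j x : dom i x -> dom j x -> euler i x *m TV i j x = V i j x *m euler j x.
Proof.
move=> xi xj; have cD := @characterD _ _ _ x.
rewrite VE (mul_weighted_mx cD (euler_compatible xi)); last first.
  move=> k l; have [_ _ <-] := EE i j; rewrite 2!mxE.
  apply: (frame_weights_compatible fanS (orbit_cone_in x) (fE i) (fE j)); exact/domP.
rewrite (mul_weighted_mx cD _ (euler_compatible xj)); last first.
  move=> l l'; rewrite mxE; have [->|//] := eqVneq l l' => _.
  by apply: perp_dual; exact: mu_perp.
by rewrite mul1mx /Q mulmxA mulmxKV.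
Qed.

(* The kernel of euler is trivial: its sections are the linear relations W among
   the u_l, twisted by the local equations of the divisors. *)
Let UK : 'M[K]_(r, f) := map_mx intr U.
Let s := \rank (kermx UK).
Let W : 'M[K]_(s, r) := row_base (kermx UK).
Let G i (x : X) : 'M[K]_r := diag_mx (\row_l character x (mu i l)).

(** The relation D A = U P required by [diag_ker_exact], from chi^mu_l chi^(m_k - mu_l) =
    chi^m_k. *)
Let GE i x : dom i x -> G i x *m euler i x =
  UK *m (map_mx intr (invmx (drsubmx (E i))) *m diag_mx (\row_k character x (db i k))).
Proof.
move=> xi; rewrite mulmxA -map_mxM mul_diag_mx mul_mx_diag; apply/matrixP => l k.
rewrite [LHS]mxE [RHS]mxE [X in X * _ = _]mxE [X in _ * X = _]mxE [X in _ = _ * X]mxE.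
rewrite [X in _ = X * _]mxE -/(Q i) mulrCA.
have [->|Qlk] := eqVneq (Q i l k) 0; first by rewrite !mul0r.
congr (_ * _); have /domP xe := xi.
have dmu := divisor_weight_dual fanS (u' l) (orbit_cone_in x) (fE i) xe.
by rewrite -(characterD dmu (euler_compatible xi Qlk)) addrC subrK.
Qed.

Let ray_of i : exists kappa : 'I_f -> 'I_r, forall k, row (rshift b k) (E i) = u' (kappa k).
Proof. by have [kappa kE] := choice (fun k => adapted_row_ray fanF rays k (aE i)); exists kappa. Qed.

Let row_full_rowsub (F : fieldType) (A : 'M[F]_(r, f)) (kappa : 'I_f -> 'I_r) :
  rowsub kappa A \in unitmx -> row_full A.
Proof.
rewrite -row_full_unit /row_full => /eqP kA; rewrite eqn_leq rank_leq_col /=.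
by rewrite -{1}kA mxrankS // rowsub_sub.
Qed.

(** The rays that are rows of the frame itself select an identity submatrix. *)
Let euler_full i x : row_full (euler i x).
Proof.
have [kappa kE] := ray_of i; apply: (@row_full_rowsub _ _ kappa).
suff -> : rowsub kappa (euler i x) = 1%:M by exact: unitmx1.
apply/matrixP => k k'; rewrite [LHS]mxE [LHS]mxE [RHS]mxE.
rewrite (Q_row _ (esym (kE k))); have [<-|_] := eqVneq k k'; last by rewrite mul0r.
by rewrite /mu (divisor_weight_row (uE i) (kE k)) subrr character0 mulr1.
Qed.

(** The fibre block of an adapted frame is an invertible submatrix; the chart around x provides such
    a frame. *)
Let UK_full (x : X) : row_full UK.
Proof.
have [i xi] := coverE x; have [kappa kE] := ray_of i.
apply: (@row_full_rowsub _ _ kappa).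
suff -> : rowsub kappa UK = map_mx intr (drsubmx (E i)).
  have : map_mx intr (drsubmx (E i)) *m map_mx intr (invmx (drsubmx (E i))) = 1%:M :> 'M[K]_f.
    by rewrite -map_mxM mulmxV // map_mx1.
  by case/mulmx1_unit.
apply/matrixP => k k'; rewrite [LHS]mxE [LHS]mxE [X in X%:~R = _]mxE [RHS]mxE; congr (_%:~R).
have /rowP/(_ (rshift b k')) := kE k; rewrite /u' row_mxEr => <-.
by rewrite [LHS]mxE [RHS]mxE [RHS]mxE.
Qed.


(** For rays outside the chart the diagonal entry is 1, so a G = 0 kills those coordinates of a.
    What remains is a relation among rows of a basis, and [Q] reads off its coefficients one by
    one. *)
Let G_inj i x (a : 'rV[K]_r) : a *m G i x = 0 -> a *m UK = 0 -> a = 0.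
Proof.
move=> aG aU.
have aQ : a *m map_mx intr (Q i) = 0 by rewrite /Q map_mxM mulmxA aU mul0mx.
have a0 l : mu i l = 0 -> a 0 l = 0.
  move=> l0; have /rowP/(_ l) := aG.
  by rewrite /G mul_mx_diag [LHS]mxE [X in _ * X = _]mxE l0 character0 mulr1 [RHS]mxE.
apply/rowP => l; rewrite [RHS]mxE.
case: (ray_cases i l) => [[k lE _]|]; last exact: a0.
have /rowP/(_ k) := aQ; rewrite [RHS]mxE (@mul_row_single _ _ _ _ _ l) => [//||l' l'l].
  by rewrite mxE (Q_row _ lE) eqxx.
case: (ray_cases i l') => [[k' l'E _]|/a0]; [right|by left].
rewrite mxE (Q_row _ l'E); have [k'k|//] := eqVneq k' k.
case/eqP: l'l; apply: (rays.1).
have : u' l' = u' l by rewrite l'E lE k'k.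
by rewrite /u' => /(congr1 (@rsubmx _ _ _ _)); rewrite !row_mxKr.
Qed.

Let character_cts i x l : dom i x -> (fun y => character y (mu i l)) @ x --> character x (mu i l).
Proof.
move=> /domP xi; apply: (character_cvg fanS).
exact: (divisor_weight_dual fanS (u' l) (orbit_cone_in x) (fE i) xi).
Qed.

Let G_cvg i x : dom i x -> G i @ x --> G i x.
Proof.
move=> xi; apply: (@cvg_mx _ _ _ _ _ (nbhs_filter x)) => k l.
rewrite [X in _ --> X]mxE [X in _ --> X *+ _]mxE.
rewrite (_ : (fun y => G i y k l) = (fun y => character y (mu i k) *+ (k == l))); last first.
  by apply/funext => y; rewrite [LHS]mxE [X in X *+ _]mxE.
case: (k == l); first exact: character_cts.
exact: cvg_cst.
Qed.

Let tO : is_transition dom (fun _ _ _ => 1%:M : 'M[K]_s).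
Proof.
have [odom cov _ _ _] := tTX; split; [exact: odom|exact: cov|..].
- by move=> i j x _ _; exact: cst_continuous.
- by [].
- by move=> *; rewrite mulmx1.
Qed.

Let GV i j x : dom i x -> dom j x -> G i x *m V i j x = G j x.
Proof.
move=> xi xj; rewrite mul_mx_diag; apply/matrixP => k l.
rewrite [LHS]mxE [X in X * _ = _]mxE [X in X *+ _ * _ = _]mxE [X in _ * X = _]mxE.
rewrite [RHS]mxE [X in _ = X *+ _]mxE.
have [->|_] := eqVneq k l; last by rewrite !mulr0n mul0r.
have /domP xe := xi.
have dmu := divisor_weight_dual fanS (u' l) (orbit_cone_in x) (fE i) xe.
rewrite !mulr1n /divisor_trans -(characterD dmu (perp_dual (mu_perp l xi xj))).
by rewrite addrC subrK.
Qed.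

Lemma chern_euler : chern c (VBundle dom V) = chern c (VBundle dom TV).
Proof.
have -> : chern c (VBundle dom V) =
    cpoly_mul (chern c (VBundle dom (fun _ _ _ => 1%:M : 'M[K]_s))) (chern c (VBundle dom TV)).
  apply: (chern_exact (h := fun i x => W *m G i x) (k := euler) c tO tV tTV).
  - by move=> i x xi; apply: (cvg_mulmx (FF := nbhs_filter x)); [exact: cvg_cst | exact: G_cvg].
  - by move=> i x xi; apply: (weighted_mx_cvg fanS); exact: euler_compatible.
  - by move=> i j x xi xj; rewrite mul1mx -mulmxA (GV xi xj).
  - by move=> i j x xi xj; rewrite (euler_trans xi xj).
  - move=> i x xi.
    exact: (diag_ker_exact (GE xi) (euler_full i x) (UK_full x) (@G_inj i x)).
have -> : chern c (VBundle dom (fun _ _ _ => 1%:M : 'M[K]_s)) = cpoly1.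
  rewrite -(chern_trivial c X s).
  by apply: (chern_refine c (is_transition_trivial _ _ s) tO (g := fun=> tt)).
exact: (cpoly1_mul_chern c tTV).
Qed.

Lemma chern_tangent_fibered :
  chern c (tangent_bundle (toric_atlas Sigma)) =
  cpoly_mul
    (cpoly_pullback p (chern c (tangent_bundle (toric_atlas SigmaB))))
    (\big[cpoly_mul/cpoly1]_(l < r)
      cpoly_lin (poincare_dual (toric_atlas Sigma)
        (toric_divisor Sigma (cone R (row_mx 0 (u l)))))).
Proof.
rewrite -chern_fibre_divisors chern_euler -chern_base_tangent chern_relative_tangent.
exact: (chern_mulC c tTV tTB).
Qed.

End FiberedToric.

Theorem proposition3p7 (R : realType) (b f r : nat)
    (SigmaB : set (set 'rV[R]_b)) (SigmaF : set (set 'rV[R]_f))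
    (Phi : 'rV[R]_b -> 'rV[R]_f) (Sigma : set (set 'rV[R]_(b + f)))
    (e : 'I_r -> 'rV[int]_f)
    (p : continuousType (toric_variety Sigma) (toric_variety SigmaB))
    (c : chern_theory R)
    (fanB : is_fan SigmaB) (fanF : is_fan SigmaF)
    (Phi_linear : conewise_linear SigmaB Phi)
    (SigmaE : Sigma = twisted_product SigmaB Phi SigmaF)
    (fanS : is_fan Sigma) (smoothS : smooth_fan Sigma)
    (completeS : complete_fan Sigma)
    (p_proj : is_toric_morphism Sigma SigmaB (col_mx 1%:M 0) p)
    (rays : ray_generators SigmaF e) :
  chern c (tangent_bundle (toric_atlas Sigma)) =
  cpoly_mul
    (cpoly_pullback p
      (chern c (tangent_bundle (toric_atlas SigmaB))))
    (\big[cpoly_mul/cpoly1]_(i < r)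
      cpoly_lin (poincare_dual (toric_atlas Sigma)
        (toric_divisor Sigma (cone R (row_mx 0 (e i)))))).
Proof.
subst Sigma.
exact: (chern_tangent_fibered fanB fanF Phi_linear fanS smoothS completeS p_proj rays c).
Qed.
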